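(* Let $n\ge1$ be an integer and let $\psi\in L^2(\mathbb{R}^{2n},\mathbb{H})$ be an admissible quaternion shearlet such that, for $u,v,t\in\mathbb{R}^n$, $$\mathcal{F}_Q(\psi)(u,v)e^{-2j\pi v\cdot t}=e^{-2j\pi v\cdot t}\mathcal{F}_Q(\psi)(u,v)\quad\text{and}\quad \mathcal{F}_Q(j\psi)(u,v)e^{-2j\pi v\cdot t}=j\,e^{-2j\pi v\cdot t}\mathcal{F}_Q(\psi)(u,v).$$ Then: 1. (Parseval) for all $f,g\in L^2(\mathbb{R}^{2n},\mathbb{H})$, $\ \langle \mathcal{SH}_\psi^Q(f),\mathcal{SH}_\psi^Q(g)\rangle_\mu=C_\psi\,(f,g)_Q$; 2. (Plancherel) for every $f\in L^2(\mathbb{R}^{2n},\mathbb{H})$, $$\int_{\mathbb{R}}\int_{\mathbb{R}^{2n-1}}\int_{\mathbb{R}^{2n}}|\mathcal{SH}_\psi^Q(f)(a,s,t)|^2\,d\mu(a,s,t)=C_\psi\,\|f\|_2^2 .$$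
   Context: $\mathbb{H}$ is the real quaternion algebra with units $i,j,k$, conjugation $\overline{q}$, modulus $|q|$ and real (scalar) part $Sc(q)$. For $f,g:\mathbb{R}^{2n}\to\mathbb{H}$ in $L^2$: $\|f\|_2=(\int_{\mathbb{R}^{2n}}|f(x)|^2dx)^{1/2}$ and $(f,g)_Q=\int_{\mathbb{R}^{2n}}Sc(f(x)\overline{g(x)})\,dx$. $\mathbb{R}^*=\mathbb{R}\setminus\{0\}$. The (two-sided) quaternion Fourier transform of $f\in L^1\cap L^2(\mathbb{R}^{2n},\mathbb{H})$ is $\mathcal{F}_Q(f)(u,v)=\int_{\mathbb{R}^{2n}}e^{-2i\pi u\cdot x}f(x,y)e^{-2j\pi v\cdot y}\,dx\,dy$ with $x,y,u,v\in\mathbb{R}^n$; it extends to a norm-preserving operator on $L^2(\mathbb{R}^{2n},\mathbb{H})$. For $a\in\mathbb{R}^*$, $s\in\mathbb{R}^{2n-1}$: $A_a=\begin{pmatrix} a & 0^T\\ 0 & \mathrm{sg}(a)|a|^{\frac1{2n}}I_{2n-1}\end{pmatrix}$ ($\mathrm{sg}$ is the sign) and $S_s=\begin{pmatrix}1 & s^T\\ 0 & I_{2n-1}\end{pmatrix}$, both $2n\times 2n$. For $t\in\mathbb{R}^{2n}$, $\psi_{a,s,t}(x)=|a|^{\frac1{4n}-1}\psi(A_a^{-1}S_s^{-1}(x-t))$. Put $\psi^*(x)=\overline{\psi(-x)}$. A function $\psi\in L^2(\mathbb{R}^{2n},\mathbb{H})$ is an admissible quaternion shearlet iff $C_\psi:=\int_{\mathbb{R}^{2n}}\frac{|\mathcal{F}_Q(\psi^*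 )(\lambda)|^2}{|\lambda_1|^{2n}}\,d\lambda<\infty$, where $\lambda=(\lambda_1,\dots,\lambda_{2n})$. The continuous quaternion shearlet transform is $\mathcal{SH}_\psi^Q(f)(a,s,t)=\int_{\mathbb{R}^{2n}}f(x)\overline{\psi_{a,s,t}(x)}\,dx$. $\mu$ is the measure $d\mu(a,s,t)=\frac{da\,ds\,dt}{|a|^{2n+1}}$ on $\mathbb{R}^*\times\mathbb{R}^{2n-1}\times\mathbb{R}^{2n}$, and for $F,G\in L^2(d\mu)$, $\langle F,G\rangle_\mu=\int Sc\big(F(a,s,t)\overline{G(a,s,t)}\big)\,d\mu(a,s,t)$. *)

(* Defs.v *)
From HB Require Import structures.
From mathcomp Require Import all_boot all_order all_algebra.
From mathcomp Require Import all_classical all_reals all_analysis.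
From mathcomp Require Import measurable_realfun ring.

Set Implicit Arguments.
Unset Strict Implicit.
Unset Printing Implicit Defensive.
Import Order.TTheory GRing.Theory Num.Theory.
Import numFieldNormedType.Exports.

Local Open Scope classical_set_scope.
Local Open Scope ring_scope.

(* Quat a b c d is a + b i + c j + d k. *)
Record quat (R : Type) := Quat { q0 : R ; q1 : R ; q2 : R ; q3 : R }.

Section QuaternionAlgebra.
Variable R : rcfType.
Implicit Types p q r : quat R.

Lemma quatP p q :
  [/\ q0 p = q0 q, q1 p = q1 q, q2 p = q2 q & q3 p = q3 q] -> p = q.
Proof. by case: p => a b c d; case: q => a' b' c' d' /= [-> -> -> ->]. Qed.

Definition quat_tuple q := (q0 q, q1 q, q2 q, q3 q).
Definition tuple_quat (t : R * R * R * R) :=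
  Quat t.1.1.1 t.1.1.2 t.1.2 t.2.

Lemma quat_tupleK : cancel quat_tuple tuple_quat.
Proof. by case. Qed.

HB.instance Definition _ := Equality.copy (quat R) (can_type quat_tupleK).
HB.instance Definition _ := Choice.copy (quat R) (can_type quat_tupleK).

Definition qadd p q :=
  Quat (q0 p + q0 q) (q1 p + q1 q) (q2 p + q2 q) (q3 p + q3 q).
Definition qopp q := Quat (- q0 q) (- q1 q) (- q2 q) (- q3 q).
Definition qzero : quat R := Quat 0 0 0 0.
Definition qone : quat R := Quat 1 0 0 0.
Definition qmul p q :=
  Quat (q0 p * q0 q - q1 p * q1 q - q2 p * q2 q - q3 p * q3 q)
       (q0 p * q1 q + q1 p * q0 q + q2 p * q3 q - q3 p * q2 q)
       (q0 p * q2 q - q1 p * q3 q + q2 p * q0 q + q3 p * q1 q)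
       (q0 p * q3 q + q1 p * q2 q - q2 p * q1 q + q3 p * q0 q).
Definition qscale (a : R) q := Quat (a * q0 q) (a * q1 q) (a * q2 q) (a * q3 q).

Lemma qaddA : associative qadd.
Proof. by move=> p q r; apply: quatP; split; rewrite /= addrA. Qed.
Lemma qaddC : commutative qadd.
Proof. by move=> p q; apply: quatP; split; rewrite /= addrC. Qed.
Lemma qadd0 : left_id qzero qadd.
Proof. by move=> p; apply: quatP; split; rewrite /= add0r. Qed.
Lemma qaddN : left_inverse qzero qopp qadd.
Proof. by move=> p; apply: quatP; split; rewrite /= addNr. Qed.

HB.instance Definition _ :=
  GRing.isZmodule.Build (quat R) qaddA qaddC qadd0 qaddN.

Lemma qmulA : associative qmul.
Proof. by move=> p q r; apply: quatP; split; rewrite /=; ring. Qed.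
Lemma qmul1q : left_id qone qmul.
Proof. by move=> p; apply: quatP; split; rewrite /=; ring. Qed.
Lemma qmulq1 : right_id qone qmul.
Proof. by move=> p; apply: quatP; split; rewrite /=; ring. Qed.
Lemma qmulDl : left_distributive qmul qadd.
Proof. by move=> p q r; apply: quatP; split; rewrite /=; ring. Qed.
Lemma qmulDr : right_distributive qmul qadd.
Proof. by move=> p q r; apply: quatP; split; rewrite /=; ring. Qed.
Lemma qone_neq0 : qone != 0 :> quat R.
Proof. by apply/eqP => -[/eqP]; rewrite oner_eq0. Qed.

HB.instance Definition _ :=
  GRing.Zmodule_isNzRing.Build (quat R)
    qmulA qmul1q qmulq1 qmulDl qmulDr qone_neq0.

Lemma qscaleA a b q : qscale a (qscale b q) = qscale (a * b) q.
Proof. by apply: quatP; split; rewrite /= mulrA. Qed.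
Lemma qscale1 : left_id 1 qscale.
Proof. by move=> q; apply: quatP; split; rewrite /= mul1r. Qed.
Lemma qscaleDr : right_distributive qscale +%R.
Proof. by move=> a p q; apply: quatP; split; rewrite /= mulrDr. Qed.
Lemma qscaleDl q : {morph qscale^~ q : a b / a + b}.
Proof. by move=> a b; apply: quatP; split; rewrite /= mulrDl. Qed.

HB.instance Definition _ :=
  GRing.Zmodule_isLmodule.Build R (quat R) qscaleA qscale1 qscaleDr qscaleDl.

Lemma qscaleAl (a : R) p q : a *: (p * q) = (a *: p) * q.
Proof. by apply: quatP; split; rewrite /=; ring. Qed.

HB.instance Definition _ :=
  GRing.Lmodule_isLalgebra.Build R (quat R) qscaleAl.

Definition qi : quat R := Quat 0 1 0 0.
Definition qj : quat R := Quat 0 0 1 0.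
Definition qk : quat R := Quat 0 0 0 1.

Lemma quat_units :
  [/\ qi * qi = -1, qj * qj = -1, qk * qk = -1, qi * qj = qk & qj * qi = - qk].
Proof. by split; apply: quatP; split; rewrite /=; ring. Qed.

Definition qSc q : R := q0 q.
Definition qconj q := Quat (q0 q) (- q1 q) (- q2 q) (- q3 q).
Definition qmod q : R :=
  Num.sqrt (q0 q ^+ 2 + q1 q ^+ 2 + q2 q ^+ 2 + q3 q ^+ 2).

End QuaternionAlgebra.

Arguments qi {R}.
Arguments qj {R}.
Arguments qk {R}.

(* e^{theta w} for a quaternion w with w^2 = -1. *)
Definition qexp (R : realType) (w : quat R) (theta : R) : quat R :=
  cos theta *: 1 + sin theta *: w.

Fact measure_cV_display : measure_display.
Proof. exact: default_measure_display. Qed.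

(* R^m is 'cV[R]_m; its sigma-algebra is generated by the coordinate
   functions, i.e. it is the Borel one. *)
Section MeasurableColumn.
Variables (R : realType) (m : nat).

Definition cV_coord (i : 'I_m) (x : 'cV[R]_m) : measurableTypeR R := x i ord0.

Let cV_measurable0 : g_sigma_preimage cV_coord set0.
Proof. exact: sigma_algebra0. Qed.

Let cV_measurableC A :
  g_sigma_preimage cV_coord A -> g_sigma_preimage cV_coord (~` A).
Proof. exact: sigma_algebraC. Qed.

Let cV_measurable_bigcup (F : (set 'cV[R]_m)^nat) :
  (forall i, g_sigma_preimage cV_coord (F i)) ->
  g_sigma_preimage cV_coord (\bigcup_i F i).
Proof. exact: sigma_algebra_bigcup. Qed.

HB.instance Definition _ := @isMeasurable.Build measure_cV_display
  'cV[R]_m (g_sigma_preimage cV_coord)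
  cV_measurable0 cV_measurableC cV_measurable_bigcup.

Lemma measurable_cV_coord (i : 'I_m) :
  measurable_fun [set: 'cV[R]_m] (cV_coord i).
Proof.
move=> _ Y mY; rewrite setTI; apply: sub_sigma_algebra => /=.
rewrite -bigcup_seq/=; exists i => /=; first by rewrite mem_index_enum.
by exists Y => //; rewrite setTI.
Qed.

Lemma measurable_fun_cV d (T : measurableType d) (f : T -> 'cV[R]_m) :
  (forall i, measurable_fun [set: T] (cV_coord i \o f)) ->
  measurable_fun [set: T] f.
Proof.
move=> mf.
suff h : g_sigma_preimage cV_coord `<=` [set A | measurable (f @^-1` A)].
  by move=> _ A mA; rewrite setTI; exact: h.
apply: smallest_sub => /=.
  split => /=.
  - by rewrite preimage_set0.
  - move=> A mA; rewrite setTD preimage_setC; exact: measurableC.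
  - by move=> F mF; rewrite preimage_bigcup; exact: bigcupT_measurable.
move=> A; rewrite -bigcup_seq/= => -[i _ [B mB <-]].
have := mf i measurableT B mB.
by rewrite !setTI comp_preimage.
Qed.

End MeasurableColumn.

Section ColumnCons.
Variables (R : realType) (m : nat).

Definition cV_cons (p : measurableTypeR R * 'cV[R]_m) : 'cV[R]_m.+1 :=
  col_mx (p.1%:M : 'cV[R]_1) p.2.

Definition cV_uncons (x : 'cV[R]_m.+1) : measurableTypeR R * 'cV[R]_m :=
  (x ord0 ord0, dsubmx (x : 'cV[R]_(1 + m))).

Lemma cV_consK : cancel cV_cons cV_uncons.
Proof.
case=> a x; rewrite /cV_uncons /cV_cons /=; congr pair; last by rewrite col_mxKd.
by rewrite mxE; case: splitP => [j _|//]; rewrite !ord1 mxE eqxx mulr1n.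
Qed.

Lemma cV_unconsK : cancel cV_uncons cV_cons.
Proof.
move=> x; rewrite /cV_cons /cV_uncons /=.
rewrite (_ : (x ord0 ord0)%:M = usubmx (x : 'cV[R]_(1 + m))).
  exact: (@vsubmxK _ 1 m 1 x).
apply/matrixP => i j; rewrite !ord1 !mxE eqxx mulr1n.
by congr (x _ _); exact/val_inj.
Qed.

Lemma measurable_cV_cons : measurable_fun setT cV_cons.
Proof.
apply: measurable_fun_cV => i.
rewrite /cV_coord /cV_cons /comp.
have [j ij|k ik] := @splitP 1 m i.
  rewrite (_ : (fun _ => _) = fst) //; apply/funext => p /=.
  have -> : i = lshift m j by exact/val_inj.
  by rewrite (@col_mxEu _ 1 m) !ord1 mxE eqxx mulr1n.
rewrite (_ : (fun _ => _) = cV_coord k \o snd); last first.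
  apply/funext => p /=; have -> : i = rshift 1 k by exact/val_inj.
  by rewrite (@col_mxEd _ 1 m).
apply: measurableT_comp => //; exact: measurable_cV_coord.
Qed.

Lemma measurable_cV_uncons : measurable_fun setT cV_uncons.
Proof.
apply/measurable_fun_pairP; split.
  rewrite (_ : fst \o _ = cV_coord ord0) //; exact: measurable_cV_coord.
apply: measurable_fun_cV => i.
rewrite (_ : _ \o _ = cV_coord (rshift 1 i : 'I_m.+1)).
  exact: measurable_cV_coord.
by apply/funext => x; rewrite /cV_coord /= mxE.
Qed.

End ColumnCons.

Lemma sigma_finite_product d1 d2 (T1 : measurableType d1)
    (T2 : measurableType d2) (R : realType)
    (m1 : {sigma_finite_measure set T1 -> \bar R})
    (m2 : {sigma_finite_measure set T2 -> \bar R}) :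
  sigma_finite setT (m1 \x m2)%E.
Proof.
have /sigma_finiteP[F [TF ndF Foo]] := sigma_finiteT m1.
have /sigma_finiteP[G [TG ndG Goo]] := sigma_finiteT m2.
exists (fun k => F k `*` G k).
  rewrite -setXTT TF TG predeqE => -[x y]; split.
    move=> [/= [k _ Fkx] [l _ Gly]]; exists (maxn k l) => //; split.
    - by move: x Fkx; exact/subsetPset/ndF/leq_maxl.
    - by move: y Gly; exact/subsetPset/ndG/leq_maxr.
  by move=> [k _ []/= ? ?]; split; exists k.
move=> k; have [? ?] := Foo k; have [? ?] := Goo k.
split; first exact: measurableX.
by rewrite product_measure1E// lte_mul_pinfty// ge0_fin_numE.
Qed.

Section LebesgueStep.
Local Open Scope ereal_scope.
Variables (R : realType) (m : nat).
Variable nu : {sigma_finite_measure set 'cV[R]_m -> \bar R}.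

Definition lebesgue_step : set 'cV[R]_m.+1 -> \bar R :=
  pushforward (@lebesgue_measure R \x nu) (@cV_cons R m).

Let step_pre A : measurable A -> measurable (@cV_cons R m @^-1` A).
Proof. by move=> mA; rewrite -[X in measurable X]setTI; exact: measurable_cV_cons. Qed.

Let lebesgue_step0 : lebesgue_step set0 = 0.
Proof. by rewrite /lebesgue_step /pushforward preimage_set0 measure0. Qed.

Let lebesgue_step_ge0 A : 0 <= lebesgue_step A.
Proof. by apply: integral_ge0 => *; exact: measure_ge0. Qed.

Let lebesgue_step_sigma_additive : semi_sigma_additive lebesgue_step.
Proof.
move=> F mF tF mUF; rewrite /lebesgue_step /pushforward preimage_bigcup.
apply: measure_semi_sigma_additive.
- by move=> k; exact: step_pre.
- apply/trivIsetP => /= i j _ _ ij; rewrite -preimage_setI.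
  by move/trivIsetP : tF => /(_ _ _ _ _ ij) ->//; rewrite preimage_set0.
- by rewrite -preimage_bigcup; exact: step_pre.
Qed.

HB.instance Definition _ := isMeasure.Build _ _ _ lebesgue_step
  lebesgue_step0 lebesgue_step_ge0 lebesgue_step_sigma_additive.

Let lebesgue_step_sigma_finite : sigma_finite setT lebesgue_step.
Proof.
have [F FT mF] := sigma_finite_product (@lebesgue_measure R) nu.
exists (fun k => @cV_uncons R m @^-1` F k).
  by rewrite -preimage_bigcup -FT preimage_setT.
move=> k; have [mFk Fkoo] := mF k; split.
  by rewrite -[X in measurable X]setTI; exact: measurable_cV_uncons.
rewrite /lebesgue_step /pushforward -comp_preimage.
rewrite (_ : @cV_uncons R m \o @cV_cons R m = id) //.
by apply/funext => p /=; rewrite cV_consK.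
Qed.

HB.instance Definition _ := Measure_isSigmaFinite.Build _ _ _
  lebesgue_step lebesgue_step_sigma_finite.

End LebesgueStep.

Fixpoint lebesgue_cV (R : realType) (m : nat) :
    {sigma_finite_measure set 'cV[R]_m -> \bar R} :=
  match m with
  | 0 => \d_ (0 : 'cV[R]_0)
  | m'.+1 => lebesgue_step (lebesgue_cV R m')
  end.

Section QuaternionValued.
Context d (T : measurableType d) (R : realType).
Variable mu : {measure set T -> \bar R}.
Implicit Types f g : T -> quat R.

(* Functions are genuine functions, not classes modulo equality almost
   everywhere; the components are Borel measurable. *)
Definition qmeasurable f :=
  [/\ measurable_fun setT (fun x => q0 (f x) : measurableTypeR R),
      measurable_fun setT (fun x => q1 (f x) : measurableTypeR R),
      measurable_fun setT (fun x => q2 (f x) : measurableTypeR R) &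
      measurable_fun setT (fun x => q3 (f x) : measurableTypeR R)].

Definition qintegral f : quat R :=
  Quat (\int[mu]_x q0 (f x)) (\int[mu]_x q1 (f x))
       (\int[mu]_x q2 (f x)) (\int[mu]_x q3 (f x)).

Definition qnorm (p : \bar R) f : \bar R :=
  Lnorm mu p (fun x => (qmod (f x))%:E).

Definition qL (p : \bar R) f := qmeasurable f /\ (qnorm p f < +oo)%E.

(* Extended-real valued; finite when f and g are in L^2. *)
Definition qinner f g : \bar R :=
  (\int[mu]_x (qSc (f x * qconj (g x)))%:E)%E.

End QuaternionValued.

(* A point (x, y) of R^{2n} is the column whose upper block is x and whose
   lower block is y. *)
Section QuaternionFourier.
Variables (R : realType) (n : nat).
Local Notation leb := (lebesgue_cV R (n + n)).
Implicit Types f g : 'cV[R]_(n + n) -> quat R.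

Definition dotcV (u x : 'cV[R]_n) : R := \sum_(l < n) u l 0 * x l 0.

Definition qfourier1 f (w : 'cV[R]_(n + n)) : quat R :=
  qintegral leb (fun z =>
    qexp qi (- (2 * pi * dotcV (usubmx w) (usubmx z))) * f z *
    qexp qj (- (2 * pi * dotcV (dsubmx w) (dsubmx z)))).

(* Extension of qfourier1 from L^1 `&` L^2 to L^2 by density: g is the L^2-limit
   of the transforms of some sequence of L^1 `&` L^2 converging to f in L^2.
   Such a g is unique up to equality almost everywhere only. *)
Definition is_qfourier f g :=
  [/\ qL leb 2%:E f, qL leb 2%:E g &
  exists h : nat -> 'cV[R]_(n + n) -> quat R,
    [/\ forall l, qL leb 1%:E (h l) /\ qL leb 2%:E (h l),
        (fun l => qnorm leb 2%:E (fun z => f z - h l z)) @ \oo --> 0%E &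
        (fun l => qnorm leb 2%:E (fun w => g w - qfourier1 (h l) w))
          @ \oo --> 0%E]].

(* A representative of the class of F_Q(f); it is a.e. equal to qfourier1 f when
   f is also in L^1. *)
Definition qfourier f : 'cV[R]_(n + n) -> quat R :=
  xget (fun=> 0) [set g | is_qfourier f g].

End QuaternionFourier.

(* The integer n >= 1 is n'.+1, so that n' + n is 2n - 1 and 'M_(n + n) is
   convertible to 'M_(1 + (n' + n)). *)
Section Shearlet.
Variables (R : realType) (n' : nat).
Local Notation n := n'.+1.
Local Notation V := 'cV[R]_(n + n).
Local Notation S := 'cV[R]_(n' + n).
Local Notation leb := (lebesgue_cV R (n + n)).
Implicit Types psi f : V -> quat R.

Definition dilation (a : R) : 'M[R]_(n + n) :=
  block_mx (a%:M : 'M[R]_1) 0 0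
    ((Num.sg a * (`|a|) `^ ((2 * n)%:R^-1))%:M : 'M[R]_(n' + n)).

Definition shearing (s : S) : 'M[R]_(n + n) :=
  block_mx (1%:M : 'M[R]_1) s^T 0 (1%:M : 'M[R]_(n' + n)).

Definition shearlet psi (a : R) (s : S) (t : V) : V -> quat R := fun x =>
  (`|a|) `^ ((4 * n)%:R^-1 - 1) *:
    psi (invmx (dilation a) *m (invmx (shearing s) *m (x - t))).

Definition qstar psi : V -> quat R := fun x => qconj (psi (- x)).

Definition admissibility_cst psi : \bar R :=
  (\int[leb]_w (qmod (qfourier (qstar psi) w) ^+ 2 /
                `|w ord0 ord0| ^+ (2 * n))%:E)%E.

Definition admissible_shearlet psi :=
  qL leb 2%:E psi /\ (admissibility_cst psi < +oo)%E.

Definition shearlet_transform psi f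
    (p : measurableTypeR R * S * V) : quat R :=
  qintegral leb (fun x => f x * qconj (shearlet psi p.1.1 p.1.2 p.2 x)).

Section Measure.
Local Open Scope ereal_scope.

Definition param_lebesgue : set (measurableTypeR R * S * V) -> \bar R :=
  (@lebesgue_measure R \x lebesgue_cV R (n' + n)) \x leb.
HB.instance Definition _ := Measure.on param_lebesgue.

(* da ds dt / |a|^{2n+1}, carried by the parameters with a != 0 *)
Definition shearlet_measure (A : set (measurableTypeR R * S * V)) : \bar R :=
  \int[param_lebesgue]_(p in A `&` [set p | p.1.1 != 0%R])
    ((`|p.1.1 : R| ^+ (2 * n + 1))^-1)%:E.

Let shearlet_measure0 : shearlet_measure set0 = 0.
Proof. by rewrite /shearlet_measure set0I integral_set0. Qed.

Let shearlet_measure_ge0 A : 0 <= shearlet_measure A.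
Proof.
by apply: integral_ge0 => p _; rewrite lee_fin invr_ge0 exprn_ge0.
Qed.

Let measurable_a :
  measurable_fun setT (fun p : measurableTypeR R * S * V => p.1.1).
Proof. exact: measurableT_comp. Qed.

Let measurable_a_neq0 :
  measurable [set p : measurableTypeR R * S * V | p.1.1 != 0%R].
Proof.
rewrite (_ : mkset _ = setT `&` (fun p => p.1.1) @^-1` (~` [set 0%R])).
  by apply: measurable_a => //; exact: measurableC.
by apply/seteqP; split => p /=; [move=> /eqP|move=> [_ ?]; exact/eqP].
Qed.

Let measurable_density : measurable_fun setT
  (fun p : measurableTypeR R * S * V =>
    ((`|p.1.1 : R| ^+ (2 * n + 1))^-1 : R)%R).
Proof.
rewrite (_ : (fun _ => _) = (@powR R)^~ (-1)%R \o
    (fun p => `|p.1.1 : R| ^+ (2 * n + 1))%R); last first.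
  by apply/funext => p /=; rewrite powR_inv1// exprn_ge0.
apply: measurableT_comp; first exact: measurable_powR.
by apply: measurable_funX; exact: measurableT_comp.
Qed.

Let shearlet_measure_sigma_additive : semi_sigma_additive shearlet_measure.
Proof.
move=> F mF tF mUF; rewrite /shearlet_measure setI_bigcupl.
rewrite ge0_integral_bigcup; first last.
- exact: trivIset_setIr.
- by move=> p _; rewrite lee_fin invr_ge0 exprn_ge0.
- apply/measurable_EFinP; exact: measurable_funS measurable_density.
- by move=> k; exact: measurableI.
apply: is_cvg_nneseries => *; exact: shearlet_measure_ge0.
Qed.

HB.instance Definition _ := isMeasure.Build _ _ _ shearlet_measure
  shearlet_measure0 shearlet_measure_ge0 shearlet_measure_sigma_additive.

End Measure.
End Shearlet.

(* Main.v *)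
From HB Require Import structures.
Require Import Defs.
From mathcomp Require Import all_boot all_order all_algebra.
From mathcomp Require Import all_classical all_reals all_analysis.
From mathcomp Require Import measurable_realfun ring lra.
Import Order.TTheory GRing.Theory Num.Theory.
Import numFieldNormedType.Exports.
Local Open Scope classical_set_scope.
Local Open Scope ring_scope.

(** Write F f(w) for the integral of f(x) e^(-2 pi j w.x), with a single exponential,
    on the right. F commutes with left multiplication by quaternions, and it is an
    isometry of L^2, as the classical Fourier transform is. The theorem is
    Calderon's reproducing argument for F; the two hypotheses on psi are what
    allows the two-sided transform to be replaced by F.

    Reduction to F. The map q |-> i q j is an involution. On its eigenspaces a left
    factor e^(i t) acts as a right factor e^(j t) or e^(-j t) [qexp_i_left], so that
    the two-sided transform of f is the sum of one component of F f and of the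
    other component of F f reflected in the first block of frequencies
    [qfourierE]. The first hypothesis says that the two-sided transform of psi
    commutes with sufficiently many e^(j t) to lie in the plane of 1 and j. The
    second one, taken at t = 0, says that the two-sided transform of j psi is j
    times that of psi; but left multiplication by j exchanges the two
    eigenspaces, and P = F psi has to be invariant under the reflection. Hence P
    is also the two-sided transform of psi, it takes its values in a commutative
    plane, and the admissibility constant is the integral of
    |P(w)|^2 / |w_1|^(2n) [shearlet_symbol].

    Fixed scale and shear. By Parseval's identity for F, the shearlet transform of f
    at (a, s, t) is the integral of F f times the conjugate of F psi_(a,s,t).
    Up to a positive factor, F psi_(a,s,t)(w) is P((S_s A_a)^T w) e^(-2 pi j w.t)
    [extension_shear]. Since P commutes with the exponential, the transform is, as
    a function of t, the reflection of F G, where G is the product of F f and of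
    the conjugate of a dilate of P [shearlet_transformE]. Plancherel's theorem
    computes its integral over t.

    Integration. By Tonelli's theorem, the total integral is that of |F f(w)|^2
    times the integral over (a, s) of the weighted |P((S_s A_a)^T w)|^2. For
    w_1 <> 0 the map (a, s) |-> (S_s A_a)^T w parametrizes the frequency space up
    to null sets, and the change of variables yields the admissibility constant,
    whatever w is [calderon_integral]. This gives Plancherel's identity
    [shearlet_plancherel], and polarization gives Parseval's.

    The L^2 theory of F is built for the purpose. On the line, the integral of
    |F f|^2 against e^(-b |l|) is that of the autocorrelation of f against the
    Poisson kernel: this is Bessel's inequality as b tends to 0, and an equality
    for functions whose autocorrelation is continuous at 0 [line_plancherel].
    Fubini's theorem gives R^m by induction [cV_plancherel], and completeness of
    L^2 gives the extension from the integrable functions [extension_exists].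
    The relation between a function and a value of the extension carries all
    later arguments: it is stable under every operation that intertwines the
    transforms of integrable functions [extension_intertwine]. *)

Set Implicit Arguments.
Unset Strict Implicit.
Unset Printing Implicit Defensive.

(** * Quaternions *)

Section QuaternionModulus.
Variable R : realType.
Implicit Types p q r : quat R.

Definition qsq q : R := q0 q ^+ 2 + q1 q ^+ 2 + q2 q ^+ 2 + q3 q ^+ 2.

Lemma qsq_ge0 q : 0 <= qsq q.
Proof. by rewrite /qsq !addr_ge0// sqr_ge0. Qed.

Lemma qmod_sq q : qmod q ^+ 2 = qsq q.
Proof. by rewrite sqr_sqrtr// qsq_ge0. Qed.

Lemma qmod_ge0 q : 0 <= qmod q.
Proof. exact: sqrtr_ge0. Qed.

Lemma qsqM p q : qsq (p * q) = qsq p * qsq q.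
Proof. by rewrite /qsq /=; ring. Qed.

Lemma qmodE q : qmod q = Num.sqrt (qsq q). Proof. by []. Qed.

Lemma qmodM p q : qmod (p * q) = qmod p * qmod q.
Proof. by rewrite !qmodE qsqM sqrtrM// qsq_ge0. Qed.

Lemma qsqN q : qsq (- q) = qsq q.
Proof. by rewrite /qsq /= !sqrrN. Qed.

Lemma qmodN q : qmod (- q) = qmod q.
Proof. by rewrite !qmodE qsqN. Qed.

Lemma qsq_conj q : qsq (qconj q) = qsq q.
Proof. by rewrite /qsq /= !sqrrN. Qed.

Lemma qmod_conj q : qmod (qconj q) = qmod q.
Proof. by rewrite !qmodE qsq_conj. Qed.

Lemma qsqZ (a : R) q : qsq (a *: q) = a ^+ 2 * qsq q.
Proof. by rewrite /qsq /=; ring. Qed.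

Lemma qmodZ (a : R) q : qmod (a *: q) = `|a| * qmod q.
Proof. by rewrite !qmodE qsqZ sqrtrM ?sqr_ge0// sqrtr_sqr. Qed.

Lemma qsq0 : qsq 0 = 0.
Proof. by rewrite /qsq /= expr0n /= !addr0. Qed.

Lemma qsq_eq0 q : qsq q = 0 -> q = 0.
Proof.
rewrite /qsq => /eqP.
rewrite !paddr_eq0 ?addr_ge0 ?sqr_ge0// !sqrf_eq0 => /andP[/andP[/andP[]]].
by move=> /eqP a /eqP b /eqP c /eqP d; apply: quatP.
Qed.

Lemma qSc_conjE p q : qSc (p * qconj q) =
  q0 p * q0 q + q1 p * q1 q + q2 p * q2 q + q3 p * q3 q.
Proof. by rewrite /qSc /=; ring. Qed.

Lemma qSc_conj_sq p : qSc (p * qconj p) = qsq p.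
Proof. by rewrite qSc_conjE. Qed.

Lemma qSc_le_qmod q : qSc q <= qmod q.
Proof.
apply: le_trans (ler_norm _) _; rewrite -sqrtr_sqr qmodE ler_wsqrtr// /qsq.
by rewrite -!addrA lerDl !addr_ge0// sqr_ge0.
Qed.

Lemma norm_qSc_le_qmod q : `|qSc q| <= qmod q.
Proof.
by rewrite ler_norml qSc_le_qmod andbT lerNl -qmodN; exact: (qSc_le_qmod (- q)).
Qed.

Lemma qsqD p q : qsq (p + q) = qsq p + 2 * qSc (p * qconj q) + qsq q.
Proof. by rewrite qSc_conjE /qsq /=; ring. Qed.

Lemma qsqB p q : qsq (p - q) = qsq p - 2 * qSc (p * qconj q) + qsq q.
Proof. by rewrite qSc_conjE /qsq /=; ring. Qed.

Lemma qmodD p q : qmod (p + q) <= qmod p + qmod q.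
Proof.
rewrite -(ler_pXn2r (n := 2))// ?nnegrE ?addr_ge0 ?qmod_ge0//.
rewrite qmod_sq qsqD sqrrD !qmod_sq lerD2r lerD2l -[leRHS]mulr_natl.
rewrite ler_pM2l// -(qmod_conj q) -qmodM; exact: qSc_le_qmod.
Qed.

Lemma qmod_le_norms q : qmod q <= `|q0 q| + `|q1 q| + `|q2 q| + `|q3 q|.
Proof.
rewrite -(ler_pXn2r (n := 2))// ?nnegrE ?addr_ge0 ?qmod_ge0//.
rewrite qmod_sq /qsq -(real_normK (num_real (q0 q))) -(real_normK (num_real (q1 q))).
rewrite -(real_normK (num_real (q2 q))) -(real_normK (num_real (q3 q))).
set a := `|_|; set b := `|_|; set c := `|_|; set d := `|_|.
have [a0 b0 c0 d0] : [/\ 0 <= a, 0 <= b, 0 <= c & 0 <= d].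
  by split; exact: normr_ge0.
rewrite -subr_ge0 (_ : _ - _ = 2 * (a * b + a * c + a * d + b * c + b * d + c * d)).
  by rewrite mulr_ge0// !addr_ge0// mulr_ge0.
by ring.
Qed.

Lemma norm_q0_le q : `|q0 q| <= qmod q.
Proof. exact: norm_qSc_le_qmod. Qed.
Lemma norm_q1_le q : `|q1 q| <= qmod q.
Proof.
rewrite -sqrtr_sqr qmodE ler_wsqrtr// /qsq.
by rewrite [_ + q1 q ^+ 2]addrC -!addrA lerDl !addr_ge0// sqr_ge0.
Qed.
Lemma norm_q2_le q : `|q2 q| <= qmod q.
Proof.
rewrite -sqrtr_sqr qmodE ler_wsqrtr// /qsq.
by rewrite [_ + q2 q ^+ 2]addrC -!addrA lerDl !addr_ge0// sqr_ge0.
Qed.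
Lemma norm_q3_le q : `|q3 q| <= qmod q.
Proof.
rewrite -sqrtr_sqr qmodE ler_wsqrtr// /qsq.
by rewrite lerDr !addr_ge0// sqr_ge0.
Qed.

Lemma qmodM_le p q : qmod p * qmod q <= qsq p + qsq q.
Proof.
rewrite -!qmod_sq; have := sqr_ge0 (qmod p - qmod q).
have := sqr_ge0 (qmod p); have := sqr_ge0 (qmod q).
by rewrite sqrrB; nra.
Qed.

Lemma qsqD_le p q : qsq (p + q) <= 2 * qsq p + 2 * qsq q.
Proof.
by have := qsq_ge0 (p - q); rewrite qsqB qsqD; lra.
Qed.

Lemma qconjM p q : qconj (p * q) = qconj q * qconj p.
Proof. by apply: quatP; split => /=; ring. Qed.

Lemma qscaleAr (a : R) p q : a *: (p * q) = p * (a *: q).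
Proof. by apply: quatP; split => /=; ring. Qed.

Lemma q_component q : [/\ q0 q = qSc q, q1 q = - qSc (qi * q),
  q2 q = - qSc (qj * q) & q3 q = - qSc (qk * q)].
Proof. by split; rewrite /qSc /=; ring. Qed.

End QuaternionModulus.

Section Character.
Variable R : realType.
Implicit Types (q : quat R) (s t : R).

(** The character t |-> e^(j t); the quaternions that commute with j are the
    complex numbers spanned by 1 and j. *)
Notation ej := (qexp (@qj R)).

Lemma ejE t : ej t = Quat (cos t) 0 (sin t) 0.
Proof. by apply: quatP; split => /=; rewrite ?mulr0 ?mulr1 ?addr0 ?add0r. Qed.

Lemma ejD s t : ej (s + t) = ej s * ej t.
Proof. by rewrite !ejE cosD sinD; apply: quatP; split => /=; ring. Qed.

Lemma ej0 : ej 0 = 1.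
Proof. by rewrite ejE cos0 sin0. Qed.

Lemma ej_conj t : qconj (ej t) = ej (- t).
Proof. by rewrite !ejE cosN sinN; apply: quatP; split => //=; rewrite oppr0. Qed.

Lemma qsq_ej t : qsq (ej t) = 1.
Proof. by rewrite ejE /qsq/= -(cos2Dsin2 t); ring. Qed.

Lemma qmod_ej t : qmod (ej t) = 1.
Proof. by rewrite qmodE qsq_ej sqrtr1. Qed.

Lemma qmodMej q t : qmod (q * ej t) = qmod q.
Proof. by rewrite qmodM qmod_ej mulr1. Qed.

End Character.
Notation ej := (qexp (@qj _)).

(** * Measurable, integrable and square integrable quaternion functions *)

Section QMeasurable.
Context d (T : measurableType d) (R : realType).
Implicit Types f g : T -> quat R.

Lemma qmeasurable_cst (q : quat R) : qmeasurable (fun _ : T => q).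
Proof. by split; exact: measurable_cst. Qed.

Lemma qmeasurableD f g : qmeasurable f -> qmeasurable g ->
  qmeasurable (fun x => f x + g x).
Proof.
by move=> [? ? ? ?] [? ? ? ?]; split => /=; exact: measurable_funD.
Qed.

Lemma qmeasurableN f : qmeasurable f -> qmeasurable (fun x => - f x).
Proof. by move=> [? ? ? ?]; split => /=; exact: measurableT_comp. Qed.

Lemma qmeasurableB f g : qmeasurable f -> qmeasurable g ->
  qmeasurable (fun x => f x - g x).
Proof. by move=> mf mg; apply: qmeasurableD => //; exact: qmeasurableN. Qed.

Lemma qmeasurable_conj f : qmeasurable f -> qmeasurable (fun x => qconj (f x)).
Proof.
by move=> [? ? ? ?]; split => //=; exact: measurableT_comp.
Qed.

Lemma qmeasurableM f g : qmeasurable f -> qmeasurable g ->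
  qmeasurable (fun x => f x * g x).
Proof.
move=> [? ? ? ?] [? ? ? ?]; split => /=;
  repeat first [assumption | apply: measurable_funM | apply: measurable_funB
               | apply: measurable_funD].
Qed.

Lemma qmeasurableZ (c : T -> R) f : measurable_fun setT c -> qmeasurable f ->
  qmeasurable (fun x => c x *: f x).
Proof. by move=> mc [? ? ? ?]; split => /=; exact: measurable_funM. Qed.

Lemma qmeasurable_ej (c : T -> R) : measurable_fun setT c ->
  qmeasurable (fun x => qexp qj (c x)).
Proof.
move=> mc; rewrite (_ : (fun _ => _) = (fun x => Quat (cos (c x)) 0 (sin (c x)) 0)).
  split => /=; try exact: measurable_cst.
    apply: measurableT_comp mc; apply: continuous_measurable_fun; exact: continuous_cos.
  apply: measurableT_comp mc; apply: continuous_measurable_fun; exact: continuous_sin.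
by apply/funext => x; rewrite ejE.
Qed.

Lemma qmeasurable_comp d' (T' : measurableType d') (h : T' -> T) f :
  measurable_fun setT h -> qmeasurable f -> qmeasurable (f \o h).
Proof.
move=> mh [m0 m1 m2 m3]; split;
  [exact: measurableT_comp m0 mh | exact: measurableT_comp m1 mh
  |exact: measurableT_comp m2 mh | exact: measurableT_comp m3 mh].
Qed.

Lemma measurable_qsq f : qmeasurable f -> measurable_fun setT (fun x => qsq (f x)).
Proof.
by move=> [? ? ? ?]; repeat apply: measurable_funD; exact: measurable_funX.
Qed.

Lemma measurable_qmod f : qmeasurable f -> measurable_fun setT (fun x => qmod (f x)).
Proof.
move=> mf; rewrite (_ : (fun _ => _) = @Num.sqrt R \o (fun x => qsq (f x)))//.
apply: measurableT_comp; last exact: measurable_qsq.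
by apply: continuous_measurable_fun; exact: sqrt_continuous.
Qed.

Lemma measurable_EFin_qmod f : qmeasurable f ->
  measurable_fun setT (fun x => (qmod (f x))%:E).
Proof. by move=> /measurable_qmod ?; exact/measurable_EFinP. Qed.

Lemma measurable_EFin_qsq f : qmeasurable f ->
  measurable_fun setT (fun x => (qsq (f x))%:E).
Proof. by move=> /measurable_qsq ?; exact/measurable_EFinP. Qed.

Lemma measurable_qSc f : qmeasurable f -> measurable_fun setT (fun x => qSc (f x)).
Proof. by case. Qed.

End QMeasurable.

Lemma EFin_qmod_ge0 (R : realType) (q : quat R) : (0 <= (qmod q)%:E)%E.
Proof. by rewrite lee_fin qmod_ge0. Qed.

Lemma EFin_qsq_ge0 (R : realType) (q : quat R) : (0 <= (qsq q)%:E)%E.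
Proof. by rewrite lee_fin qsq_ge0. Qed.

#[global] Hint Extern 0 (is_true (@Order.le _ _ _ (qmod _))) => exact: qmod_ge0 : core.
#[global] Hint Extern 0 (is_true (@Order.le _ _ _ (qsq _))) => exact: qsq_ge0 : core.
#[global] Hint Extern 0 (is_true (@Order.le _ _ _ (EFin (qmod _)))) =>
  exact: EFin_qmod_ge0 : core.
#[global] Hint Extern 0 (is_true (@Order.le _ _ _ (EFin (qsq _)))) =>
  exact: EFin_qsq_ge0 : core.

Section QIntegral.
Context d (T : measurableType d) (R : realType).
Variable mu : {measure set T -> \bar R}.
Implicit Types f g : T -> quat R.

(** The squared L^2 norm; unlike the norm it is an integral, to which Tonelli's
    theorem and changes of variables apply. *)
Definition energy f : \bar R := (\int[mu]_x (qsq (f x))%:E)%E.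

Lemma energy_ge0 f : (0 <= energy f)%E.
Proof. by exact: integral_ge0. Qed.

Lemma qL1P f : qL mu 1%:E f <->
  qmeasurable f /\ (\int[mu]_x (qmod (f x))%:E < +oo)%E.
Proof.
rewrite /qL /qnorm Lnorm1 (_ : \int[mu]_x `|(qmod (f x))%:E| = \int[mu]_x (qmod (f x))%:E)%E//.
by apply: eq_integral => x _; rewrite /= ger0_norm ?qmod_ge0.
Qed.

Lemma qnorm2E f : qnorm mu 2%:E f = (energy f `^ (2^-1))%E.
Proof.
rewrite /qnorm unlock; congr (_ `^ _)%E; apply: eq_integral => x _.
rewrite /= ger0_norm ?qmod_ge0// -[LHS]/((qmod (f x) `^ 2)%:E).
by rewrite powR_mulrn ?qmod_ge0// qmod_sq.
Qed.

Lemma qnorm2_sq f : (qnorm mu 2%:E f ^+ 2 = energy f)%E.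
Proof.
rewrite qnorm2E expe2 -poweRD; last by rewrite add_neq0_poweRD_def// -splitr.
by rewrite -[2^-1]mul1r -splitr poweRe1// energy_ge0.
Qed.

Lemma qL2P f : qL mu 2%:E f <-> qmeasurable f /\ (energy f < +oo)%E.
Proof.
rewrite /qL qnorm2E; split=> -[mf fy]; split => //.
  by apply: lty_poweRy fy; rewrite invr_neq0 ?pnatr_eq0.
by apply: poweR_lty.
Qed.

Lemma qnorm2_ge0 f : (0 <= qnorm mu 2%:E f)%E.
Proof. exact: Lnorm_ge0. Qed.

Lemma qL1_integrable f : qL mu 1%:E f ->
  [/\ mu.-integrable setT (EFin \o (fun x => q0 (f x))),
      mu.-integrable setT (EFin \o (fun x => q1 (f x))),
      mu.-integrable setT (EFin \o (fun x => q2 (f x))) &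
      mu.-integrable setT (EFin \o (fun x => q3 (f x)))].
Proof.
move=> /qL1P[mf fy].
have fi : mu.-integrable setT (EFin \o (fun x => qmod (f x))).
  apply/integrableP; split; first exact: measurable_EFin_qmod.
  by under eq_integral do rewrite /= ger0_norm//.
case: mf => m0 m1 m2 m3.
split; (apply: (le_integrable measurableT _ _ fi);
  [exact/measurable_EFinP | move=> x _ /=; rewrite lee_fin (ger0_norm (qmod_ge0 _))]).
- exact: norm_q0_le.
- exact: norm_q1_le.
- exact: norm_q2_le.
- exact: norm_q3_le.
Qed.

Lemma qL1_dominated f (u : T -> R) : qmeasurable f ->
  measurable_fun setT u ->
  (forall x, qmod (f x) <= u x) -> (\int[mu]_x (u x)%:E < +oo)%E ->
  qL mu 1%:E f.
Proof.
move=> mf mu_ fu uy; apply/qL1P; split => //; apply: le_lt_trans uy.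
apply: ge0_le_integral => //.
- exact: measurable_EFin_qmod.
- exact/measurable_EFinP.
- by move=> x _; rewrite lee_fin.
Qed.

Lemma qL1_le f g : qmeasurable f -> qL mu 1%:E g ->
  (forall x, qmod (f x) <= qmod (g x)) -> qL mu 1%:E f.
Proof.
move=> mf /qL1P[mg gy] fg.
by apply: (qL1_dominated mf _ fg) => //; exact: measurable_qmod.
Qed.

Lemma qL1D f g : qL mu 1%:E f -> qL mu 1%:E g -> qL mu 1%:E (fun x => f x + g x).
Proof.
move=> /qL1P[mf fy] /qL1P[mg gy].
apply: (qL1_dominated (u := fun x => qmod (f x) + qmod (g x))).
- exact: qmeasurableD.
- by apply: measurable_funD; exact: measurable_qmod.
- by move=> x; exact: qmodD.
under eq_integral do rewrite EFinD.
rewrite ge0_integralD//; [exact: lte_add_pinfty | exact: measurable_EFin_qmod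
  | exact: measurable_EFin_qmod].
Qed.

Lemma qL1Ml (c : quat R) f : qL mu 1%:E f -> qL mu 1%:E (fun x => c * f x).
Proof.
move=> /qL1P[mf fy]; apply/qL1P; split.
  by apply: qmeasurableM => //; exact: qmeasurable_cst.
under eq_integral do rewrite qmodM EFinM.
rewrite ge0_integralZl//; last exact: measurable_EFin_qmod.
by apply: lte_mul_pinfty.
Qed.

Lemma qL1_eqmod f g : qmeasurable f -> qL mu 1%:E g ->
  (forall x, qmod (f x) = qmod (g x)) -> qL mu 1%:E f.
Proof. by move=> mf gL fg; apply: (qL1_le mf gL) => x; rewrite fg. Qed.

Lemma qL1Mr (c : quat R) f : qL mu 1%:E f -> qL mu 1%:E (fun x => f x * c).
Proof.
move=> fL; apply: (@qL1_eqmod _ (fun x => c * f x)).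
- by apply: qmeasurableM; [case: fL | exact: qmeasurable_cst].
- exact: qL1Ml.
- by move=> x; rewrite !qmodM mulrC.
Qed.

Lemma qL1N f : qL mu 1%:E f -> qL mu 1%:E (fun x => - f x).
Proof.
move=> fL; apply: (qL1_eqmod _ fL) => [|x]; last by rewrite qmodN.
by apply: qmeasurableN; case: fL.
Qed.

Lemma qL1B f g : qL mu 1%:E f -> qL mu 1%:E g -> qL mu 1%:E (fun x => f x - g x).
Proof. by move=> fL gL; apply: qL1D => //; exact: qL1N. Qed.

Lemma energy_le f g : qmeasurable f -> qmeasurable g ->
  (forall x, qsq (f x) <= qsq (g x)) -> (energy f <= energy g)%E.
Proof.
move=> mf mg fg; apply: ge0_le_integral => //.
- exact: measurable_EFin_qsq.
- exact: measurable_EFin_qsq.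
- by move=> x _; rewrite lee_fin.
Qed.

Lemma eq_energy f g : (forall x, qsq (f x) = qsq (g x)) -> energy f = energy g.
Proof. by move=> fg; apply: eq_integral => x _; rewrite fg. Qed.

Lemma qL2_le f g : qmeasurable f -> qL mu 2%:E g ->
  (forall x, qsq (f x) <= qsq (g x)) -> qL mu 2%:E f.
Proof.
move=> mf /qL2P[mg gy] fg; apply/qL2P; split => //.
exact: le_lt_trans (energy_le mf mg fg) gy.
Qed.

Lemma energyD_le f g : qmeasurable f -> qmeasurable g ->
  (energy (fun x => f x + g x)%R <= 2%:E * energy f + 2%:E * energy g)%E.
Proof.
move=> mf mg; have ? := measurable_EFin_qsq mf; have ? := measurable_EFin_qsq mg.
have nn (h : T -> quat R) x : [set: T] x -> (0 <= 2%:E * (qsq (h x))%:E)%E.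
  by rewrite -EFinM lee_fin mulr_ge0.
rewrite /energy -!ge0_integralZl// -ge0_integralD//; try exact: measurable_funeM.
apply: ge0_le_integral => //.
- by apply: measurable_EFin_qsq; exact: qmeasurableD.
- by apply: emeasurable_funD; exact: measurable_funeM.
- by move=> x _; rewrite -!EFinM -EFinD lee_fin; exact: qsqD_le.
- exact: nn.
- exact: nn.
Qed.

Lemma qL2D f g : qL mu 2%:E f -> qL mu 2%:E g -> qL mu 2%:E (fun x => f x + g x).
Proof.
move=> /qL2P[mf fy] /qL2P[mg gy]; apply/qL2P; split; first exact: qmeasurableD.
by apply: (le_lt_trans (energyD_le mf mg)); apply: lte_add_pinfty;
  apply: lte_mul_pinfty.
Qed.

Lemma energyMl (c : quat R) f : qmeasurable f ->
  energy (fun x => c * f x) = ((qsq c)%:E * energy f)%E.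
Proof.
move=> mf; rewrite /energy; under eq_integral do rewrite qsqM EFinM.
by rewrite ge0_integralZl//; exact: measurable_EFin_qsq.
Qed.

Lemma qL2Ml (c : quat R) f : qL mu 2%:E f -> qL mu 2%:E (fun x => c * f x).
Proof.
move=> /qL2P[mf fy]; apply/qL2P; split.
  by apply: qmeasurableM => //; exact: qmeasurable_cst.
by rewrite energyMl//; apply: lte_mul_pinfty => //; rewrite lee_fin.
Qed.

Lemma energyN f : energy (fun x => - f x) = energy f.
Proof. by apply: eq_energy => x; rewrite qsqN. Qed.

Lemma qL2N f : qL mu 2%:E f -> qL mu 2%:E (fun x => - f x).
Proof.
move=> /qL2P[mf fy]; apply/qL2P; split; first exact: qmeasurableN.
by rewrite energyN.
Qed.

Lemma qL2B f g : qL mu 2%:E f -> qL mu 2%:E g -> qL mu 2%:E (fun x => f x - g x).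
Proof. by move=> fL gL; apply: qL2D => //; exact: qL2N. Qed.

Lemma qL2M_qL1 f g : qL mu 2%:E f -> qL mu 2%:E g -> qL mu 1%:E (fun x => f x * g x).
Proof.
move=> /qL2P[mf fy] /qL2P[mg gy].
apply: (qL1_dominated (u := fun x => qsq (f x) + qsq (g x))).
- exact: qmeasurableM.
- by apply: measurable_funD; exact: measurable_qsq.
- by move=> x; rewrite qmodM; exact: qmodM_le.
under eq_integral do rewrite EFinD.
rewrite ge0_integralD//; [exact: lte_add_pinfty | exact: measurable_EFin_qsq
  | exact: measurable_EFin_qsq].
Qed.

Lemma qL2_conj f : qL mu 2%:E f -> qL mu 2%:E (fun x => qconj (f x)).
Proof.
move=> fL; apply: (qL2_le _ fL); first by apply: qmeasurable_conj; case: fL.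
by move=> x; rewrite qsq_conj.
Qed.

Lemma eq_qintegral f g : f =1 g -> qintegral mu f = qintegral mu g.
Proof. by move=> /funext ->. Qed.

(** Multiplication by a fixed quaternion is real-linear, and mixes the components
    that are integrated separately. *)
Lemma Rintegral_qlinear (a b c e : R) (L : quat R -> R) f : qL mu 1%:E f ->
  (forall q, L q = a * q0 q + b * q1 q + c * q2 q + e * q3 q) ->
  \int[mu]_x L (f x) = L (qintegral mu f).
Proof.
move=> /qL1_integrable[i0 i1 i2 i3] LE.
have Z r h : mu.-integrable setT (EFin \o h) ->
    mu.-integrable setT (EFin \o (fun x => r * h x)).
  by move=> ih; exact: (integrableZl measurableT r ih).
have D h k : mu.-integrable setT (EFin \o h) -> mu.-integrable setT (EFin \o k) ->
    mu.-integrable setT (EFin \o (fun x => h x + k x)).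
  by move=> ih ik; exact: (integrableD measurableT ih ik).
rewrite LE (_ : (fun x => L (f x)) = (fun x => a * q0 (f x) + b * q1 (f x)
  + c * q2 (f x) + e * q3 (f x))); last by apply/funext => x; rewrite LE.
have j0 := Z a _ i0; have j1 := Z b _ i1; have j2 := Z c _ i2.
have k1 := D _ _ j0 j1; have k2 := D _ _ k1 j2.
rewrite (RintegralD measurableT k2 (Z e _ i3)) (RintegralD measurableT k1 j2).
rewrite (RintegralD measurableT j0 j1).
by rewrite !RintegralZl.
Qed.

Lemma qintegralMl (c : quat R) f : qL mu 1%:E f ->
  qintegral mu (fun x => c * f x) = c * qintegral mu f.
Proof.
move=> fL; apply: quatP; split.
- apply: (@Rintegral_qlinear (q0 c) (- q1 c) (- q2 c) (- q3 c) (fun q => q0 (c * q)) _ fL).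
  by move=> q /=; ring.
- apply: (@Rintegral_qlinear (q1 c) (q0 c) (- q3 c) (q2 c) (fun q => q1 (c * q)) _ fL).
  by move=> q /=; ring.
- apply: (@Rintegral_qlinear (q2 c) (q3 c) (q0 c) (- q1 c) (fun q => q2 (c * q)) _ fL).
  by move=> q /=; ring.
- apply: (@Rintegral_qlinear (q3 c) (- q2 c) (q1 c) (q0 c) (fun q => q3 (c * q)) _ fL).
  by move=> q /=; ring.
Qed.

Lemma qintegralMr (c : quat R) f : qL mu 1%:E f ->
  qintegral mu (fun x => f x * c) = qintegral mu f * c.
Proof.
move=> fL; apply: quatP; split.
- apply: (@Rintegral_qlinear (q0 c) (- q1 c) (- q2 c) (- q3 c) (fun q => q0 (q * c)) _ fL).
  by move=> q /=; ring.
- apply: (@Rintegral_qlinear (q1 c) (q0 c) (q3 c) (- q2 c) (fun q => q1 (q * c)) _ fL).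
  by move=> q /=; ring.
- apply: (@Rintegral_qlinear (q2 c) (- q3 c) (q0 c) (q1 c) (fun q => q2 (q * c)) _ fL).
  by move=> q /=; ring.
- apply: (@Rintegral_qlinear (q3 c) (q2 c) (- q1 c) (q0 c) (fun q => q3 (q * c)) _ fL).
  by move=> q /=; ring.
Qed.

Lemma qintegralD f g : qL mu 1%:E f -> qL mu 1%:E g ->
  qintegral mu (fun x => f x + g x) = qintegral mu f + qintegral mu g.
Proof.
move=> /qL1_integrable[? ? ? ?] /qL1_integrable[? ? ? ?].
by apply: quatP; split; exact: RintegralD.
Qed.

Lemma qintegralN f : qL mu 1%:E f ->
  qintegral mu (fun x => - f x) = - qintegral mu f.
Proof.
move=> fL; rewrite -[RHS]mulN1r -qintegralMl//.
by apply: eq_qintegral => x; rewrite mulN1r.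
Qed.

Lemma qintegralB f g : qL mu 1%:E f -> qL mu 1%:E g ->
  qintegral mu (fun x => f x - g x) = qintegral mu f - qintegral mu g.
Proof. by move=> fL gL; rewrite qintegralD// ?qintegralN//; exact: qL1N. Qed.

Lemma Rintegral_qSc (c : quat R) f : qL mu 1%:E f ->
  \int[mu]_x qSc (f x * c) = qSc (qintegral mu f * c).
Proof. by move=> fL; rewrite -qintegralMr. Qed.

(** With I the integral of f, |I|^2 is the integral of Sc (f conj(I)), which
    is at most |I| times the integral of |f|. *)
Lemma qmod_qintegral_le f : qL mu 1%:E f ->
  ((qmod (qintegral mu f))%:E <= \int[mu]_x (qmod (f x))%:E)%E.
Proof.
move=> fL; have /qL1P[mf fy] := fL.
have mqf := measurable_EFin_qmod mf.
have ffin : (\int[mu]_x (qmod (f x))%:E)%E \is a fin_num.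
  by rewrite ge0_fin_numE// integral_ge0.
rewrite -(fineK ffin) lee_fin; set I := qintegral mu f; set A := fine _.
have A0 : 0 <= A by rewrite fine_ge0// integral_ge0.
have [->|I0] := eqVneq (qmod I) 0; first by [].
have Ip : 0 < qmod I by rewrite lt0r I0 qmod_ge0.
rewrite -(ler_pM2r Ip) -expr2 qmod_sq -qSc_conj_sq -Rintegral_qSc//.
have [iS _ _ _] := qL1_integrable (qL1Mr (qconj I) fL).
rewrite -lee_fin EFinM /A (fineK ffin) fineK; last exact: integrable_fin_num.
rewrite -ge0_integralZr//.
apply: le_integral => //.
- apply/integrableP; split.
    by apply: emeasurable_funM => //; exact: measurable_cst.
  under eq_integral do rewrite gee0_abs ?mule_ge0//.
  by rewrite ge0_integralZr//; apply: lte_mul_pinfty; rewrite ?ltry// integral_ge0.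
- move=> x _; rewrite -EFinM lee_fin; apply: le_trans (qSc_le_qmod _) _.
  by rewrite qmodM qmod_conj.
Qed.

Lemma energy0_ae f : qmeasurable f -> energy f = 0%E -> {ae mu, forall x, f x = 0}.
Proof.
move=> mf f0.
have e0 : (\int[mu]_x `|(qsq (f x))%:E|)%E = 0%E.
  by rewrite -[RHS]f0; apply: eq_integral => x _; rewrite /= ger0_norm.
have [+ _] := ae_eq_integral_abs mu measurableT (measurable_EFin_qsq mf).
move=> /(_ e0); apply: filterS => x /(_ I) /= [].
exact: qsq_eq0.
Qed.

Lemma ae_energy f g : qmeasurable f -> qmeasurable g ->
  {ae mu, forall x, f x = g x} -> energy f = energy g.
Proof.
move=> mf mg fg; rewrite /energy; apply: ge0_ae_eq_integral => //; try exact: measurable_EFin_qsq.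
by apply: filterS fg => x -> _.
Qed.

Lemma ae_qL2 f g : qmeasurable f -> {ae mu, forall x, f x = g x} ->
  qL mu 2%:E g -> qL mu 2%:E f.
Proof.
by move=> mf fg /qL2P[mg gy]; apply/qL2P; split => //; rewrite (ae_energy mf mg fg).
Qed.

Lemma ae_qintegral f g : qmeasurable f -> qmeasurable g ->
  {ae mu, forall x, f x = g x} -> qintegral mu f = qintegral mu g.
Proof.
move=> [? ? ? ?] [? ? ? ?] fg; rewrite /qintegral /Rintegral.
congr Quat; congr fine; (apply: ae_eq_integral => //;
  [exact/measurable_EFinP|exact/measurable_EFinP|by apply: filterS fg => x -> _]).
Qed.

Lemma qnormD f g : qmeasurable f -> qmeasurable g ->
  (qnorm mu 2%:E (fun x => f x + g x)%R <= qnorm mu 2%:E f + qnorm mu 2%:E g)%E.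
Proof.
move=> mf mg; have mf' := measurable_qmod mf; have mg' := measurable_qmod mg.
have := minkowski_EFin mu mf' mg' (ler1n R 2); apply: le_trans.
have -> : Lnorm mu 2%:E (EFin \o ((fun x => qmod (f x)) \+ (fun x => qmod (g x)))%R) =
    ((\int[mu]_x ((qmod (f x) + qmod (g x)) ^+ 2)%:E) `^ 2^-1)%E.
  rewrite unlock; congr (_ `^ _)%E; apply: eq_integral => x _.
  rewrite /= ger0_norm ?addr_ge0//.
  by rewrite -[LHS]/((_ `^ 2)%:E) powR_mulrn ?addr_ge0.
rewrite qnorm2E; apply: gt0_ler_poweR; rewrite ?invr_ge0// ?in_itv ?inE//=.
- by rewrite leey andbT energy_ge0.
- by rewrite leey andbT integral_ge0// => x _; rewrite lee_fin sqr_ge0.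
apply: ge0_le_integral => //.
- by apply: measurable_EFin_qsq; exact: qmeasurableD.
- by apply/measurable_EFinP; apply: measurable_funX; exact: measurable_funD.
- move=> x _; rewrite lee_fin -qmod_sq ler_pXn2r ?nnegrE ?addr_ge0//.
  exact: qmodD.
Qed.

Lemma qnormN f : qnorm mu 2%:E (fun x => - f x) = qnorm mu 2%:E f.
Proof. by rewrite !qnorm2E energyN. Qed.

Lemma eq_qnorm f g : f =1 g -> qnorm mu 2%:E f = qnorm mu 2%:E g.
Proof. by move=> /funext ->. Qed.

Lemma qnormB f g : qmeasurable f -> qmeasurable g ->
  (qnorm mu 2%:E (fun x => f x - g x)%R <= qnorm mu 2%:E f + qnorm mu 2%:E g)%E.
Proof.
by move=> mf mg; rewrite -(qnormN g); apply: qnormD => //; exact: qmeasurableN.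
Qed.

Lemma qnorm_distC f g :
  qnorm mu 2%:E (fun x => f x - g x) = qnorm mu 2%:E (fun x => g x - f x).
Proof. by rewrite -qnormN; apply: eq_qnorm => x; rewrite opprB. Qed.

Lemma qnorm_energy f g : energy f = energy g -> qnorm mu 2%:E f = qnorm mu 2%:E g.
Proof. by rewrite !qnorm2E => ->. Qed.

End QIntegral.

(** * Changes of variables and Fubini's theorem *)

Section Rescaling.
Context d1 d2 (T1 : measurableType d1) (T2 : measurableType d2) (R : realType).
Variables (mu : {measure set T1 -> \bar R}) (nu : {measure set T2 -> \bar R}).
Implicit Types (phi : T1 -> T2) (c : R).

(** The image of mu under phi is c times nu, phrased so that it can be used
    directly for integrals. *)
Definition rescales phi c := [/\ measurable_fun setT phi, 0 < c &
  forall f : T2 -> \bar R, measurable_fun setT f -> (forall x, 0 <= f x)%E ->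
    (\int[mu]_x f (phi x) = c%:E * \int[nu]_x f x)%E].

Lemma rescalesP phi c : measurable_fun setT phi -> 0 < c ->
  (forall A, measurable A -> mu (phi @^-1` A) = (c%:E * nu A)%E) -> rescales phi c.
Proof.
move=> mphi c0 H; split => // f mf f0.
transitivity (\int[pushforward mu phi]_x f x)%E.
  by rewrite (ge0_integral_pushforward mphi).
have cp : 0 <= c by exact: ltW.
transitivity (\int[mscale (NngNum cp) nu]_x f x)%E; last by rewrite ge0_integral_mscale.
by apply: eq_measure_integral => A mA _; exact: H.
Qed.

Lemma rescales_qmeasurable phi c (f : T2 -> quat R) : rescales phi c ->
  qmeasurable f -> qmeasurable (fun x => f (phi x)).
Proof. by move=> [mphi _ _]; exact: qmeasurable_comp. Qed.

Lemma rescales_energy phi c (f : T2 -> quat R) : rescales phi c ->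
  qmeasurable f -> (energy mu (fun x => f (phi x)) = c%:E * energy nu f)%E.
Proof.
move=> [mphi _ H] mf.
by rewrite -(H (fun x => (qsq (f x))%:E))//; exact: measurable_EFin_qsq.
Qed.

Lemma rescales_qL2 phi c (f : T2 -> quat R) : rescales phi c ->
  qL nu 2%:E f -> qL mu 2%:E (fun x => f (phi x)).
Proof.
move=> r /qL2P[mf fy]; apply/qL2P; split; first exact: rescales_qmeasurable r mf.
rewrite (rescales_energy r mf); case: r => _ c0 _.
by rewrite lte_mul_pinfty// lee_fin ltW.
Qed.

Lemma rescales_qL1 phi c (f : T2 -> quat R) : rescales phi c ->
  qL nu 1%:E f -> qL mu 1%:E (fun x => f (phi x)).
Proof.
move=> r /qL1P[mf fy]; apply/qL1P; split; first exact: rescales_qmeasurable r mf.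
case: r => mphi c0 H.
rewrite (H (fun x => (qmod (f x))%:E))//; last exact: measurable_EFin_qmod.
by rewrite lte_mul_pinfty// lee_fin ltW.
Qed.

Lemma rescales_integral phi c (f : T2 -> \bar R) : rescales phi c ->
  nu.-integrable setT f ->
  (\int[mu]_x f (phi x) = c%:E * \int[nu]_x f x)%E.
Proof.
move=> [mphi c0 H] fi; have mf := measurable_int _ fi.
rewrite integralE [in RHS]integralE.
have -> : (\int[mu]_x (fun x => f (phi x))^\+ x = c%:E * \int[nu]_x f^\+ x)%E.
  by rewrite -(H f^\+)%E//; [apply: eq_integral => x _; rewrite !funeposE | exact: measurable_funepos].
have -> : (\int[mu]_x (fun x => f (phi x))^\- x = c%:E * \int[nu]_x f^\- x)%E.
  by rewrite -(H f^\-)%E//; [apply: eq_integral => x _; rewrite !funenegE | exact: measurable_funeneg].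
rewrite [RHS]muleBr//; apply: fin_num_adde_defr.
exact: integrable_pos_fin_num.
Qed.

Lemma rescales_qintegral phi c (f : T2 -> quat R) : rescales phi c ->
  qL nu 1%:E f ->
  qintegral mu (fun x => f (phi x)) = c *: qintegral nu f.
Proof.
move=> r fL; have [i0 i1 i2 i3] := qL1_integrable fL.
apply: quatP; split; rewrite /= /Rintegral.
- by rewrite (rescales_integral r i0) fineM// integrable_fin_num.
- by rewrite (rescales_integral r i1) fineM// integrable_fin_num.
- by rewrite (rescales_integral r i2) fineM// integrable_fin_num.
- by rewrite (rescales_integral r i3) fineM// integrable_fin_num.
Qed.

Lemma rescales_ae phi c (Q : T2 -> Prop) : rescales phi c ->
  {ae nu, forall x, Q x} -> {ae mu, forall x, Q (phi x)}.
Proof.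
move=> [mphi c0 H] [N [mN N0 QN]]; exists (phi @^-1` N); split.
- by rewrite -[X in measurable X]setTI; exact: mphi.
- have mN' : measurable (phi @^-1` N).
    by rewrite -[X in measurable X]setTI; exact: mphi.
  have := integral_indic mu measurableT mN'; rewrite setIT => <-.
  have := H (fun x => (\1_N x)%:E) _ _.
  rewrite (integral_indic nu measurableT mN) setIT N0 mule0; apply; first exact/measurable_EFinP.
  by move=> x; rewrite lee_fin.
- by move=> x /= Qx; apply: QN.
Qed.

End Rescaling.

Lemma rescales_comp d1 d2 d3 (T1 : measurableType d1) (T2 : measurableType d2)
    (T3 : measurableType d3) (R : realType) (mu : {measure set T1 -> \bar R})
    (nu : {measure set T2 -> \bar R}) (rho : {measure set T3 -> \bar R})
    (phi : T1 -> T2) (psi : T2 -> T3) (b c : R) :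
  rescales mu nu phi b -> rescales nu rho psi c ->
  rescales mu rho (fun x => psi (phi x)) (b * c).
Proof.
move=> [mphi b0 H] [mpsi c0 K]; split; first exact: measurableT_comp.
  exact: mulr_gt0.
move=> f mf f0; rewrite (H (fun x => f (psi x)))//; last exact: measurableT_comp.
by rewrite K// EFinM muleA.
Qed.

Section RealLine.
Variable R : realType.
Notation leb := (@lebesgue_measure R).

Let rescales_affine_pos (k t : R) : 0 < k ->
  rescales leb leb (fun x => k * (x + t) : measurableTypeR R) k^-1.
Proof.
move=> k0; have mphi : measurable_fun setT (fun x : measurableTypeR R => k * ((x : R) + t) : measurableTypeR R).
  by apply: measurable_funM => //; apply: measurable_funD.
apply: rescalesP => //; first by rewrite invr_gt0.
have kp : 0 <= k by exact: ltW.
pose phi (x : measurableTypeR R) : measurableTypeR R := k * ((x : R) + t).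
have [nu nuE] : exists nu : {measure set (measurableTypeR R) -> \bar R},
    forall A, nu A = (k%:E * leb (phi @^-1` A))%E.
  unshelve refine (ex_intro _ (mscale (NngNum kp) (pushforward leb phi) :
    {measure set (measurableTypeR R) -> \bar R}) _); first exact: mphi.
  by [].
move=> A mA; transitivity (k^-1%:E * nu A)%E.
  by rewrite nuE muleA -EFinM mulVf ?gt_eqF// mul1e.
congr (_ * _)%E; apply/esym; apply: lebesgue_measure_unique mA.
move=> _ [[a b] _ <-].
rewrite nuE (_ : _ @^-1` _ = `](a / k - t), (b / k - t)]%classic).
  rewrite !lebesgue_measure_itv /= !lte_fin ltrD2r ltr_pM2r ?invr_gt0//.
  case: ifPn => _; last by rewrite mule0.
  rewrite -!EFinB -EFinM; congr EFin; field; rewrite ?gt_eqF//.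
apply/seteqP; split => x /=; rewrite /phi !in_itv/= [k * _]mulrC ltrBlDr lerBrDr ltr_pdivrMr// ler_pdivlMr//.
Qed.

Let rescales_opp : rescales leb leb (fun x => - x : measurableTypeR R) 1.
Proof.
apply: rescalesP => // [|A mA].
  exact: oppr_measurable.
transitivity (leb A); last exact: esym (mul1e _).
exact: lebesgue_measureN.
Qed.

Lemma rescales_affine (k t : R) : k != 0 ->
  rescales leb leb (fun x => k * (x + t) : measurableTypeR R) `|k|^-1.
Proof.
move=> k0; case: (ltgtP k 0) k0 => // k0 _.
- rewrite ltr0_norm// -[_^-1]mulr1.
  rewrite (_ : (fun x => _) = (fun x => - (- k * (x + t)))).
    by apply: rescales_comp rescales_opp; apply: rescales_affine_pos; rewrite oppr_gt0.
  by apply/funext => x; rewrite mulNr opprK.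
- by rewrite gtr0_norm//; exact: rescales_affine_pos.
Qed.

End RealLine.

Lemma ae_fin_integral d (T : measurableType d) (R : realType)
    (mu : {measure set T -> \bar R}) (f : T -> \bar R) :
  measurable_fun setT f -> (forall x, 0 <= f x)%E -> (\int[mu]_x f x < +oo)%E ->
  {ae mu, forall x, (f x < +oo)%E}.
Proof.
move=> mf f0 fy.
have fi : mu.-integrable setT f.
  apply/integrableP; split => //.
  by under eq_integral do rewrite gee0_abs//.
have := integrable_ae measurableT fi; apply: filterS => x /(_ I).
by rewrite ge0_fin_numE.
Qed.

Section Product.
Context d1 d2 (T1 : measurableType d1) (T2 : measurableType d2) (R : realType).
Variable m1 : {sigma_finite_measure set T1 -> \bar R}.
Variable m2 : {sigma_finite_measure set T2 -> \bar R}.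
Implicit Types F : T1 * T2 -> quat R.

Lemma tonelli1 (f : T1 * T2 -> \bar R) : measurable_fun setT f ->
  (forall x, 0 <= f x)%E ->
  (\int[m1 \x m2]_z f z = \int[m1]_x \int[m2]_y f (x, y))%E.
Proof. by move=> mf f0; rewrite fubini_tonelli1. Qed.

Lemma tonelli2 (f : T1 * T2 -> \bar R) : measurable_fun setT f ->
  (forall x, 0 <= f x)%E ->
  (\int[m1 \x m2]_z f z = \int[m2]_y \int[m1]_x f (x, y))%E.
Proof. by move=> mf f0; rewrite tonelli1// fubini_tonelli. Qed.

Lemma qmeasurable_slice1 F x : qmeasurable F -> qmeasurable (fun y => F (x, y)).
Proof. by apply: qmeasurable_comp; exact: measurable_fun_pair. Qed.

Lemma qmeasurable_slice2 F y : qmeasurable F -> qmeasurable (fun x => F (x, y)).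
Proof. by apply: qmeasurable_comp; exact: measurable_fun_pair. Qed.

Let measurable_Rintegral2 (g : T1 * T2 -> R) : measurable_fun setT g ->
  measurable_fun setT (fun x => \int[m2]_y g (x, y)).
Proof.
move=> mg; rewrite /Rintegral; apply: measurableT_comp => //.
under eq_fun do rewrite integralE.
have mE : measurable_fun setT (EFin \o g) by exact/measurable_EFinP.
apply: emeasurable_funB.
- have /= := measurable_fun_fubini_tonelli_F (m2 := m2) _
    (measurable_funepos mE) (fun x => funepos_ge0 _ x).
  apply: eq_measurable_fun => x _; apply: eq_integral => y _.
  by rewrite !funeposE.
- have /= := measurable_fun_fubini_tonelli_F (m2 := m2) _
    (measurable_funeneg mE) (fun x => funeneg_ge0 _ x).
  apply: eq_measurable_fun => x _; apply: eq_integral => y _.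
  by rewrite !funenegE.
Qed.

Lemma qmeasurable_qintegral2 F : qmeasurable F ->
  qmeasurable (fun x => qintegral m2 (fun y => F (x, y))).
Proof.
move=> [h0 h1 h2 h3]; split; [exact: (measurable_Rintegral2 h0)
  |exact: (measurable_Rintegral2 h1)|exact: (measurable_Rintegral2 h2)
  |exact: (measurable_Rintegral2 h3)].
Qed.

Lemma measurable_energy1 F : qmeasurable F ->
  measurable_fun setT (fun x => energy m2 (fun y => F (x, y))).
Proof.
move=> mF; exact: (measurable_fun_fubini_tonelli_F (m2 := m2) _
  (measurable_EFin_qsq mF) (fun x => EFin_qsq_ge0 _)).
Qed.

Lemma measurable_energy2 F : qmeasurable F ->
  measurable_fun setT (fun y => energy m1 (fun x => F (x, y))).
Proof.
move=> mF; exact: (measurable_fun_fubini_tonelli_G (m1 := m1) _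
  (measurable_EFin_qsq mF) (fun x => EFin_qsq_ge0 _)).
Qed.

Lemma energy_prod1 F : qmeasurable F ->
  (energy (m1 \x m2) F = \int[m1]_x energy m2 (fun y => F (x, y)))%E.
Proof. by move=> mF; rewrite /energy tonelli1//; exact: measurable_EFin_qsq. Qed.

Lemma energy_prod2 F : qmeasurable F ->
  (energy (m1 \x m2) F = \int[m2]_y energy m1 (fun x => F (x, y)))%E.
Proof. by move=> mF; rewrite /energy tonelli2//; exact: measurable_EFin_qsq. Qed.

Lemma ae_slice2_qL1 F : qL (m1 \x m2)%E 1%:E F ->
  {ae m2, forall y, qL m1 1%:E (fun x => F (x, y))}.
Proof.
move=> /qL1P[mF Fy]; have mqF := measurable_EFin_qmod mF.
rewrite tonelli2// in Fy.
have := ae_fin_integral (measurable_fun_fubini_tonelli_G (m1 := m1) _ mqF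
  (fun x => EFin_qmod_ge0 _)) (fun y => integral_ge0 _ _) Fy.
move=> /(_ (fun _ _ => _)); move=> /(_ (fun _ _ _ => EFin_qmod_ge0 _)).
apply: filterS => y yy; apply/qL1P; split => //; exact: qmeasurable_slice2.
Qed.

Lemma ae_slice2_qL2 F : qL (m1 \x m2)%E 2%:E F ->
  {ae m2, forall y, qL m1 2%:E (fun x => F (x, y))}.
Proof.
move=> /qL2P[mF Fy]; rewrite energy_prod2// in Fy.
have := ae_fin_integral (measurable_energy2 mF) (fun y => energy_ge0 _ _) Fy.
apply: filterS => y yy; apply/qL2P; split => //; exact: qmeasurable_slice2.
Qed.

Let RFubini1 (g : T1 * T2 -> R) : (m1 \x m2)%E.-integrable setT (EFin \o g) ->
  \int[(m1 \x m2)%E]_z g z = \int[m1]_x \int[m2]_y g (x, y).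
Proof.
move=> gi; rewrite /Rintegral; congr fine.
have Gi := integrable_fubini_F gi.
rewrite -(integral12_prod_meas1 gi); apply: ae_eq_integral => //.
- exact: measurable_int Gi.
- apply/measurable_EFinP; apply: measurable_Rintegral2.
  by apply/measurable_EFinP; exact: measurable_int gi.
- have := integrable_ae measurableT Gi; apply: filterS => x /(_ I) xf _.
  by rewrite fineK.
Qed.

Lemma qFubini1 F : qL (m1 \x m2)%E 1%:E F ->
  qintegral (m1 \x m2)%E F = qintegral m1 (fun x => qintegral m2 (fun y => F (x, y))).
Proof.
move=> /qL1_integrable[i0 i1 i2 i3]; apply: quatP.
by split; [exact: (RFubini1 i0)|exact: (RFubini1 i1)
  |exact: (RFubini1 i2)|exact: (RFubini1 i3)].
Qed.

End Product.

Section ProductSwap.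
Context d1 d2 (T1 : measurableType d1) (T2 : measurableType d2) (R : realType).
Variable m1 : {sigma_finite_measure set T1 -> \bar R}.
Variable m2 : {sigma_finite_measure set T2 -> \bar R}.
Implicit Types F : T1 * T2 -> quat R.

Lemma qmeasurable_qintegral1 F : qmeasurable F ->
  qmeasurable (fun y => qintegral m1 (fun x => F (x, y))).
Proof.
move=> mF; have := @qmeasurable_qintegral2 _ _ _ _ R m1 (fun p => F (p.2, p.1)).
apply; apply: qmeasurable_comp mF; exact: measurable_fun_pair.
Qed.

Lemma rescales_swap :
  rescales (m2 \x m1)%E (m1 \x m2)%E (fun p : T2 * T1 => (p.2, p.1)) 1.
Proof.
split; [exact: measurable_fun_pair | by [] | move=> f mf f0].
rewrite mul1e tonelli1//; first by rewrite (tonelli2 m1 m2 mf f0).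
by apply: measurableT_comp mf _; exact: measurable_fun_pair.
Qed.

Lemma qFubini2 F : qL (m1 \x m2)%E 1%:E F ->
  qintegral (m1 \x m2)%E F = qintegral m2 (fun y => qintegral m1 (fun x => F (x, y))).
Proof.
move=> FL; have := rescales_qintegral rescales_swap FL; rewrite scale1r => <-.
by rewrite qFubini1//; exact: (rescales_qL1 rescales_swap FL).
Qed.

Lemma qFubini_exchange F : qL (m1 \x m2)%E 1%:E F ->
  qintegral m1 (fun x => qintegral m2 (fun y => F (x, y))) =
  qintegral m2 (fun y => qintegral m1 (fun x => F (x, y))).
Proof. by move=> FL; rewrite -qFubini1// qFubini2. Qed.

(** Triangular maps: one factor is mapped on its own, and over each of its points
    the other factor is mapped with a constant ratio. *)
Lemma rescales_fiber2 (phi : T1 * T2 -> T1) (chi : T2 -> T2) (b c : R) :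
  measurable_fun setT phi -> 0 < b ->
  (forall y, rescales m1 m1 (fun x => phi (x, y)) b) -> rescales m2 m2 chi c ->
  rescales (m1 \x m2)%E (m1 \x m2)%E (fun p => (phi p, chi p.2)) (b * c).
Proof.
move=> mphi b0 rphi [mchi c0 H].
have mpc : measurable_fun setT (fun p : T1 * T2 => (phi p, chi p.2)).
  by apply: measurable_fun_pair => //; exact: measurableT_comp.
split => //; first exact: mulr_gt0.
move=> f mf f0; rewrite (tonelli2 m1 m2 mf f0) tonelli2//; last exact: measurableT_comp mf mpc.
have mG : measurable_fun setT (fun y => \int[m1]_x f (x, y))%E.
  exact: (measurable_fun_fubini_tonelli_G (m1 := m1) _ mf f0).
have G0 y : (0 <= \int[m1]_x f (x, y))%E by exact: integral_ge0.
rewrite EFinM -muleA -H// -ge0_integralZl//; last 2 first.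
- exact: measurableT_comp mG mchi.
- by rewrite lee_fin ltW.
apply: eq_integral => y _; have [_ _ K] := rphi y.
by rewrite (K (fun x => f (x, chi y)))//; apply: measurableT_comp mf _; exact: measurable_fun_pair.
Qed.

Lemma rescales_fiber1 (phi : T1 -> T1) (chi : T1 * T2 -> T2) (b c : R) :
  measurable_fun setT chi -> 0 < c ->
  rescales m1 m1 phi b -> (forall x, rescales m2 m2 (fun y => chi (x, y)) c) ->
  rescales (m1 \x m2)%E (m1 \x m2)%E (fun p => (phi p.1, chi p)) (b * c).
Proof.
move=> mchi c0 [mphi b0 H] rchi.
have mpc : measurable_fun setT (fun p : T1 * T2 => (phi p.1, chi p)).
  by apply: measurable_fun_pair => //; exact: measurableT_comp.
split => //; first exact: mulr_gt0.
move=> f mf f0; rewrite !tonelli1//; last exact: measurableT_comp mf mpc.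
have mG : measurable_fun setT (fun x => \int[m2]_y f (x, y))%E.
  exact: (measurable_fun_fubini_tonelli_F (m2 := m2) _ mf f0).
have G0 x : (0 <= \int[m2]_y f (x, y))%E by exact: integral_ge0.
rewrite mulrC EFinM -muleA -(H (fun x => \int[m2]_y f (x, y))%E)//.
rewrite -ge0_integralZl//; last 2 first.
- exact: measurableT_comp mG mphi.
- by rewrite lee_fin ltW.
apply: eq_integral => x _; have [_ _ K] := rchi x.
by rewrite (K (fun y => f (phi x, y)))//; apply: measurableT_comp mf _; exact: measurable_fun_pair.
Qed.

End ProductSwap.

(** * Lebesgue measure on column vectors *)

Section LebesgueColumn.
Variable R : realType.
Notation leb1 := (@lebesgue_measure R).

Lemma cV_cons_ord0 m a (x : 'cV[R]_m) : cV_cons (a, x) ord0 ord0 = a.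
Proof. by have [] := cV_consK (a, x). Qed.

Lemma cV_cons_lift m a (x : 'cV[R]_m) (i : 'I_m) :
  cV_cons (a, x) (lift ord0 i) ord0 = x i ord0.
Proof.
have [_ e] := cV_consK (a, x); rewrite -[in RHS]e [RHS]mxE; congr (fun_of_matrix _ _ _).
exact/val_inj.
Qed.

Lemma cV_consP m (x : 'cV[R]_m.+1) : exists a y, x = cV_cons (a, y).
Proof. by exists (cV_uncons x).1, (cV_uncons x).2; rewrite -surjective_pairing cV_unconsK. Qed.

Lemma eq_cV_cons m (x : 'cV[R]_m.+1) (a : R) (y : 'cV[R]_m) : x ord0 ord0 = a ->
  (forall i, x (lift ord0 i) ord0 = y i ord0) -> x = cV_cons (a, y).
Proof.
move=> x0 xS; apply/matrixP => i j; rewrite ord1.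
have [k ->|->] := unliftP ord0 i; first by rewrite cV_cons_lift xS.
by rewrite x0 cV_cons_ord0.
Qed.

Lemma cV_consD m a b (x y : 'cV[R]_m) :
  cV_cons (a, x) + cV_cons (b, y) = cV_cons ((a : R) + b, x + y).
Proof.
by apply: eq_cV_cons => [|i]; rewrite mxE ?cV_cons_ord0// !cV_cons_lift mxE.
Qed.

Lemma cV_consZ m k a (x : 'cV[R]_m) :
  k *: cV_cons (a, x) = cV_cons (k * a : R, k *: x).
Proof.
by apply: eq_cV_cons => [|i]; rewrite mxE ?cV_cons_ord0// !cV_cons_lift mxE.
Qed.

Lemma dotcV_cons m a b (x y : 'cV[R]_m) :
  dotcV (cV_cons (a, x)) (cV_cons (b, y)) = (a : R) * b + dotcV x y.
Proof.
rewrite /dotcV big_ord_recl !cV_cons_ord0; congr (_ + _).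
by apply: eq_bigr => i _; rewrite !cV_cons_lift.
Qed.

Lemma rescales_cV_cons m :
  rescales (leb1 \x lebesgue_cV R m)%E (lebesgue_cV R m.+1) (@cV_cons R m) 1.
Proof.
split; [exact: measurable_cV_cons | by [] | move=> f mf f0].
by rewrite mul1e [RHS](ge0_integral_pushforward (@measurable_cV_cons R m)).
Qed.

Lemma rescales_cV_uncons m :
  rescales (lebesgue_cV R m.+1) (leb1 \x lebesgue_cV R m)%E (@cV_uncons R m) 1.
Proof.
split; [exact: measurable_cV_uncons | by [] | move=> f mf f0].
have [_ _ H] := rescales_cV_cons m.
have := H (f \o @cV_uncons R m); rewrite !mul1e /= => <- //; last first.
  by apply: measurableT_comp mf _; exact: measurable_cV_uncons.
by apply: eq_integral => p _; rewrite cV_consK.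
Qed.

Lemma rescales_cV_conj m (phi : measurableTypeR R * 'cV[R]_m -> measurableTypeR R * 'cV[R]_m) c :
  rescales (leb1 \x lebesgue_cV R m)%E (leb1 \x lebesgue_cV R m)%E phi c ->
  rescales (lebesgue_cV R m.+1) (lebesgue_cV R m.+1)
    (fun x => cV_cons (phi (cV_uncons x))) c.
Proof.
move=> rphi; rewrite -[c]mul1r -[c]mulr1 mulrA.
apply: rescales_comp (rescales_cV_cons m); rewrite mul1r -[c]mul1r.
exact: rescales_comp (rescales_cV_uncons m) rphi.
Qed.

Lemma rescales_cV_affine m (k : R) (t : 'cV[R]_m) : k != 0 ->
  rescales (lebesgue_cV R m) (lebesgue_cV R m) (fun x => k *: (x + t)) (`|k| ^- m).
Proof.
move=> k0; have kp : 0 < `|k| by rewrite normr_gt0.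
elim: m t => [|m IH] t.
  have -> : (fun x : 'cV_0 => k *: (x + t)) = id.
    by apply/funext => x; rewrite (flatmx0 (k *: _)) (flatmx0 x).
  by split => //; [rewrite expr0 invr1 | move=> f mf f0; rewrite expr0 invr1 mul1e].
have [b [s ->]] := cV_consP t.
have -> : (fun x : 'cV_m.+1 => k *: (x + cV_cons (b, s))) = (fun x => cV_cons
    ((fun p => (k * ((p.1 : R) + b) : measurableTypeR R, k *: (p.2 + s))) (cV_uncons x))).
  apply/funext => x; rewrite -[in LHS](cV_unconsK x) [cV_uncons x]surjective_pairing.
  by rewrite cV_consD cV_consZ.
rewrite exprS invfM; apply: (@rescales_cV_conj m
  (fun p => (k * ((p.1 : R) + b) : measurableTypeR R, k *: (p.2 + s)))).
have [mk _ _] := rescales_affine b k0.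
apply: (@rescales_fiber2 _ _ _ _ _ leb1 (lebesgue_cV R m)
  (fun p => k * ((p.1 : R) + b) : measurableTypeR R) (fun x => k *: (x + s))).
- exact: (measurableT_comp mk measurable_fst).
- by rewrite invr_gt0.
- by move=> y; exact: rescales_affine.
- exact: IH.
Qed.

End LebesgueColumn.

(** * The Poisson kernel *)

Section Poisson.
Variable R : realType.
Notation leb := (@lebesgue_measure R).
Notation RR := (measurableTypeR R).
Implicit Types b c l x z : R.

Definition laplace_weight (b l : R) : R := expR (- (b * `|l|)).

Definition poisson (b z : R) : R := 2 * b / (b ^+ 2 + (2 * pi * z) ^+ 2).

Let E b (l : R) := expR (- b * l).

Let dE b x : is_derive x 1 (E b) (- b * E b x).
Proof.
have dl : is_derive x 1 (fun l : R => - b * l) (- b * 1).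
  exact: (is_deriveZ (f := id)).
apply: is_derive_eq (is_derive1_comp (is_derive_expR _) dl) _.
by rewrite mulr1 mulrC.
Qed.

Let dsin c x : is_derive x 1 (fun l : R => sin (c * l)) (c * cos (c * x)).
Proof.
have dl : is_derive x 1 (fun l : R => c * l) (c * 1).
  exact: (is_deriveZ (f := id)).
apply: is_derive_eq (is_derive1_comp (is_derive_sin _) dl) _.
by rewrite mulr1 mulrC.
Qed.

Let dcos c x : is_derive x 1 (fun l : R => cos (c * l)) (- (c * sin (c * x))).
Proof.
have dl : is_derive x 1 (fun l : R => c * l) (c * 1).
  exact: (is_deriveZ (f := id)).
apply: is_derive_eq (is_derive1_comp (is_derive_cos _) dl) _.
by rewrite mulr1 mulrC mulrN.
Qed.

(* a primitive of the weight times 1 + cos: adding 1 makes the integrand nonnegative,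
   as the fundamental theorem of calculus on a half-line requires *)
Let F b c (l : R) := E b l * (- b^-1 +
  (b ^+ 2 + c ^+ 2)^-1 * (c * sin (c * l) - b * cos (c * l))).

Let den_neq0 b c : 0 < b -> b ^+ 2 + c ^+ 2 != 0.
Proof. by move=> b0; rewrite gt_eqF// ltr_wpDr ?sqr_ge0// exprn_gt0. Qed.

Let dF b c x : 0 < b -> is_derive x 1 (F b c) (E b x * (1 + cos (c * x))).
Proof.
move=> b0; pose s := (b ^+ 2 + c ^+ 2)^-1.
have d1 := dsin c x; have d2 := dcos c x; have d3 := dE b x.
have d4 : is_derive x 1 (fun l => c * sin (c * l) - b * cos (c * l))
    (c * (c * cos (c * x)) - b * - (c * sin (c * x))).
  exact: (is_deriveB (is_deriveZ c d1) (is_deriveZ b d2)).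
have d5 : is_derive x 1 (fun l => - b^-1 + s * (c * sin (c * l) - b * cos (c * l)))
    (0 + s * (c * (c * cos (c * x)) - b * - (c * sin (c * x)))).
  exact: (is_deriveD (is_derive_cst (- b^-1) x 1) (is_deriveZ s d4)).
apply: is_derive_eq (is_deriveM d3 d5) _.
rewrite /GRing.scale/= /s; field.
by rewrite den_neq0// gt_eqF.
Qed.

Let cvgE b : 0 < b -> E b x @[x --> +oo] --> 0.
Proof.
move=> b0; have -> : E b = (fun y => expR (- y)) \o (fun x => b * x).
  by apply/funext => x; rewrite /E /= mulNr.
apply: (@cvg_comp _ _ _ (fun x => b * x) (fun y => expR (- y)) _ (pinfty_nbhs R)); last exact: cvgr_expR.
exact: gt0_cvgMry.
Qed.

Let cvgF b c : 0 < b -> F b c x @[x --> +oo] --> 0.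
Proof.
move=> b0; set K := b^-1 + (b ^+ 2 + c ^+ 2)^-1 * (`|c| + b).
have s0 : 0 <= (b ^+ 2 + c ^+ 2)^-1 by rewrite invr_ge0 addr_ge0// sqr_ge0.
apply/cvgr0Pnorm_le => e e0.
have H := cvgr0_norm_le _ (cvgE b0).
have K0 : 0 < K + 1 by rewrite ltr_wpDl// addr_ge0 ?invr_ge0 ?mulr_ge0 ?addr_ge0// ltW.
have := H _ (e / (K + 1)); rewrite divr_gt0// => /(_ _ isT); apply: filterS => x Hx.
rewrite /F normrM.
apply: (@le_trans _ _ (`|E b x| * (K + 1))); last by rewrite -ler_pdivlMr.
apply: ler_wpM2l => //; rewrite ler_wpDr//.
apply: le_trans (ler_normD _ _) _; rewrite normrN normfV (gtr0_norm b0) lerD2l.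
rewrite normrM (ger0_norm s0) ler_wpM2l//.
apply: le_trans (ler_normB _ _) _; rewrite !normrM (ger0_norm (ltW b0)) lerD//.
  by rewrite ler_piMr// sin_max.
by rewrite ler_piMr ?cos_max// ltW.
Qed.

Let cderiv (f : R -> R) : (forall x, exists y, is_derive (x : R) 1 f y) -> continuous f.
Proof.
move=> df x; have [y dfx] := df x.
by apply/differentiable_continuous/derivable1_diffP.
Qed.

Let integral_half b c : 0 < b ->
  (\int[leb]_(x in `[0%R, +oo[) (E b x * (1 + cos (c * x)))%:E =
   (b^-1 + b / (b ^+ 2 + c ^+ 2))%:E)%E.
Proof.
move=> b0.
have cE : continuous (E b) by apply: cderiv => x; exists (- b * E b x).
have ccos : continuous (fun x => cos (c * x)) by apply: cderiv => x; eexists; exact: dcos.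
rewrite (@ge0_continuous_FTC2y _ _ (F b c) 0 0).
- rewrite /F /E mulr0 expR0 mulr0 sin0 cos0 -EFinD; congr EFin.
  by rewrite mulr0 mulr1 sub0r; ring.
- by move=> x _; rewrite mulr_ge0 ?expR_ge0// -lerBlDl sub0r cos_geN1.
- apply: continuous_subspaceT => x; apply: cvgM; first exact: cE.
  by apply: cvgD; [exact: cvg_cst|exact: ccos].
- exact: cvgF.
- by move=> x _; have := dF c x b0; case.
- apply: cvg_at_right_filter; apply: cderiv => x.
  by exists (E b x * (1 + cos (c * x))); exact: dF.
- by move=> x _; rewrite derive1E; have := dF c x b0 => d; rewrite derive_val.
Qed.

Lemma laplace_weight_ge0 b l : 0 <= laplace_weight b l.
Proof. exact: expR_ge0. Qed.

Lemma continuous_laplace_weight b : continuous (laplace_weight b).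
Proof.
move=> x; apply: continuous_comp; last exact: continuous_expR.
apply: cvgN; apply: cvgM; first exact: cvg_cst.
exact: norm_continuous.
Qed.

Let integral_even b c : 0 < b ->
  (\int[leb]_x (laplace_weight b x * (1 + cos (c * x)))%:E =
   (2 * (b^-1 + b / (b ^+ 2 + c ^+ 2)))%:E)%E.
Proof.
move=> b0; rewrite ge0_symfun_integralT.
- rewrite EFinM -integral_half// -set_itvcy; congr (_ * _)%E.
  apply: eq_integral => x; rewrite inE/= in_itv/= andbT => x0.
  by rewrite /laplace_weight /E ger0_norm// mulNr.
- by move=> x; rewrite mulr_ge0 ?expR_ge0// -lerBlDl sub0r cos_geN1.
- move=> x; apply: cvgM; first exact: continuous_laplace_weight.
  apply: cvgD; [exact: cvg_cst|].
  have ccos : continuous (fun x => cos (c * x)).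
    by apply: cderiv => y; eexists; exact: dcos.
  exact: ccos.
- by move=> x; rewrite /= /laplace_weight normrN mulrN cosN.
Qed.

Lemma measurable_laplace_weight b : measurable_fun setT (laplace_weight b).
Proof. by apply: continuous_measurable_fun; exact: continuous_laplace_weight. Qed.

Let mw b : measurable_fun setT (fun x => (laplace_weight b x)%:E).
Proof. by apply/measurable_EFinP; exact: measurable_laplace_weight. Qed.

Lemma integral_laplace_weight b : 0 < b ->
  (\int[leb]_x (laplace_weight b x)%:E = (2 / b)%:E)%E.
Proof.
move=> b0; transitivity
    (\int[leb]_x (2^-1%:E * (laplace_weight b x * (1 + cos (0 * x)))%:E))%E.
  apply: eq_integral => x _; rewrite -EFinM mul0r cos0; congr EFin.
  by rewrite mulrCA (_ : 2^-1 * (1 + 1) = 1) ?mulr1//; field.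
rewrite ge0_integralZl//.
- rewrite integral_even// -EFinM; congr EFin; rewrite expr0n addr0 /=.
  by field; rewrite gt_eqF.
- under eq_fun do rewrite mul0r cos0.
  apply/measurable_EFinP; apply: measurable_funM => //.
  exact: measurable_laplace_weight.
- by move=> x _; rewrite lee_fin mulr_ge0 ?expR_ge0// mul0r cos0 addr_ge0.
Qed.

Lemma integrable_laplace_weight b : 0 < b ->
  leb.-integrable setT (EFin \o laplace_weight b).
Proof.
move=> b0; apply/integrableP; split; first exact: mw.
under eq_integral do rewrite /= ger0_norm ?laplace_weight_ge0//.
by rewrite integral_laplace_weight// ltry.
Qed.

Lemma qL1_laplace_weight_ej b (u : RR -> R) : 0 < b -> measurable_fun setT u ->
  qL leb 1%:E (fun l => laplace_weight b l *: ej (u l)).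
Proof.
move=> b0 mu; apply: (@qL1_dominated _ RR R leb _ (laplace_weight b)).
- apply: qmeasurableZ; [exact: measurable_laplace_weight|exact: qmeasurable_ej].
- exact: measurable_laplace_weight.
- by move=> x; rewrite qmodZ qmod_ej mulr1 ger0_norm// laplace_weight_ge0.
- by rewrite integral_laplace_weight// ltry.
Qed.

Let Rintegral_cos b c : 0 < b ->
  \int[leb]_x (laplace_weight b x * cos (c * x)) = 2 * b / (b ^+ 2 + c ^+ 2).
Proof.
move=> b0; have iw := integrable_laplace_weight b0.
have mcos : measurable_fun setT (fun x => cos (c * x)).
  apply: measurableT_comp; last exact: measurable_funM.
  by apply: continuous_measurable_fun; exact: continuous_cos.
have iwc : leb.-integrable setT (EFin \o (fun x => laplace_weight b x * (1 + cos (c * x)))).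
  apply/integrableP; split.
    apply/measurable_EFinP; apply: measurable_funM; first exact: measurable_laplace_weight.
    exact: measurable_funD.
  under eq_integral do rewrite /= ger0_norm ?mulr_ge0 ?expR_ge0 -?lerBlDl ?sub0r ?cos_geN1//.
  by rewrite integral_even// ltry.
transitivity (\int[leb]_x (laplace_weight b x * (1 + cos (c * x)) - laplace_weight b x)).
  by apply: eq_Rintegral => x _; rewrite mulrDr mulr1 addrAC subrr add0r.
rewrite RintegralB// /Rintegral integral_even// integral_laplace_weight//=.
by field; rewrite den_neq0//= gt_eqF.
Qed.

(** The Poisson kernel is the Fourier transform of the two-sided exponential. *)
Lemma qintegral_laplace_weight b z : 0 < b ->
  qintegral leb (fun l : RR => laplace_weight b l *: ej (- (2 * pi * ((l : R) * z)))) =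
  poisson b z *: 1.
Proof.
move=> b0; set g := fun l : RR => _; set I := qintegral _ _.
have gL : qL leb 1%:E g.
  apply: qL1_laplace_weight_ej => //; apply: measurableT_comp => //.
  by apply: measurable_funM => //; exact: measurable_funM.
(* invariance under l |-> -l makes the sine part vanish *)
have N10 : (-1 : R) != 0 by rewrite oppr_eq0 oner_eq0.
have gE l : g l = Quat (laplace_weight b l * cos (2 * pi * z * l)) 0
    (- (laplace_weight b l * sin (2 * pi * z * l))) 0.
  rewrite /g ejE cosN sinN [_ * z]mulrC !mulrA; apply: quatP.
  by split; rewrite /= ?mulr0// mulrN.
have I2 : q2 I = 0.
  suff : q2 I = - q2 I by set y := q2 I => h; lra.
  have := rescales_qintegral (rescales_affine 0 N10) gL.
  rewrite normrN normr1 invr1 scale1r => /(congr1 (@q2 R)) e; rewrite -[LHS]e.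
  rewrite -[q2 I]/(\int[leb]_x q2 (g x)) -[RHS]mulN1r -RintegralZl//; last first.
    by have [] := qL1_integrable gL.
  apply: eq_Rintegral => x _; rewrite addr0 !gE /= /laplace_weight mulN1r normrN.
  by rewrite mulrN sinN mulrN mulN1r.
apply: quatP; split; rewrite ?I2 [RHS]/= ?mulr0//.
- rewrite mulr1 /poisson -Rintegral_cos//.
  by apply: eq_Rintegral => x _; rewrite -[LHS]/(q0 (g x)) gE.
- transitivity (\int[leb]_(_ in setT) (0 : R)); last by rewrite Rintegral_cst// mul0r.
  by apply: eq_Rintegral => x _; rewrite -[LHS]/(q1 (g x)) gE.
- transitivity (\int[leb]_(_ in setT) (0 : R)); last by rewrite Rintegral_cst// mul0r.
  by apply: eq_Rintegral => x _; rewrite -[LHS]/(q3 (g x)) gE.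
Qed.

Lemma integral_poisson b : 0 < b -> (\int[leb]_z (poisson b z)%:E = 1)%E.
Proof.
move=> b0; set k := 2 * pi / b.
have k0 : k != 0 by rewrite gt_eqF// divr_gt0// mulr_gt0// pi_gt0.
have co : continuous (fun x : R => (oneDsqr x)^-1) by exact: continuous_oneDsqrV.
have mo : measurable_fun setT (fun x : R => ((oneDsqr x)^-1)%:E).
  by apply/measurable_EFinP; exact: continuous_measurable_fun.
have o0 (x : R) : (0 <= ((oneDsqr x)^-1)%:E)%E.
  by rewrite lee_fin invr_ge0 ltW// oneDsqr_gt0.
transitivity (\int[leb]_z ((2 / b)%:E * ((oneDsqr (k * (z + 0)))^-1)%:E))%E.
  apply: eq_integral => z _; rewrite -EFinM; congr EFin; rewrite addr0 /poisson /oneDsqr /k.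
  move: (z : R) => y; have b_neq0 : b != 0 by rewrite gt_eqF.
  have -> : 1 + (2 * pi / b * y) ^+ 2 = (b ^+ 2 + (2 * pi * y) ^+ 2) / b ^+ 2.
    by field.
  have := den_neq0 (2 * pi * y) b0; set D := b ^+ 2 + _ => D0.
  by field; rewrite ?D0 ?b_neq0.
have [mk _ H] := rescales_affine 0 k0.
rewrite ge0_integralZl//.
- rewrite (H (fun x => ((oneDsqr x)^-1)%:E)) // ge0_symfun_integralT//.
  + rewrite -set_itvcy integral0y_oneDsqr -!EFinM; congr EFin.
    rewrite gtr0_norm ?divr_gt0 ?mulr_gt0 ?pi_gt0// /k.
    have := gt_eqF (pi_gt0 R); move: (pi : R) => p /negbT p0; field.
    by rewrite p0 (gt_eqF b0).
  + by move=> x; rewrite /= /oneDsqr sqrrN.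
- exact: measurableT_comp mo mk.
- by rewrite lee_fin divr_ge0// ltW.
Qed.

Lemma poisson_ge0 b z : 0 < b -> 0 <= poisson b z.
Proof.
by move=> b0; rewrite divr_ge0 ?mulr_ge0 ?addr_ge0 ?sqr_ge0// ltW.
Qed.

Lemma poisson_le b z : 0 < b -> poisson b z <= 2 / b.
Proof.
move=> b0; rewrite /poisson ler_pdivrMr; last by rewrite ltr_wpDr ?sqr_ge0// exprn_gt0.
rewrite -subr_ge0 (_ : _ - _ = 2 / b * (2 * pi * z) ^+ 2).
  by rewrite mulr_ge0 ?sqr_ge0// divr_ge0// ltW.
by move: (pi : R) => p; field; rewrite gt_eqF.
Qed.

(** The kernel of rate b is the dilation by b of a fixed one, so that it concentrates
    at 0 as b decreases. *)
Lemma poisson_scale b z : 0 < b -> b * poisson b (b * z) = poisson 1 z.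
Proof.
move=> b0; have := den_neq0 (2 * pi * z) (@ltr01 R).
rewrite /poisson; move: (2 * pi) => p D0.
have bn : b != 0 by rewrite gt_eqF.
have -> : b ^+ 2 + (p * (b * z)) ^+ 2 = b ^+ 2 * (1 ^+ 2 + (p * z) ^+ 2) by ring.
set D := 1 ^+ 2 + _ in D0 *.
by field; rewrite D0.
Qed.

Lemma measurable_poisson b : measurable_fun setT (poisson b : RR -> RR).
Proof.
have -> : (poisson b : RR -> RR) =
    (fun z => 2 * b * ((b ^+ 2 + (2 * pi * z) ^+ 2) `^ (-1))).
  apply/funext => z; rewrite /poisson powR_inv1//.
  by rewrite addr_ge0 ?sqr_ge0.
apply: measurable_funM => //.
apply: (@measurableT_comp _ _ _ _ RR RR (fun y => y `^ -1)); first exact: measurable_powR.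
apply: measurable_funD => //; apply: measurable_funX; exact: measurable_funM.
Qed.

End Poisson.

(** * Plancherel's theorem on the line *)

Section Auxiliary.
Context d (T : measurableType d) (R : realType).
Variable mu : {measure set T -> \bar R}.
Implicit Types f g : T -> quat R.

Lemma qintegral_conj f : qL mu 1%:E f ->
  qintegral mu (fun x => qconj (f x)) = qconj (qintegral mu f).
Proof.
move=> fL; apply: quatP; split.
- by [].
- by apply: (@Rintegral_qlinear _ _ _ mu 0 (-1) 0 0 (fun q => q1 (qconj q)) _ fL) => q /=; ring.
- by apply: (@Rintegral_qlinear _ _ _ mu 0 0 (-1) 0 (fun q => q2 (qconj q)) _ fL) => q /=; ring.
- by apply: (@Rintegral_qlinear _ _ _ mu 0 0 0 (-1) (fun q => q3 (qconj q)) _ fL) => q /=; ring.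
Qed.

Lemma qL1_conj f : qL mu 1%:E f -> qL mu 1%:E (fun x => qconj (f x)).
Proof.
move=> fL; apply: (qL1_eqmod _ fL) => [|x]; last by rewrite qmod_conj.
by apply: qmeasurable_conj; case: fL.
Qed.

Lemma qL1Z (c : R) f : qL mu 1%:E f -> qL mu 1%:E (fun x => c *: f x).
Proof.
move=> fL; rewrite (_ : (fun x => c *: f x) = (fun x => Quat c 0 0 0 * f x)).
  exact: qL1Ml.
by apply/funext => x; apply: quatP; split; rewrite /=; ring.
Qed.

Lemma qintegralZ (c : R) f : qL mu 1%:E f ->
  qintegral mu (fun x => c *: f x) = c *: qintegral mu f.
Proof.
move=> fL; have qE q : c *: q = Quat c 0 0 0 * q.
  by apply: quatP; split; rewrite /=; ring.
by rewrite qE -qintegralMl//; apply: eq_qintegral => x; rewrite qE.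
Qed.

Lemma qmodM_half (p q : quat R) : qmod p * qmod q <= 2^-1 * qsq p + 2^-1 * qsq q.
Proof.
rewrite -!qmod_sq; have := sqr_ge0 (qmod p - qmod q).
by rewrite sqrrB; lra.
Qed.

(** Cauchy-Schwarz, in the form that the arithmetic-geometric inequality gives
    for two functions of the same energy. *)
Lemma qmod_integralM_le f g (E : R) : qmeasurable f -> qmeasurable g ->
  energy mu f = E%:E -> energy mu g = E%:E ->
  (\int[mu]_x (qmod (f x * g x))%:E <= E%:E)%E.
Proof.
move=> mf mg fE gE.
have m1 := measurable_EFin_qsq mf; have m2 := measurable_EFin_qsq mg.
have -> : E%:E = (\int[mu]_x (2^-1%:E * (qsq (f x))%:E + 2^-1%:E * (qsq (g x))%:E))%E.
  rewrite ge0_integralD//; try exact: measurable_funeM.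
  - rewrite !ge0_integralZl// -/(energy mu f) -/(energy mu g) fE gE -!EFinM -EFinD.
    by congr EFin; field.
  - by move=> x _; rewrite mule_ge0.
  - by move=> x _; rewrite mule_ge0.
apply: ge0_le_integral => //.
- exact/measurable_EFin_qmod/qmeasurableM.
- by apply: emeasurable_funD; exact: measurable_funeM.
- by move=> x _; rewrite -!EFinM -EFinD lee_fin qmodM; exact: qmodM_half.
Qed.

End Auxiliary.

Section ProductL1.
Context d1 d2 (T1 : measurableType d1) (T2 : measurableType d2) (R : realType).
Variable m1 : {sigma_finite_measure set T1 -> \bar R}.
Variable m2 : {sigma_finite_measure set T2 -> \bar R}.
Implicit Types F : T1 * T2 -> quat R.

Lemma qL1_iterated F : qmeasurable F ->
  (\int[m1]_x \int[m2]_y (qmod (F (x, y)))%:E < +oo)%E -> qL (m1 \x m2)%E 1%:E F.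
Proof.
by move=> mF Fy; apply/qL1P; split => //; rewrite tonelli1//; exact: measurable_EFin_qmod.
Qed.

Lemma qL1_tensor F (u : T1 -> R) (v : T2 -> R) : qmeasurable F ->
  measurable_fun setT u -> measurable_fun setT v ->
  (forall x, 0 <= u x) -> (forall y, 0 <= v y) ->
  (forall x y, qmod (F (x, y)) <= u x * v y) ->
  (\int[m1]_x (u x)%:E < +oo)%E -> (\int[m2]_y (v y)%:E < +oo)%E ->
  qL (m1 \x m2)%E 1%:E F.
Proof.
move=> mF mu mv u0 v0 Fuv uy vy.
have mu' : measurable_fun setT (fun x => (u x)%:E) by exact/measurable_EFinP.
have mv' : measurable_fun setT (fun x => (v x)%:E) by exact/measurable_EFinP.
have muv : measurable_fun setT (fun p : T1 * T2 => u p.1 * v p.2).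
  by apply: measurable_funM; exact: measurableT_comp.
apply: (qL1_dominated mF muv) => [[x y]|]; first exact: Fuv.
rewrite tonelli1//; last 2 first.
- exact/measurable_EFinP.
- by move=> p; rewrite lee_fin mulr_ge0.
under eq_integral do under eq_integral do rewrite EFinM.
under eq_integral.
  move=> x _; rewrite /= ge0_integralZl//; first last.
  - by rewrite lee_fin.
  - by move=> y _; rewrite lee_fin.
  over.
have v0' : (0 <= \int[m2]_y (v y)%:E)%E by apply: integral_ge0 => y _; rewrite lee_fin.
rewrite ge0_integralZr//; last by move=> x _; rewrite lee_fin.
have u0' : (0 <= \int[m1]_x (u x)%:E)%E by apply: integral_ge0 => x _; rewrite lee_fin.
by apply: lte_mul_pinfty => //; rewrite ge0_fin_numE.
Qed.

End ProductL1.

Section LineTransform.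
Variable R : realType.
Notation RR := (measurableTypeR R).
Notation leb := (@lebesgue_measure R).
Implicit Types f : RR -> quat R.

Definition line_phase (l x : R) : R := - (2 * pi * (l * x)).

Definition line_fourier f (l : RR) : quat R :=
  qintegral leb (fun x : RR => f x * ej (line_phase l x)).

Lemma measurable_line_phase d (T : measurableType d) (u v : T -> RR) :
  measurable_fun setT u -> measurable_fun setT v ->
  measurable_fun setT (fun p => line_phase (u p) (v p) : RR).
Proof.
move=> mu mv; apply: measurableT_comp => //.
by apply: measurable_funM => //; exact: measurable_funM.
Qed.

Lemma qL1_line_phase f l : qL leb 1%:E f ->
  qL leb 1%:E (fun x => f x * ej (line_phase l x)).
Proof.
move=> fL; apply: (qL1_eqmod _ fL) => [|x]; last by rewrite qmodMej.
apply: qmeasurableM; first by case: fL.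
by apply: qmeasurable_ej; exact: measurable_line_phase.
Qed.

Lemma qmeasurable_line_fourier f : qmeasurable f -> qmeasurable (line_fourier f).
Proof.
move=> mf; pose F (p : RR * RR) := f p.2 * ej (line_phase p.1 p.2).
apply: (@qmeasurable_qintegral2 _ _ _ _ _ leb F).
apply: qmeasurableM; first exact: qmeasurable_comp mf.
by apply: qmeasurable_ej; exact: measurable_line_phase.
Qed.

Lemma line_fourierB f g : qL leb 1%:E f -> qL leb 1%:E g ->
  forall l, line_fourier (fun x => f x - g x) l = line_fourier f l - line_fourier g l.
Proof.
move=> fL gL l; rewrite /line_fourier -qintegralB; try exact: qL1_line_phase.
by apply: eq_qintegral => x; rewrite mulrBl.
Qed.

Lemma qmod_line_fourier_le f l : qL leb 1%:E f ->
  ((qmod (line_fourier f l))%:E <= \int[leb]_x (qmod (f x))%:E)%E.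
Proof.
move=> fL; apply: le_trans (qmod_qintegral_le (qL1_line_phase l fL)) _.
by under eq_integral do rewrite qmodMej.
Qed.

Lemma rescales_translate (z : R) :
  rescales leb leb (fun x : RR => (x : R) - z : RR) 1.
Proof.
have := rescales_affine (- z) (@oner_neq0 R); rewrite normr1 invr1.
by under [X in rescales _ _ X _]eq_fun do rewrite mul1r.
Qed.

Section Poisson.
Variables (f : RR -> quat R) (b : R).
Hypotheses (f1 : qL leb 1%:E f) (f2 : qL leb 2%:E f) (b0 : 0 < b).

Let W := laplace_weight b.
Let P := poisson b.
Let F := line_fourier f.
Let mf : qmeasurable f. Proof. by case: f1. Qed.
Let mF : qmeasurable F. Proof. exact: qmeasurable_line_fourier. Qed.
Let mW : measurable_fun setT (W : RR -> R).
Proof. exact: measurable_laplace_weight. Qed.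
Let mP : measurable_fun setT (P : RR -> R).
Proof. exact: measurable_poisson. Qed.
Let W0 l : 0 <= W l. Proof. exact: laplace_weight_ge0. Qed.
Let P0 z : 0 <= P z. Proof. exact: poisson_ge0. Qed.
Let Wy : (\int[leb]_l (W l)%:E < +oo)%E.
Proof. by rewrite integral_laplace_weight// ltry. Qed.
Let fy : (\int[leb]_x (qmod (f x))%:E < +oo)%E.
Proof. by have /qL1P[] := f1. Qed.
Let mqf : measurable_fun setT (fun x => qmod (f x)).
Proof. exact: measurable_qmod. Qed.

Definition autocorrelation (z : RR) : quat R :=
  qintegral leb (fun x : RR => f x * qconj (f ((x : R) - z))).

Let B := autocorrelation.

(** Multiplying conj(F) by the weight and transforming back convolves conj(f)
    with the Poisson kernel. *)
Let smoothed (x : RR) :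
  qintegral leb (fun l => W l *: (ej (line_phase l x) * qconj (F l))) =
  qintegral leb (fun z : RR => P z *: qconj (f ((x : R) - z))).
Proof.
pose H (p : RR * RR) := W p.1 *: ej (line_phase p.1 ((x : R) - p.2)) * qconj (f p.2).
have H1 : qL (leb \x leb)%E 1%:E H.
  apply: (@qL1_tensor _ _ RR RR R leb leb H W (fun y => qmod (f y))) => //.
    apply: qmeasurableM.
      apply: qmeasurableZ; first exact: measurableT_comp.
      apply: qmeasurable_ej; apply: measurable_line_phase => //.
      by apply: measurable_funB.
    by apply: qmeasurable_conj; exact: qmeasurable_comp mf.
  by move=> l y; rewrite /H qmodM qmodZ qmod_ej mulr1 ger0_norm//= qmod_conj.
have hL : qL leb 1%:E (fun y : RR => P ((x : R) - y) *: qconj (f y)).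
  apply: (@qL1_le _ _ _ _ _ (fun y => (2 / b) *: f y)).
  - apply: qmeasurableZ; last exact: qmeasurable_conj.
    by apply: measurableT_comp mP _; exact: measurable_funB.
  - exact: qL1Z.
  - move=> y; rewrite !qmodZ qmod_conj ler_wpM2r// ger0_norm ?P0//.
    by rewrite ger0_norm ?divr_ge0 ?(ltW b0)//; exact: poisson_le.
have N10 : (-1 : R) != 0 by rewrite oppr_eq0 oner_eq0.
transitivity (qintegral leb (fun l : RR => qintegral leb (fun y : RR => H (l, y)))).
  apply: eq_qintegral => l; rewrite /F /line_fourier -qintegral_conj; last first.
    exact: qL1_line_phase.
  have cL : qL leb 1%:E (fun y => qconj (f y * ej (line_phase l y))).
    exact/qL1_conj/qL1_line_phase.
  rewrite -qintegralMl// -qintegralZ; last exact: qL1Ml.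
  apply: eq_qintegral => y; rewrite /H /= qconjM ej_conj mulrA -ejD -qscaleAl.
  congr (_ *: (ej _ * _)); rewrite /line_phase; ring.
rewrite qFubini_exchange//.
transitivity (qintegral leb (fun y : RR => P ((x : R) - y) *: qconj (f y))).
  apply: eq_qintegral => y; rewrite /H /= qintegralMr; last first.
    by apply: qL1_laplace_weight_ej => //; apply: measurable_line_phase.
  by rewrite qintegral_laplace_weight// -qscaleAl mul1r.
have := rescales_qintegral (rescales_affine (- (x : R)) N10) hL.
rewrite normrN normr1 invr1 scale1r => <-; apply: eq_qintegral => z.
have e1 (u v : R) : -1 * (v - u) = u - v by ring.
have e2 (u v : R) : u - (u - v) = v by ring.
by rewrite e1 e2.
Qed.

Let fz2 (z : R) : qL leb 2%:E (fun x : RR => qconj (f ((x : R) - z))).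
Proof. by apply: qL2_conj; exact: (rescales_qL2 (rescales_translate z) f2). Qed.

Let ff1 (z : R) : qL leb 1%:E (fun x : RR => f x * qconj (f ((x : R) - z))).
Proof. exact: qL2M_qL1. Qed.

Let E := fine (energy leb f).
Let fE : energy leb f = E%:E.
Proof. by rewrite fineK// ge0_fin_numE ?energy_ge0//; have /qL2P[] := f2. Qed.

Let E0 : 0 <= E. Proof. by rewrite fine_ge0// energy_ge0. Qed.

Let fzE (z : R) : energy leb (fun x : RR => qconj (f ((x : R) - z))) = E%:E.
Proof.
rewrite -fE -[RHS]mul1e -(rescales_energy (rescales_translate z) mf).
by apply: eq_energy => x; rewrite qsq_conj.
Qed.

Let ffE (z : R) :
  (\int[leb]_x (qmod (f x * qconj (f ((x : R) - z)%R)))%:E <= E%:E)%E.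
Proof. by apply: qmod_integralM_le => //; case: (fz2 z). Qed.

Let mK : qmeasurable (fun p : RR * RR => P p.1 *: (f p.2 * qconj (f ((p.2 : R) - p.1)))).
Proof.
apply: qmeasurableZ; first exact: measurableT_comp.
apply: qmeasurableM; first exact: qmeasurable_comp mf.
apply: qmeasurable_conj; apply: qmeasurable_comp mf; exact: measurable_funB.
Qed.

Lemma qmeasurable_autocorrelation : qmeasurable B.
Proof.
pose G (p : RR * RR) := f p.2 * qconj (f ((p.2 : R) - p.1)).
apply: (@qmeasurable_qintegral2 _ _ _ _ _ leb G).
apply: qmeasurableM; first exact: qmeasurable_comp mf.
apply: qmeasurable_conj; apply: qmeasurable_comp mf; exact: measurable_funB.
Qed.

Lemma qmod_autocorrelation_le z : qmod (B z) <= E.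
Proof.
rewrite -lee_fin; apply: le_trans (qmod_qintegral_le (ff1 z)) _; exact: ffE.
Qed.

Let Py : (\int[leb]_z (P z)%:E = 1)%E. Proof. exact: integral_poisson. Qed.

Lemma qL1_poisson_autocorrelation : qL leb 1%:E (fun z => P z *: B z).
Proof.
apply: (@qL1_dominated _ RR R leb _ (fun z => P z * E)).
- by apply: qmeasurableZ => //; exact: qmeasurable_autocorrelation.
- exact: measurable_funM.
- by move=> z; rewrite qmodZ ger0_norm ?P0// ler_wpM2l// qmod_autocorrelation_le.
under eq_integral do rewrite EFinM.
rewrite ge0_integralZr//; first by rewrite Py mul1e ltry.
- exact/measurable_EFinP.
- by move=> z _; rewrite lee_fin.
Qed.

Let Nf := fine (\int[leb]_x (qmod (f x))%:E)%E.

Let FN l : qmod (F l) <= Nf.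
Proof.
rewrite -lee_fin fineK; first exact: qmod_line_fourier_le.
by rewrite ge0_fin_numE// integral_ge0.
Qed.

Let Nf0 : 0 <= Nf. Proof. by rewrite fine_ge0// integral_ge0. Qed.

Let WF1 (u : RR -> quat R) (C : R) : qmeasurable u -> 0 <= C ->
  (forall l, qmod (u l) <= C) -> qL leb 1%:E (fun l => W l *: (u l * qconj (F l))).
Proof.
move=> mu C0 uC; apply: (@qL1_dominated _ RR R leb _ (fun l => W l * (C * Nf))).
- apply: qmeasurableZ => //; apply: qmeasurableM => //; exact: qmeasurable_conj.
- exact: measurable_funM.
- move=> l; rewrite qmodZ qmodM qmod_conj ger0_norm ?W0// ler_wpM2l//.
  by rewrite ler_pM.
under eq_integral do rewrite EFinM.
rewrite ge0_integralZr//; last 2 first.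
- by move=> z _; rewrite lee_fin.
- by rewrite lee_fin mulr_ge0.
- by rewrite integral_laplace_weight// -EFinM ltry.
- exact/measurable_EFinP.
Qed.

(* Fubini on the product of the weighted conjugate transform with the integral that
   defines the transform, then the smoothing formula *)
Let weighted :
  qintegral leb (fun l => W l *: (F l * qconj (F l))) = qintegral leb (fun z => P z *: B z).
Proof.
pose H (p : RR * RR) := f p.2 * ej (line_phase p.1 p.2) * (W p.1 *: qconj (F p.1)).
have H1 : qL (leb \x leb)%E 1%:E H.
  apply: (@qL1_tensor _ _ RR RR R leb leb H (fun l => W l * Nf) (fun y => qmod (f y))) => //.
  - apply: qmeasurableM.
      apply: qmeasurableM; first exact: qmeasurable_comp mf.
      by apply: qmeasurable_ej; exact: measurable_line_phase.
    apply: qmeasurableZ; first exact: measurableT_comp.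
    by apply: qmeasurable_conj; exact: qmeasurable_comp mF.
  - exact: measurable_funM.
  - by move=> l; rewrite mulr_ge0.
  - move=> l x; rewrite /H /= qmodM qmodMej qmodZ qmod_conj ger0_norm ?W0//.
    by rewrite mulrC ler_wpM2r// ler_wpM2l.
  under eq_integral do rewrite EFinM.
  rewrite ge0_integralZr//.
  - by rewrite integral_laplace_weight// -EFinM ltry.
  - exact/measurable_EFinP.
  - by move=> z _; rewrite lee_fin.
transitivity (qintegral leb (fun l : RR => qintegral leb (fun x : RR => H (l, x)))).
  apply: eq_qintegral => l; rewrite /H /= qintegralMr; last exact: qL1_line_phase.
  by rewrite -qscaleAr.
rewrite qFubini_exchange//.
pose K (p : RR * RR) := P p.1 *: (f p.2 * qconj (f ((p.2 : R) - p.1))).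
have K1 : qL (leb \x leb)%E 1%:E K.
  apply: qL1_iterated => //.
  apply: (@le_lt_trans _ _ (\int[leb]_z (P z)%:E * E%:E)%E); last by rewrite Py mul1e ltry.
  rewrite -ge0_integralZr//; [|exact/measurable_EFinP|by move=> z _; rewrite lee_fin].
  apply: ge0_le_integral => //.
  - by move=> z _; exact: integral_ge0.
  - exact: (measurable_fun_fubini_tonelli_F (m2 := leb) _ (measurable_EFin_qmod mK)
      (fun x => EFin_qmod_ge0 _)).
  - by apply: emeasurable_funM => //; exact/measurable_EFinP.
  - move=> z _; under eq_integral do rewrite qmodZ EFinM (ger0_norm (P0 z)).
    rewrite ge0_integralZl//; [|exact/measurable_EFin_qmod/(ff1 z).1|by rewrite lee_fin].
    by apply: lee_wpmul2l; rewrite ?lee_fin//; exact: ffE.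
transitivity (qintegral leb (fun x : RR => qintegral leb (fun z : RR => K (z, x)))).
  apply: eq_qintegral => x.
  have -> : qintegral leb (fun l => H (l, x)) =
      f x * qintegral leb (fun l => W l *: (ej (line_phase l x) * qconj (F l))).
    rewrite -qintegralMl; last first.
      apply: (@WF1 _ 1) => //; last by move=> l; rewrite qmod_ej.
      by apply: qmeasurable_ej; exact: measurable_line_phase.
    by apply: eq_qintegral => l; rewrite /H /= -!qscaleAr mulrA.
  rewrite smoothed -qintegralMl; first by apply: eq_qintegral => z; rewrite /K /= -qscaleAr.
  have N10 : (-1 : R) != 0 by rewrite oppr_eq0 oner_eq0.
  have fx : qL leb 1%:E (fun z : RR => f (-1 * ((z : R) + - (x : R)))).
    exact: (rescales_qL1 (rescales_affine (- (x : R)) N10) f1).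
  have e1 (u v : R) : -1 * (v - u) = u - v by ring.
  apply: (@qL1_le _ _ _ _ _ (fun z : RR => (2 / b) *: f (-1 * ((z : R) + - (x : R))))).
  - apply: qmeasurableZ => //; apply: qmeasurable_conj.
    by apply: qmeasurable_comp mf; exact: measurable_funB.
  - exact: qL1Z.
  - move=> z; rewrite !qmodZ qmod_conj e1 ler_wpM2r// ger0_norm ?P0//.
    by rewrite ger0_norm ?divr_ge0 ?(ltW b0)//; exact: poisson_le.
rewrite -(qFubini_exchange K1); apply: eq_qintegral => z.
by rewrite /K /= qintegralZ.
Qed.

Lemma integral_weighted_line_fourier :
  (\int[leb]_l (W l * qsq (F l))%:E = \int[leb]_z (P z * qSc (B z))%:E)%E.
Proof.
have qc l : q0 (W l *: (F l * qconj (F l))) = W l * qsq (F l).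
  by rewrite -qSc_conj_sq.
have [iF _ _ _] := qL1_integrable (WF1 mF Nf0 FN).
have [iB _ _ _] := qL1_integrable qL1_poisson_autocorrelation.
under eq_integral do rewrite -qc.
have := congr1 (fun q => (q0 q)%:E) weighted; rewrite /= /Rintegral.
by rewrite !fineK//; apply: integrable_fin_num.
Qed.

(** The Poisson kernel has mass 1 and the autocorrelation is at most its value at 0. *)
Lemma integral_weighted_line_fourier_le :
  (\int[leb]_l (W l * qsq (F l))%:E <= energy leb f)%E.
Proof.
rewrite integral_weighted_line_fourier fE -[leRHS]mul1e -Py -ge0_integralZr//.
- apply: le_integral => //.
  + by have [] := qL1_integrable qL1_poisson_autocorrelation.
  + apply/integrableP; split.
      by apply: emeasurable_funM => //; exact/measurable_EFinP.
    under eq_integral do rewrite gee0_abs ?mule_ge0 ?lee_fin//.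
    rewrite ge0_integralZr//; [by rewrite Py mul1e ltry|exact/measurable_EFinP
      |by move=> z _; rewrite lee_fin].
  + move=> z _; rewrite -EFinM lee_fin ler_wpM2l//.
    by apply: le_trans (qSc_le_qmod _) _; exact: qmod_autocorrelation_le.
- exact/measurable_EFinP.
- by move=> z _; rewrite lee_fin.
Qed.

End Poisson.

Section Isometry.
Variables (f : RR -> quat R).
Hypotheses (f1 : qL leb 1%:E f) (f2 : qL leb 2%:E f).
Let F := line_fourier f.
Let mf : qmeasurable f. Proof. by case: f1. Qed.
Let mF : qmeasurable F. Proof. exact: qmeasurable_line_fourier. Qed.
Let h (n : nat) : R := n.+1%:R^-1.
Let h0 n : 0 < h n. Proof. by rewrite invr_gt0. Qed.
Let W n l := laplace_weight (h n) l * qsq (F l).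

Let W0 n l : (0 <= (W n l)%:E)%E.
Proof. by rewrite lee_fin mulr_ge0// laplace_weight_ge0. Qed.

(* the weights increase to 1 as their rate h n tends to 0 *)
Let cvg_W : (\int[leb]_l (W n l)%:E @[n --> \oo] --> energy leb F)%E.
Proof.
have mW n : measurable_fun setT (fun l : RR => (W n l)%:E).
  apply/measurable_EFinP; apply: measurable_funM; last exact: measurable_qsq.
  exact: measurable_laplace_weight.
have ndW l : {homo (fun n => (W n l)%:E) : m n / (m <= n)%N >-> (m <= n)%E}.
  move=> m n mn; rewrite lee_fin ler_wpM2r// ler_expR lerN2 ler_wpM2r//.
  by rewrite lef_pV2 ?posrE// ler_nat ltnS.
have -> : energy leb F = (\int[leb]_l limn (fun n => (W n l)%:E))%E.
  apply: eq_integral => l _; apply/esym/cvg_lim => //.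
  apply: cvg_EFin; first exact: nearW.
  rewrite -[X in _ --> X]mul1r; apply: cvgM; last exact: cvg_cst.
  rewrite -(@expR0 R); apply: continuous_cvg; first exact: continuous_expR.
  rewrite -oppr0; apply: cvgN; rewrite -(mul0r `|l : R|); apply: cvgM; last exact: cvg_cst.
  exact: cvg_harmonic.
exact: cvg_monotone_convergence.
Qed.

(** Bessel's inequality: the weighted energies are at most the energy of f. *)
Lemma line_fourier_bessel : (energy leb F <= energy leb f)%E.
Proof.
rewrite -(cvg_lim _ cvg_W)//; apply: lime_le; first by apply/cvg_ex; eexists; exact: cvg_W.
by apply: nearW => n; exact: integral_weighted_line_fourier_le.
Qed.

Let E := fine (energy leb f).
Let fE : energy leb f = E%:E.
Proof. by rewrite fineK// ge0_fin_numE ?energy_ge0//; have /qL2P[] := f2. Qed.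
Let B := autocorrelation f.

(* the change of variables that makes the kernel independent of n *)
Let unscale n : (\int[leb]_l (W n l)%:E =
  \int[leb]_u (poisson 1 u * qSc (B (h n * (u + 0))))%:E)%E.
Proof.
have hn0 : h n != 0 by rewrite gt_eqF.
have [iB _ _ _] := qL1_integrable (qL1_poisson_autocorrelation f1 f2 (h0 n)).
transitivity (\int[leb]_z (poisson (h n) z * qSc (B z))%:E)%E.
  exact: (integral_weighted_line_fourier f1 f2 (h0 n)).
have := rescales_integral (rescales_affine 0 hn0) iB.
rewrite (gtr0_norm (h0 n)) => e.
have -> : (\int[leb]_u (poisson 1 u * qSc (B (h n * (u + 0))))%:E =
    \int[leb]_u ((h n)%:E * (EFin \o (fun z => q0 (poisson (h n) z *: B z)))
      (h n * (u + 0))%R))%E.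
  apply: eq_integral => u _; rewrite /= -EFinM; congr EFin.
  by rewrite mulrA addr0 poisson_scale.
have [ie _ _ _] := qL1_integrable (rescales_qL1 (rescales_affine 0 hn0)
  (qL1_poisson_autocorrelation f1 f2 (h0 n))).
transitivity ((h n)%:E * \int[leb]_u (EFin \o (fun z => q0 (poisson (h n) z *: B z)))
    (h n * (u + 0))%R)%E; last by rewrite -(integralZl measurableT ie (h n)).
by rewrite e muleA -EFinM divff// mul1e.
Qed.

(** After rescaling, the Poisson kernel is fixed and the autocorrelation is evaluated
    ever closer to 0; dominated convergence then reduces the isometry to the
    continuity of the autocorrelation at 0. *)
Lemma line_fourier_isometry_cvg :
  (forall u : R, qSc (B (h n * (u + 0))) @[n --> \oo] --> E) ->
  energy leb F = energy leb f.
Proof.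
move=> cB; apply: (cvg_unique _ cvg_W) => //=.
under eq_cvg do rewrite unscale.
have mB := qmeasurable_autocorrelation f1.
have E0 : 0 <= E by rewrite fine_ge0// energy_ge0.
have mp : measurable_fun setT (poisson 1 : RR -> R) by exact: measurable_poisson.
have ip : (\int[leb]_u (poisson 1 u * E)%:E = E%:E)%E.
  under eq_integral do rewrite EFinM.
  rewrite ge0_integralZr//; first by rewrite integral_poisson// mul1e.
  - exact/measurable_EFinP.
  - by move=> u _; rewrite lee_fin poisson_ge0.
have [] // := @dominated_convergence _ _ _ leb setT measurableT
  (fun n (u : RR) => (poisson 1 u * qSc (B (h n * (u + 0))))%:E)
  (fun u => (poisson 1 u * E)%:E) (fun u => (poisson 1 u * E)%:E).
- move=> n; apply/measurable_EFinP; apply: measurable_funM => //.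
  have hn0 : h n != 0 by rewrite gt_eqF.
  have [mk _ _] := rescales_affine 0 hn0.
  exact: measurableT_comp (measurable_qSc mB) mk.
- by apply/measurable_EFinP; exact: measurable_funM.
- apply: aeW => u _; apply: cvg_EFin; first exact: nearW.
  by apply: cvgM; [exact: cvg_cst|exact: cB].
- apply/integrableP; split; first by apply/measurable_EFinP; exact: measurable_funM.
  under eq_integral do rewrite /= (ger0_norm (mulr_ge0 (poisson_ge0 _ (@ltr01 R)) E0)).
  by rewrite ip ltry.
- apply: aeW => u n _; rewrite lee_fin normrM (ger0_norm (poisson_ge0 _ _))// ler_wpM2l ?poisson_ge0//.
  by apply: le_trans (norm_qSc_le_qmod _) _; exact: qmod_autocorrelation_le.
by move=> _ _; rewrite ip fE.
Qed.

End Isometry.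
End LineTransform.

Section Truncation.
Context d (T : measurableType d) (R : realType).
Variable mu : {measure set T -> \bar R}.
Variables (E_ : nat -> set T) (f : T -> quat R).
Hypotheses (mE : forall l, measurable (E_ l)) (Ey : forall l, (mu (E_ l) < +oo)%E).
Hypothesis cover : forall x, \forall l \near \oo, E_ l x.
Hypothesis f2 : qL mu 2%:E f.

Definition truncation_set l := E_ l `&` [set x | qmod (f x) <= l%:R].

(** Restricting a square integrable function to a set of finite measure on which
    it is bounded makes it integrable too. *)
Definition truncation l : T -> quat R := fun x => \1_(truncation_set l) x *: f x.

Lemma truncation_out l x : ~ E_ l x -> truncation l x = 0.
Proof.
move=> Ex; rewrite /truncation indicE memNset ?scale0r//.
by move=> [].
Qed.

Lemma qmod_truncation_le l x : qmod (truncation l x) <= l%:R * \1_(E_ l) x.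
Proof.
rewrite /truncation qmodZ !indicE.
case: (boolP (x \in truncation_set l)) => [/set_mem[Ex fx]|_].
  by rewrite normr1 mul1r mem_set// mulr1.
by rewrite normr0 mul0r mulr_ge0.
Qed.

Lemma qmod_truncation_le1 l x : qmod (truncation l x) <= l%:R.
Proof.
apply: le_trans (qmod_truncation_le l x) _.
by rewrite ler_piMr// indicE; case: (_ \in _).
Qed.

Let mf : qmeasurable f. Proof. by case: f2. Qed.

Lemma measurable_truncation_set l : measurable (truncation_set l).
Proof.
apply: measurableI => //.
have := measurable_qmod mf measurableT (measurable_itv `]-oo, l%:R]).
rewrite setTI; congr measurable; apply/seteqP; split => x /=; by rewrite in_itv.
Qed.

Lemma qmeasurable_truncation l : qmeasurable (truncation l).
Proof.
apply: qmeasurableZ => //; exact/measurable_indicP/measurable_truncation_set.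
Qed.

Lemma qL1_truncation l : qL mu 1%:E (truncation l).
Proof.
have mi : measurable_fun setT (\1_(E_ l) : T -> R) by exact/measurable_indicP.
apply: (qL1_dominated (qmeasurable_truncation l) _ (qmod_truncation_le l)).
  exact: measurable_funM.
under eq_integral do rewrite EFinM.
rewrite ge0_integralZl//; last exact/measurable_EFinP.
by rewrite integral_indic// setIT; apply: lte_mul_pinfty => //; rewrite lee_fin.
Qed.

Lemma qL2_truncation l : qL mu 2%:E (truncation l).
Proof.
apply: qL2_le f2 _; first exact: qmeasurable_truncation.
move=> x; rewrite /truncation qsqZ indicE; case: (_ \in _); rewrite ?expr1n ?mul1r//.
by rewrite expr0n mul0r.
Qed.

(** Dominated convergence, |f|^2 being the bound. *)
Lemma cvg_truncation :
  (energy mu (fun x => f x - truncation l x)%R @[l --> \oo] --> 0)%E.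
Proof.
have /qL2P[_ fy] := f2.
have le_qsq l x : qsq (f x - truncation l x) <= qsq (f x).
  rewrite /truncation indicE; case: (_ \in _); rewrite ?scale1r ?scale0r ?subr0//.
  by rewrite subrr qsq0.
have [] // := @dominated_convergence _ _ _ mu setT measurableT
  (fun l x => (qsq (f x - truncation l x))%:E) (fun=> 0%E) (fun x => (qsq (f x))%:E).
- by move=> l; apply/measurable_EFin_qsq/qmeasurableB => //; exact: qmeasurable_truncation.
- apply: aeW => x _; apply: cvg_near_cst; near=> l.
  rewrite /truncation indicE mem_set ?scale1r ?subrr ?qsq0//; split; first by near: l.
  by near: l; exact: nbhs_infty_ger.
- apply/integrableP; split; first exact: measurable_EFin_qsq.
  by under eq_integral do rewrite gee0_abs//.
- by apply: aeW => x l _; rewrite gee0_abs// lee_fin.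
by move=> _ _; rewrite integral0.
Unshelve. all: end_near. Qed.

End Truncation.

Section Clip.
Variable R : realType.
Implicit Types M y a : R.

(* y clipped to [-M, M], in a form whose continuity is immediate *)
Let clip M y := (`|y + M| - `|y - M|) / 2.

Let continuous_clip M : continuous (clip M).
Proof.
move=> y; apply: cvgM; last exact: cvg_cst.
apply: cvgB; apply: cvg_norm; [apply: cvgD|apply: cvgB] => //; exact: cvg_cst.
Qed.

Let clip_le M y : 0 <= M -> `|clip M y| <= M.
Proof.
rewrite /clip => M0; case: (ler0P (y + M)) => ?; case: (ler0P (y - M)) => ?;
  rewrite ler_norml; lra.
Qed.

Let clip_dist M y a : `|a| <= M -> `|a - clip M y| <= `|a - y|.
Proof.
rewrite /clip ler_norml => /andP[? ?].
case: (ler0P (y + M)) => ?; case: (ler0P (y - M)) => ?; case: (ler0P (a - y)) => ?;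
  rewrite ler_norml; lra.
Qed.

Notation leb := (@lebesgue_measure R).

(** A bounded function on an interval is approximated in L^2 by a bounded
    continuous one: the L^1 approximation, clipped, remains as close, and the
    square of the distance is at most 2 M times the distance. *)
Lemma bounded_approximation M (a b : R) (f : R -> R) (e : R) :
  0 <= M -> 0 < e -> measurable_fun setT f -> (forall x, `|f x| <= M) ->
  exists phi : R -> R, [/\ continuous phi, forall x, `|phi x| <= M &
    (\int[leb]_(x in `[a, b]) ((f x - phi x) ^+ 2)%:E <= e%:E)%E].
Proof.
move=> M0 e0 mf fM; have mE : measurable `[a, b]%classic by [].
have Ey : (leb `[a, b]%classic < +oo)%E.
  by rewrite lebesgue_measure_itv /=; case: ifP => _; rewrite ?ltry// -EFinB ltry.
have fi : leb.-integrable `[a, b] (EFin \o f).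
  apply: measurable_bounded_integrable => //; first exact: measurable_funTS.
  by exists M; split; rewrite ?num_real// => x Mx y _ /=; rewrite (le_trans (fM y))// ltW.
have [g [cg ig]] := approximation_continuous_integrable mE Ey fi.
move=> /fine_cvgP[gfin] /cvgr0_norm_le.
have d0 : 0 < e / (2 * M + 1) by rewrite divr_gt0// ltr_wpDl// mulr_ge0.
move=> /(_ _ d0) gd; near \oo => n.
have Fn : (\int[leb]_(z in `[a, b]) `|(f z - g n z)%:E|)%E \is a fin_num by near: n.
have Dn : (\int[leb]_(z in `[a, b]) `|(f z - g n z)%:E| <= (e / (2 * M + 1))%:E)%E.
  rewrite -(fineK Fn) lee_fin -[leLHS]ger0_norm ?fine_ge0 ?integral_ge0//.
  by near: n.
exists (clip M \o g n); split => [x|x|].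
- by apply: continuous_comp; [exact: cg|exact: continuous_clip].
- exact: clip_le.
have mg : measurable_fun `[a, b] (g n) by apply: measurable_funTS; exact: continuous_measurable_fun.
have mc : measurable_fun `[a, b] (clip M \o g n).
  apply: measurable_funTS; apply: continuous_measurable_fun => x.
  by apply: continuous_comp; [exact: cg|exact: continuous_clip].
have mf' : measurable_fun `[a, b] f by exact: measurable_funTS.
have mfg : measurable_fun `[a, b] (fun z => `|(f z - g n z)%:E|)%E.
  by apply: measurableT_comp => //; apply/measurable_EFinP; exact: measurable_funB.
apply: (@le_trans _ _ (\int[leb]_(z in `[a, b]) ((2 * M)%:E * `|(f z - g n z)%:E|))%E).
  apply: ge0_le_integral => //.
  - by move=> x _; rewrite lee_fin sqr_ge0.
  - by apply/measurable_EFinP; apply: measurable_funX; exact: measurable_funB.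
  - exact: measurable_funeM.
  - move=> x _; rewrite -EFinM lee_fin -real_normK ?num_real// expr2.
    apply: ler_pM => //=; last exact: clip_dist.
    rewrite mulr_natl mulr2n; apply: le_trans (ler_normB _ _) _.
    by rewrite lerD// clip_le.
rewrite ge0_integralZl//; last by rewrite lee_fin mulr_ge0.
apply: (@le_trans _ _ ((2 * M)%:E * (e / (2 * M + 1))%:E)%E).
  by apply: lee_wpmul2l => //; rewrite lee_fin mulr_ge0.
rewrite -EFinM lee_fin mulrA ler_pdivrMr ?ltr_wpDl ?mulr_ge0//.
by rewrite mulrC ler_wpM2l ?(ltW e0)// lerDl.
Unshelve. all: end_near. Qed.

End Clip.

Section ContinuousPieces.
Variable R : realType.
Notation RR := (measurableTypeR R).
Notation leb := (@lebesgue_measure R).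
Variables (a b M : R) (p0 p1 p2 p3 : R -> R).
Hypothesis M0 : 0 <= M.
Hypotheses (c0 : continuous p0) (c1 : continuous p1) (c2 : continuous p2) (c3 : continuous p3).
Hypotheses (b0 : forall x, `|p0 x| <= M) (b1 : forall x, `|p1 x| <= M)
  (b2 : forall x, `|p2 x| <= M) (b3 : forall x, `|p3 x| <= M).

Let I : R -> R := \1_(`[a, b]%classic).

(** The dense class on which the isometry is proved directly: cutting off by the
    indicator function of an interval avoids building continuous cut-offs. *)
Definition continuous_piece (x : RR) : quat R := I x *: Quat (p0 x) (p1 x) (p2 x) (p3 x).

Let f := continuous_piece.

Let mI : measurable_fun setT (I : RR -> R). Proof. exact/measurable_indicP. Qed.

Let mf : qmeasurable f.
Proof.
apply: qmeasurableZ => //; split; exact: continuous_measurable_fun.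
Qed.

Let I01 x : I x = 0 \/ I x = 1.
Proof. by rewrite /I indicE; case: (_ \in _); [right|left]. Qed.

Let Iy : (\int[leb]_x (I x)%:E < +oo)%E.
Proof.
have H : (leb (`[a, b]%classic : set R) < +oo)%E.
  by rewrite lebesgue_measure_itv /=; case: ifP => _; rewrite ?ltry// -EFinB ltry.
by rewrite integral_indic// setIT; exact: H.
Qed.

Let fM x : qmod (f x) <= 4 * M * I x.
Proof.
rewrite /f /continuous_piece qmodZ; case: (I01 x) => ->; first by rewrite normr0 mul0r mulr0.
rewrite normr1 mul1r mulr1; apply: le_trans (qmod_le_norms _) _ => /=.
by have := b0 x; have := b1 x; have := b2 x; have := b3 x; lra.
Qed.

Lemma qL1_continuous_piece : qL leb 1%:E f.
Proof.
apply: (@qL1_dominated _ RR R leb _ (fun x => 4 * M * I x)) => //.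
  exact: measurable_funM.
under eq_integral do rewrite EFinM.
rewrite ge0_integralZl//.
- by apply: lte_mul_pinfty => //; rewrite lee_fin mulr_ge0.
- exact/measurable_EFinP.
- by move=> x _; rewrite lee_fin; case: (I01 x) => ->.
- by rewrite lee_fin mulr_ge0.
Qed.

Let fM' x : qmod (f x) <= 4 * M.
Proof.
by apply: le_trans (fM x) _; case: (I01 x) => ->; rewrite ?mulr0 ?mulr1// mulr_ge0.
Qed.

Lemma qL2_continuous_piece : qL leb 2%:E f.
Proof.
have /qL1P[_ fy] := qL1_continuous_piece.
apply/qL2P; split => //.
apply: (@le_lt_trans _ _ (\int[leb]_x ((4 * M)%:E * (qmod (f x))%:E))%E).
  apply: ge0_le_integral => //.
  - exact: measurable_EFin_qsq.
  - by apply: measurable_funeM; exact: measurable_EFin_qmod.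
  - by move=> x _; rewrite -EFinM lee_fin -qmod_sq expr2 ler_wpM2r.
rewrite ge0_integralZl//.
- by apply: lte_mul_pinfty => //; rewrite lee_fin mulr_ge0.
- exact: measurable_EFin_qmod.
- by rewrite lee_fin mulr_ge0.
Qed.

Let cvg_I (x : R) (y : nat -> R) : x != a -> x != b -> y @ \oo --> x ->
  (fun n => I (y n)) @ \oo --> I x.
Proof.
move=> xa xb yx; apply: cvg_near_cst.
have [{}xa|xa'|] := ltgtP x a; last by move=> e; rewrite e eqxx in xa.
  have H : \forall n \near \oo, y n < a by exact: cvgr_lt xa.
  apply: filterS H => n yn; rewrite /I !indicE !memNset//=; rewrite in_itv/=.
    by rewrite leNgt xa.
  by rewrite leNgt yn.
have [xb'|{}xb|] := ltgtP x b; last by move=> e; rewrite e eqxx in xb.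
  have H1 : \forall n \near \oo, a < y n by exact: cvgr_gt xa'.
  have H2 : \forall n \near \oo, y n < b by exact: cvgr_lt xb'.
  near=> n; rewrite /I !indicE !mem_set//=; rewrite in_itv/=.
    by rewrite !ltW.
  by apply/andP; split; apply: ltW; near: n.
have H : \forall n \near \oo, b < y n by exact: cvgr_gt xb.
apply: filterS H => n yn; rewrite /I !indicE !memNset//=; rewrite in_itv/=.
  by rewrite [x <= b]leNgt xb andbF.
by rewrite [y n <= b]leNgt yn andbF.
Unshelve. all: end_near. Qed.

(** Translates of the function converge to it off the two end points, boundedly and
    within a fixed interval, so that its autocorrelation is continuous at 0. *)
Lemma line_fourier_isometry_piece : energy leb (line_fourier f) = energy leb f.
Proof.
have f1 := qL1_continuous_piece; have f2 := qL2_continuous_piece.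
apply: line_fourier_isometry_cvg => // u.
have fE : energy leb f = (fine (energy leb f))%:E.
  by rewrite fineK// ge0_fin_numE ?energy_ge0//; have /qL2P[] := f2.
pose z n : R := n.+1%:R^-1 * (u + 0).
have z0 : z @ \oo --> 0.
  rewrite -(mul0r (u + 0)); apply: cvgM; last exact: cvg_cst.
  exact: cvg_harmonic.
have mfz n : qmeasurable (fun x : RR => f ((x : R) - z n)).
  by apply: qmeasurable_comp mf; exact: measurable_funB.
suff : (\int[leb]_x (qSc (f x * qconj (f ((x : R) - z n))))%:E @[n --> \oo] -->
    \int[leb]_x (qsq (f x))%:E)%E by rewrite -/(energy leb f) fE => /fine_cvg.
have [] // := @dominated_convergence _ _ _ leb setT measurableT
  (fun n (x : RR) => (qSc (f x * qconj (f ((x : R) - z n))))%:E)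
  (fun x => (qsq (f x))%:E) (fun x => (4 * M * qmod (f x))%:E).
- move=> n; apply/measurable_EFinP; apply: measurable_qSc; apply: qmeasurableM => //.
  exact: qmeasurable_conj.
- exact: measurable_EFin_qsq.
- have ab0 : leb [set a; b] = 0%E.
    by apply: countable_lebesgue_measure0; exact/finite_set_countable/finite_set2.
  exists [set a; b]; split => //; first exact: measurableU.
  move=> x /= /not_implyP[_ H]; apply: contrapT => xab; apply: H.
  have xa : x != a by apply/eqP => e; apply: xab; left.
  have xb : x != b by apply/eqP => e; apply: xab; right.
  have yx : (fun n => (x : R) - z n) @ \oo --> (x : R).
    by rewrite -[X in _ --> X]subr0; apply: cvgB z0; exact: cvg_cst.
  have cI := cvg_I xa xb yx.
  have cp (p : R -> R) : continuous p -> (fun n => I x * p x * (I (x - z n) * p (x - z n)))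
      @ \oo --> I x * p x * (I x * p x).
    move=> cp; apply: cvgM; first exact: cvg_cst; apply: cvgM => //.
    exact: continuous_cvg (cp x) yx.
  have cS : (fun n => qSc (f x * qconj (f ((x : R) - z n)))) @ \oo --> qsq (f x).
    rewrite -qSc_conj_sq qSc_conjE.
    rewrite (_ : (fun n => _) = (fun n => q0 (f x) * q0 (f ((x : R) - z n)) +
      q1 (f x) * q1 (f ((x : R) - z n)) + q2 (f x) * q2 (f ((x : R) - z n)) +
      q3 (f x) * q3 (f ((x : R) - z n)))).
      by apply: cvgD; [apply: cvgD; [apply: cvgD|]|]; exact: cp.
    by apply/funext => n; rewrite qSc_conjE.
  by apply: cvg_EFin; [exact: nearW|exact: cS].
- have /qL1P[_ fy] := f1.
  apply/integrableP; split.
    by apply/measurable_EFinP; apply: measurable_funM => //; exact: measurable_qmod.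
  under eq_integral do rewrite /= ger0_norm ?mulr_ge0// EFinM.
  rewrite ge0_integralZl//; last 2 first.
  + exact: measurable_EFin_qmod.
  + by rewrite lee_fin mulr_ge0.
  by apply: lte_mul_pinfty => //; rewrite lee_fin mulr_ge0.
- apply: aeW => x n _; rewrite lee_fin; apply: le_trans (norm_qSc_le_qmod _) _.
  by rewrite qmodM qmod_conj mulrC ler_wpM2r.
Qed.

End ContinuousPieces.

Lemma cvge0_near_le (R : realType) (a : nat -> \bar R) (e : R) :
  (forall n, 0 <= a n)%E -> (a @ \oo --> 0)%E -> 0 < e ->
  \forall n \near \oo, (a n <= e%:E)%E.
Proof.
move=> a0 /fine_cvgP[afin /cvgr0_norm_le ae] e0.
have := ae _ e0; apply: filterS2 afin => n an ane.
by rewrite -(fineK an) lee_fin -[leLHS]ger0_norm ?fine_ge0.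
Qed.

Lemma cvge0_le_near (R : realType) (a : nat -> \bar R) :
  (forall n, 0 <= a n)%E ->
  (forall e : R, 0 < e -> \forall n \near \oo, (a n <= e%:E)%E) -> (a @ \oo --> 0)%E.
Proof.
move=> a0 H; apply/fine_cvgP; split.
  apply: filterS (H 1 ltr01) => n an.
  by rewrite ge0_fin_numE// (le_lt_trans an)// ltry.
apply/cvgr0Pnorm_le => e e0; apply: filterS (H _ e0) => n an.
have fin : a n \is a fin_num by rewrite ge0_fin_numE// (le_lt_trans an)// ltry.
by rewrite ger0_norm ?fine_ge0// -lee_fin fineK.
Qed.

Section QnormEnergy.
Context d1 d2 (T1 : measurableType d1) (T2 : measurableType d2) (R : realType).
Variables (mu : {measure set T1 -> \bar R}) (nu : {measure set T2 -> \bar R}).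

Lemma qnorm_le (f : T1 -> quat R) (g : T2 -> quat R) :
  (energy mu f <= energy nu g)%E -> (qnorm mu 2%:E f <= qnorm nu 2%:E g)%E.
Proof.
move=> fg; rewrite !qnorm2E; apply: gt0_ler_poweR fg => //.
  by rewrite ?in_itv ?inE/= leey andbT energy_ge0.
by rewrite ?in_itv ?inE/= leey andbT energy_ge0.
Qed.

Lemma qnorm_le_fin (f : T1 -> quat R) (e : R) : 0 <= e ->
  (energy mu f <= (e ^+ 2)%:E)%E -> (qnorm mu 2%:E f <= e%:E)%E.
Proof.
move=> e0 fe; rewrite qnorm2E.
have -> : e%:E = ((e ^+ 2)%:E `^ 2^-1)%E.
  by rewrite poweR_EFin -powR_mulrn// -powRrM divff// powRr1.
apply: gt0_ler_poweR fe => //; first by rewrite ?in_itv ?inE/= leey andbT energy_ge0.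
by rewrite ?in_itv ?inE/= leey andbT lee_fin sqr_ge0.
Qed.

End QnormEnergy.

Section LinePlancherel.
Variable R : realType.
Notation RR := (measurableTypeR R).
Notation leb := (@lebesgue_measure R).
Implicit Types f : RR -> quat R.

(* a truncation of f, replaced in each component by a continuous bounded function *)
Let isometric_dense f (e : R) : qL leb 2%:E f -> 0 < e ->
  exists g, [/\ qL leb 1%:E g, qL leb 2%:E g,
    energy leb (line_fourier g) = energy leb g &
    (energy leb (fun x => f x - g x)%R <= e%:E)%E].
Proof.
move=> f2 e0; have mf : qmeasurable f by case: f2.
pose E_ (l : nat) : set RR := `[- (l%:R : R), l%:R]%classic.
have mE l : measurable (E_ l) by exact: measurable_itv.
have Ey l : (leb (E_ l) < +oo)%E.
  by rewrite /E_ lebesgue_measure_itv /=; case: ifP => _; rewrite ?ltry// -EFinB ltry.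
have cover x : \forall l \near \oo, E_ l x.
  near=> l; rewrite /E_ /= in_itv/= -ler_norml; near: l; exact: nbhs_infty_ger.
have e4 : 0 < e / 4 by rewrite divr_gt0.
have e16 : 0 < e / 16 by rewrite divr_gt0.
have := cvge0_near_le (fun n => energy_ge0 leb _) (cvg_truncation mE cover f2) e4.
move=> [l _ /(_ l (leqnn l)) /= fl].
set h := truncation E_ f l in fl.
have mh : qmeasurable h by exact: (qmeasurable_truncation mE f2).
have hl x : qmod (h x) <= l%:R := qmod_truncation_le1 E_ f l x.
have [m0 m1 m2 m3] := mh.
have lR0 : 0 <= (l%:R : R) by [].
have [p0 [c0 b0 i0]] := @bounded_approximation R _ (- l%:R) l%:R (fun x => q0 (h x)) _
  lR0 e16 m0 (fun x => le_trans (norm_q0_le _) (hl x)).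
have [p1 [c1 b1 i1]] := @bounded_approximation R _ (- l%:R) l%:R (fun x => q1 (h x)) _
  lR0 e16 m1 (fun x => le_trans (norm_q1_le _) (hl x)).
have [p2 [c2 b2 i2]] := @bounded_approximation R _ (- l%:R) l%:R (fun x => q2 (h x)) _
  lR0 e16 m2 (fun x => le_trans (norm_q2_le _) (hl x)).
have [p3 [c3 b3 i3]] := @bounded_approximation R _ (- l%:R) l%:R (fun x => q3 (h x)) _
  lR0 e16 m3 (fun x => le_trans (norm_q3_le _) (hl x)).
pose g := continuous_piece (- l%:R) l%:R p0 p1 p2 p3.
have g1 : qL leb 1%:E g by exact: (@qL1_continuous_piece _ _ _ l%:R).
have g2 : qL leb 2%:E g by exact: (@qL2_continuous_piece _ _ _ l%:R).
exists g; split => //; first exact: (@line_fourier_isometry_piece _ _ _ l%:R).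
have mg : qmeasurable g by case: g2.
have hg : (energy leb (fun x => h x - g x)%R <= (e / 4)%:E)%E.
  have -> : energy leb (fun x => h x - g x) = (\int[leb]_(x in E_ l)
      (((q0 (h x) - p0 x) ^+ 2)%:E + ((q1 (h x) - p1 x) ^+ 2)%:E +
       ((q2 (h x) - p2 x) ^+ 2)%:E + ((q3 (h x) - p3 x) ^+ 2)%:E))%E.
    rewrite [RHS]integral_mkcond; apply: eq_integral => x _; rewrite patchE.
    case: ifPn => [xE|/negP xE].
      rewrite -!EFinD; congr EFin; rewrite /g /continuous_piece indicE xE scale1r.
      by rewrite /qsq.
    have hx : h x = 0 by apply: truncation_out => xE'; apply: xE; exact/mem_set.
    have gx : g x = 0.
      by rewrite /g /continuous_piece indicE (negbTE (introN idP xE)) scale0r.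
    by rewrite hx gx subrr qsq0.
  have mk (q : RR -> R) (p : R -> R) : measurable_fun setT q -> continuous p ->
      measurable_fun (E_ l) (fun x => ((q x - p x) ^+ 2)%:E).
    move=> mq cp; apply: measurable_funTS; apply/measurable_EFinP.
    by apply: measurable_funX; apply: measurable_funB => //; exact: continuous_measurable_fun.
  have k0 := mk _ _ m0 c0; have k1 := mk _ _ m1 c1.
  have k2 := mk _ _ m2 c2; have k3 := mk _ _ m3 c3.
  have k01 := emeasurable_funD k0 k1; have k012 := emeasurable_funD k01 k2.
  rewrite ge0_integralD//; try by (move=> x _; rewrite -?EFinD lee_fin ?addr_ge0 ?sqr_ge0).
  rewrite ge0_integralD//; try by (move=> x _; rewrite -?EFinD lee_fin ?addr_ge0 ?sqr_ge0).
  rewrite ge0_integralD//; try by (move=> x _; rewrite -?EFinD lee_fin ?addr_ge0 ?sqr_ge0).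
  have -> : (e / 4)%:E = ((e / 16)%:E + (e / 16)%:E + (e / 16)%:E + (e / 16)%:E)%E.
    by rewrite -!EFinD; congr EFin; field.
  by rewrite !leeD.
have fgE : energy leb (fun x => f x - g x) = energy leb (fun x => (f x - h x) + (h x - g x)).
  by apply: eq_energy => x; rewrite addrA subrK.
apply: (@le_trans _ _ (energy leb (fun x => (f x - h x) + (h x - g x))%R)).
  by rewrite -fgE.
apply: le_trans (energyD_le _ (qmeasurableB mf mh) (qmeasurableB mh mg)) _.
apply: (@le_trans _ _ (2%:E * (e / 4)%:E + 2%:E * (e / 4)%:E)%E).
  by apply: leeD; apply: lee_wpmul2l.
by rewrite -!EFinM -EFinD lee_fin; lra.
Unshelve. all: end_near. Qed.

Lemma line_fourierB_fun f g : qL leb 1%:E f -> qL leb 1%:E g ->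
  line_fourier (fun x => f x - g x) = (fun l => line_fourier f l - line_fourier g l).
Proof. by move=> f1 g1; apply/funext => l; rewrite line_fourierB. Qed.

(** Bessel's inequality turns the isometry property of a dense class into that
    of all integrable, square integrable functions. *)
Lemma line_plancherel f : qL leb 1%:E f -> qL leb 2%:E f ->
  energy leb (line_fourier f) = energy leb f.
Proof.
move=> f1 f2; apply/eqP; rewrite eq_le line_fourier_bessel//=.
have mf : qmeasurable f by case: f1.
have mF : qmeasurable (line_fourier f) by exact: qmeasurable_line_fourier.
suff H : (qnorm leb 2%:E f <= qnorm leb 2%:E (line_fourier f))%E.
  by rewrite -!qnorm2_sq !expe2 lee_pmul// qnorm2_ge0.
apply/lee_addgt0Pr => e e0.
have e2 : 0 < (e / 2) ^+ 2 by rewrite exprn_gt0// divr_gt0.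
have [g [g1 g2 gE fg]] := isometric_dense f2 e2.
have mg : qmeasurable g by case: g1.
have mG : qmeasurable (line_fourier g) by exact: qmeasurable_line_fourier.
have nfg : (qnorm leb 2%:E (fun x => f x - g x)%R <= (e / 2)%:E)%E.
  by apply: qnorm_le_fin => //; rewrite divr_ge0// ltW.
have d1 : qL leb 1%:E (fun x => g x - f x) by exact: qL1B.
have d2 : qL leb 2%:E (fun x => g x - f x) by exact: qL2B.
have nFG : (qnorm leb 2%:E (fun x => line_fourier g x - line_fourier f x)%R <= (e / 2)%:E)%E.
  apply: le_trans nfg; rewrite [leRHS]qnorm_distC; apply: qnorm_le.
  by rewrite -line_fourierB_fun//; exact: line_fourier_bessel.
have G : (qnorm leb 2%:E g <= (e / 2)%:E + qnorm leb 2%:E (line_fourier f))%E.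
  rewrite -(qnorm_energy gE) (@eq_qnorm _ _ _ leb (line_fourier g) (fun x =>
    (line_fourier g x - line_fourier f x) + line_fourier f x)); last by move=> x; rewrite subrK.
  apply: le_trans (qnormD leb (qmeasurableB mG mF) mF) _.
  exact: leeD2r.
rewrite (@eq_qnorm _ _ _ leb f (fun x => (f x - g x) + g x)); last by move=> x; rewrite subrK.
apply: le_trans (qnormD leb (qmeasurableB mf mg) mg) _.
apply: le_trans (leeD nfg G) _.
by rewrite addeA -EFinD -splitr addeC.
Qed.

End LinePlancherel.

(** * Plancherel's theorem on column vectors *)

Lemma qmod_qintegral_le_measurable d (T : measurableType d) (R : realType)
    (mu : {measure set T -> \bar R}) (f : T -> quat R) : qmeasurable f ->
  ((qmod (qintegral mu f))%:E <= \int[mu]_x (qmod (f x))%:E)%E.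
Proof.
move=> mf; have [fy|] := ltP (\int[mu]_x (qmod (f x))%:E)%E +oo%E.
  by apply: qmod_qintegral_le; apply/qL1P.
by rewrite leye_eq => /eqP ->; exact: leey.
Qed.

Lemma measurable_dotcV d (T : measurableType d) (R : realType) m (u v : T -> 'cV[R]_m) :
  measurable_fun setT u -> measurable_fun setT v ->
  measurable_fun setT (fun p => dotcV (u p) (v p) : measurableTypeR R).
Proof.
move=> mu mv; apply: measurable_sum => i.
by apply: measurable_funM; apply: (measurableT_comp (@measurable_cV_coord R m i)).
Qed.

Section ColumnTransform.
Variable R : realType.
Notation RR := (measurableTypeR R).
Notation leb1 := (@lebesgue_measure R).

Definition cV_phase m (l x : 'cV[R]_m) : R := - (2 * pi * dotcV l x).

(** The Fourier transform with the exponential on the right; for functions with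
    values in the complex plane of 1 and j it is the usual one. *)
Definition cV_fourier m (f : 'cV[R]_m -> quat R) (l : 'cV[R]_m) : quat R :=
  qintegral (lebesgue_cV R m) (fun x => f x * ej (cV_phase l x)).

Lemma measurable_cV_phase d (T : measurableType d) m (u v : T -> 'cV[R]_m) :
  measurable_fun setT u -> measurable_fun setT v ->
  measurable_fun setT (fun p => cV_phase (u p) (v p) : RR).
Proof.
move=> mu mv; apply: measurableT_comp => //.
by apply: measurable_funM => //; exact: measurable_dotcV.
Qed.

Section FixedDimension.
Variable m : nat.
Notation leb := (lebesgue_cV R m).
Implicit Types f g : 'cV[R]_m -> quat R.

Lemma qL1_cV_phase f l : qL leb 1%:E f -> qL leb 1%:E (fun x => f x * ej (cV_phase l x)).
Proof.
move=> fL; apply: (qL1_eqmod _ fL) => [|x]; last by rewrite qmodMej.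
apply: qmeasurableM; first by case: fL.
by apply: qmeasurable_ej; exact: measurable_cV_phase.
Qed.

Lemma qmeasurable_cV_fourier f : qmeasurable f -> qmeasurable (cV_fourier f).
Proof.
move=> mf; pose F (p : 'cV[R]_m * 'cV[R]_m) := f p.2 * ej (cV_phase p.1 p.2).
apply: (@qmeasurable_qintegral2 _ _ _ _ _ leb F).
apply: qmeasurableM; first exact: qmeasurable_comp mf.
by apply: qmeasurable_ej; exact: measurable_cV_phase.
Qed.

Lemma cV_fourierB f g : qL leb 1%:E f -> qL leb 1%:E g ->
  forall l, cV_fourier (fun x => f x - g x) l = cV_fourier f l - cV_fourier g l.
Proof.
move=> fL gL l; rewrite /cV_fourier -qintegralB; try exact: qL1_cV_phase.
by apply: eq_qintegral => x; rewrite mulrBl.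
Qed.

Lemma cV_fourierMl (c : quat R) f : qL leb 1%:E f ->
  forall l, cV_fourier (fun x => c * f x) l = c * cV_fourier f l.
Proof.
move=> fL l; rewrite /cV_fourier -qintegralMl; last exact: qL1_cV_phase.
by apply: eq_qintegral => x; rewrite mulrA.
Qed.

End FixedDimension.

Section Step.
Variable m : nat.
Notation leb := (lebesgue_cV R m).
Hypothesis IH : forall g : 'cV[R]_m -> quat R, qL leb 1%:E g -> qL leb 2%:E g ->
  energy leb (cV_fourier g) = energy leb g.
Variable f : 'cV[R]_m.+1 -> quat R.
Hypotheses (f1 : qL (lebesgue_cV R m.+1) 1%:E f) (f2 : qL (lebesgue_cV R m.+1) 2%:E f).

Let F (p : RR * 'cV[R]_m) := f (cV_cons p).
Let F1 : qL (leb1 \x leb)%E 1%:E F.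
Proof. exact: (rescales_qL1 (rescales_cV_cons R m) f1). Qed.
Let F2 : qL (leb1 \x leb)%E 2%:E F.
Proof. exact: (rescales_qL2 (rescales_cV_cons R m) f2). Qed.
Let mF : qmeasurable F. Proof. by case: F1. Qed.

Let G (p : RR * 'cV[R]_m) : quat R := line_fourier (fun x => F (x, p.2)) p.1.

Let mG : qmeasurable G.
Proof.
pose H (p : (RR * 'cV[R]_m) * RR) := F (p.2, p.1.2) * ej (line_phase p.1.1 p.2).
apply: (@qmeasurable_qintegral2 _ _ _ _ _ leb1 H).
apply: qmeasurableM.
  apply: qmeasurable_comp mF; apply: measurable_fun_pair => //.
  exact: measurableT_comp.
apply: qmeasurable_ej; apply: measurable_line_phase => //.
exact: measurableT_comp.
Qed.

Let G1 (l1 : RR) : qL leb 1%:E (fun x' => G (l1, x')).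
Proof.
have /qL1P[_ Fy] := F1; apply/qL1P; split; first exact: qmeasurable_slice1.
rewrite tonelli2// in Fy; last exact: measurable_EFin_qmod.
apply: le_lt_trans Fy; apply: ge0_le_integral => //.
- by apply: measurable_EFin_qmod; exact: qmeasurable_slice1.
- exact: (measurable_fun_fubini_tonelli_G (m1 := leb1) _ (measurable_EFin_qmod mF)
    (fun x => EFin_qmod_ge0 _)).
- move=> x' _; rewrite /G /line_fourier /=.
  have mH : qmeasurable (fun x : RR => F (x, x') * ej (line_phase l1 x)).
    apply: qmeasurableM; first exact: (qmeasurable_slice2 x' mF).
    by apply: qmeasurable_ej; exact: measurable_line_phase.
  apply: le_trans (qmod_qintegral_le_measurable leb1 mH) _.
  by under eq_integral do rewrite qmodMej.
Qed.

Let split_transform (l1 : RR) (l' : 'cV[R]_m) :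
  cV_fourier f (cV_cons (l1, l')) = cV_fourier (fun x' => G (l1, x')) l'.
Proof.
pose H p := F p * (ej (line_phase l1 p.1) * ej (cV_phase l' p.2)).
have mH : qmeasurable H.
  apply: qmeasurableM => //; apply: qmeasurableM.
    by apply: qmeasurable_ej; exact: measurable_line_phase.
  by apply: qmeasurable_ej; exact: measurable_cV_phase.
have H1 : qL (leb1 \x leb)%E 1%:E H.
  by apply: (qL1_eqmod mH F1) => p; rewrite /H mulrA !qmodMej.
transitivity (qintegral (leb1 \x leb)%E H).
  rewrite /cV_fourier; have := rescales_qintegral (rescales_cV_cons R m)
    (qL1_cV_phase (cV_cons (l1, l')) f1).
  rewrite scale1r => <-; apply: eq_qintegral => p; rewrite /H -ejD; congr (_ * ej _).
  by rewrite [in cV_cons p](surjective_pairing p) /cV_phase dotcV_cons /line_phase; ring.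
rewrite qFubini2//; apply: ae_qintegral.
- exact: qmeasurable_qintegral1.
- apply: qmeasurableM; first by case: (G1 l1).
  by apply: qmeasurable_ej; exact: measurable_cV_phase.
apply: filterS (ae_slice2_qL1 F1) => x' Fx'.
rewrite /G /line_fourier /= -qintegralMr; last exact: qL1_line_phase.
by apply: eq_qintegral => x; rewrite /H /= mulrA.
Qed.

(** The partial transform in the first coordinate is isometric on almost every line;
    the transform in the others is then isometric on almost every slice, because
    the total energy is finite. *)
Lemma cV_plancherel_step :
  energy (lebesgue_cV R m.+1) (cV_fourier f) = energy (lebesgue_cV R m.+1) f.
Proof.
have mf : qmeasurable f by case: f1.
have mFf := qmeasurable_cV_fourier mf.
have ener (h : 'cV[R]_m.+1 -> quat R) : qmeasurable h ->
    energy (lebesgue_cV R m.+1) h = energy (leb1 \x leb)%E (fun p => h (cV_cons p)).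
  by move=> mh; rewrite (rescales_energy (rescales_cV_cons R m) mh) mul1e.
have GE : energy (leb1 \x leb)%E G = energy (lebesgue_cV R m.+1) f.
  have mFc : qmeasurable (fun p => f (cV_cons p)) by exact: mF.
  rewrite (ener f mf) (energy_prod2 leb1 leb mG) (energy_prod2 leb1 leb mFc).
  apply: ge0_ae_eq_integral => //.
  - exact: measurable_energy2.
  - exact: (measurable_energy2 leb1 mF).
  - by move=> x _; exact: energy_ge0.
  - by move=> x _; exact: energy_ge0.
  have := ae_slice2_qL1 F1; have := ae_slice2_qL2 F2.
  by apply: filterS2 => x' x2 x1 _; exact: (line_plancherel x1 x2).
have mFfc : qmeasurable (fun p => cV_fourier f (cV_cons p)).
  exact: (qmeasurable_comp (@measurable_cV_cons R m) mFf).
rewrite (ener _ mFf) -GE (energy_prod1 leb1 leb mFfc) (energy_prod1 leb1 leb mG).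
apply: ge0_ae_eq_integral => //.
- exact: (measurable_energy1 leb mFfc).
- exact: (measurable_energy1 leb mG).
- by move=> x _; exact: energy_ge0.
- by move=> x _; exact: energy_ge0.
have Gy : (\int[leb1]_l energy leb (fun x' => G (l, x')) < +oo)%E.
  by rewrite -energy_prod1// GE; have /qL2P[] := f2.
have := ae_fin_integral (measurable_energy1 leb mG) (fun l => energy_ge0 _ _) Gy.
apply: filterS => l1 Gl _.
rewrite -[RHS](IH (G1 l1)); last by apply/qL2P; split => //; case: (G1 l1).
by apply: eq_energy => l'; rewrite split_transform.
Qed.

End Step.

(** Partial transforms are isometric by the case of the line and by induction,
    and Fubini's theorem composes them. *)
Lemma cV_plancherel m (f : 'cV[R]_m -> quat R) :
  qL (lebesgue_cV R m) 1%:E f -> qL (lebesgue_cV R m) 2%:E f ->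
  energy (lebesgue_cV R m) (cV_fourier f) = energy (lebesgue_cV R m) f.
Proof.
elim: m f => [|m IH] f f1 f2; last exact: cV_plancherel_step.
have ddirac (g : 'cV[R]_0 -> R) : measurable_fun setT g ->
    \int[lebesgue_cV R 0]_x g x = g 0.
  move=> mg; rewrite /Rintegral.
  have := @integral_dirac _ _ (0 : 'cV[R]_0) R setT measurableT (EFin \o g).
  by rewrite diracT mul1e => -> //; exact/measurable_EFinP.
apply: eq_energy => l; rewrite (flatmx0 l); case: (qL1_cV_phase 0 f1) => -[h0 h1 h2 h3] _.
have -> : cV_fourier f 0 = f 0 * ej (cV_phase (0 : 'cV[R]_0) 0).
  by apply: quatP; split; [exact: (ddirac _ h0)|exact: (ddirac _ h1)
    |exact: (ddirac _ h2)|exact: (ddirac _ h3)].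
by rewrite qsqM qsq_ej mulr1.
Qed.

End ColumnTransform.

(** * Completeness of L^2 and extension of isometries *)

Section Completeness.
Context d (T : measurableType d) (R : realType).
Variable mu : {measure set T -> \bar R}.
Variable G : nat -> T -> quat R.
Hypothesis G2 : forall n, qL mu 2%:E (G n).
Hypothesis cauchy : forall e : R, 0 < e -> exists N, forall m n, (N <= m)%N -> (N <= n)%N ->
  (energy mu (fun x => G m x - G n x)%R <= e%:E)%E.

Let mG n : qmeasurable (G n). Proof. by case: (G2 n). Qed.

(* a subsequence whose consecutive distances are summable *)
Let subseq : exists n_ : nat -> nat, (forall k, (k <= n_ k)%N) /\
  forall k, (energy mu (fun x => G (n_ k.+1) x - G (n_ k) x)%R <= ((4^-1) ^+ k)%:E)%E.
Proof.
have e0 k : 0 < (4^-1 : R) ^+ k by rewrite exprn_gt0.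
have [N_ NP] := choice (fun k => cauchy (e0 k)).
exists (fun k => k + \sum_(i < k.+1) N_ i)%N; split => [k|k]; first exact: leq_addr.
apply: NP; last by rewrite big_ord_recr/= addnA leq_addl.
rewrite !big_ord_recr /=; apply: leq_trans (leq_addl _ _).
by apply: leq_trans (leq_addr _ _); exact: leq_addl.
Qed.

(** A subsequence with summable distances converges almost everywhere, to a limit
    towards which Fatou's lemma makes the whole sequence converge in L^2. *)
Lemma qL2_complete : exists g, qL mu 2%:E g /\
  (energy mu (fun x => g x - G n x)%R @[n --> \oo] --> 0)%E.
Proof.
have [n_ [n_ge nE]] := subseq.
pose D k x := G (n_ k.+1) x - G (n_ k) x.
have mD k : qmeasurable (D k) by exact: qmeasurableB.
pose a k x : \bar R := ((2 ^+ k)%:E * (qsq (D k x))%:E)%E.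
have a0 k x : (0 <= a k x)%E by rewrite mule_ge0// lee_fin exprn_ge0.
have ma k : measurable_fun setT (a k).
  by apply: measurable_funeM; exact: measurable_EFin_qsq.
have aE k : (\int[mu]_x a k x = (2 ^+ k)%:E * energy mu (D k))%E.
  apply: ge0_integralZl; [by []|exact: measurable_EFin_qsq
    |by move=> x _; exact: EFin_qsq_ge0|by rewrite lee_fin exprn_ge0].
have ay : (\int[mu]_x (\sum_(k <oo) a k x) < +oo)%E.
  rewrite integral_nneseries//; apply: (@le_lt_trans _ _ 2%:E); last exact: ltry.
  apply: lime_le; first by apply: is_cvg_nneseries => k _ _; exact: integral_ge0.
  apply: nearW => n.
  apply: (@le_trans _ _ (\sum_(0 <= k < n) ((2^-1) ^+ k)%:E)%E).
    apply: lee_sum => k _; rewrite aE.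
    apply: (@le_trans _ _ ((2 ^+ k)%:E * ((4^-1) ^+ k)%:E)%E).
      by apply: lee_wpmul2l (nE k); rewrite lee_fin exprn_ge0.
    by rewrite -EFinM lee_fin -exprMn (_ : 2 * 4^-1 = 2^-1 :> R)//; field.
  rewrite sumEFin lee_fin.
  have := @geometric_le_lim R n 1 2^-1 ler01 _ _.
  rewrite (_ : 1 * (1 - 2^-1)^-1 = 2 :> R); last by field.
  rewrite /series/=; under eq_bigr do rewrite mul1r; apply => //.
  by rewrite ger0_norm// invf_lt1// ltr1n.
have aeS := ae_fin_integral (f := fun x => \sum_(k <oo) a k x)%E
  (ge0_emeasurable_sum (fun k x _ _ => a0 k x) (fun k _ => ma k))
  (fun x => nneseries_ge0 (fun k _ _ => a0 k x)) ay.
pose ulim (q : quat R -> R) x : R := fine (limn_esup (fun k => (q (G (n_ k) x))%:E)).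
have cvg_q (q : quat R -> R) x : (forall p p', q (p - p') = q p - q p') ->
    (forall p, `|q p| <= qmod p) -> (\sum_(k <oo) a k x < +oo)%E ->
    (fun k => q (G (n_ k) x)) @ \oo --> ulim q x.
  move=> qB qle Sx; set u := fun k => _.
  suff cu : cvgn u.
    suff -> : ulim q x = limn u by [].
    have uE : (fun k => (u k)%:E) @ \oo --> (limn u)%:E by apply: cvg_EFin; [exact: nearW | exact: cu].
    by rewrite /ulim (cvg_limn_einf_sup uE).2.
  have dk k : `|telescope u k| <= 2^-1 * ((2^-1) ^+ k + 2 ^+ k * qsq (D k x)).
    rewrite /telescope /= /u -qB; apply: le_trans (qle _) _; rewrite -/(D k x).
    have s0 : 0 < (2 : R) ^+ k by rewrite exprn_gt0.
    rewrite -qmod_sq exprVn; set s := _ ^+ k in s0 *; set m := qmod _.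
    rewrite -subr_ge0 (_ : _ - _ = 2^-1 * s * (m - s^-1) ^+ 2).
      by rewrite mulr_ge0 ?sqr_ge0// mulr_ge0// ltW.
    by field; rewrite gt_eqF.
  pose S := fine (\sum_(k <oo) a k x)%E.
  have Sfin : (\sum_(k <oo) a k x)%E \is a fin_num.
    by rewrite ge0_fin_numE// nneseries_ge0.
  have bound n : [normed series (telescope u)] n <= 2^-1 * (2 + S).
    rewrite /series /=.
    apply: (@le_trans _ _ (\sum_(0 <= k < n) 2^-1 * ((2^-1) ^+ k + 2 ^+ k * qsq (D k x)))).
      by apply: ler_sum => k _; exact: dk.
    rewrite -mulr_sumr ler_pM2l// big_split/=; apply: lerD.
      have := @geometric_le_lim R n 1 2^-1 ler01 _ _.
      rewrite (_ : 1 * (1 - 2^-1)^-1 = 2 :> R); last by field.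
      rewrite /series/=; under eq_bigr do rewrite mul1r; apply => //.
      by rewrite ger0_norm// invf_lt1// ltr1n.
    rewrite -lee_fin fineK// -sumEFin.
    under eq_bigr do rewrite EFinM.
    exact: (nneseries_lim_ge (u_ := fun k => a k x) (P := xpredT)).
  have ct : cvgn (series (telescope u)).
    apply: normed_cvg; apply: nondecreasing_is_cvgn.
      by apply: nondecreasing_series => k _ _; exact: normr_ge0.
    by exists (2^-1 * (2 + S)) => _ [n _ <-]; exact: bound.
  rewrite (_ : u = (fun n => u 0%N + series (telescope u) n)); last first.
    by apply/funext => n; exact: eq_sum_telescope.
  by apply: is_cvgD ct; exact: is_cvg_cst.
pose g x := Quat (ulim (@q0 R) x) (ulim (@q1 R) x) (ulim (@q2 R) x) (ulim (@q3 R) x).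
have mu_ (q : quat R -> R) : (forall k, measurable_fun setT (fun x => q (G (n_ k) x))) ->
    measurable_fun setT (ulim q).
  move=> mq; rewrite /ulim; apply: measurableT_comp => //.
  by apply: measurable_fun_limn_esup => k; exact/measurable_EFinP.
have mg : qmeasurable g.
  by split; apply: mu_ => k; case: (mG (n_ k)).
have cvg_g : {ae mu, forall x, forall m,
    (fun k => (qsq (G (n_ k) x - G m x))%:E) @ \oo --> (qsq (g x - G m x))%:E}.
  apply: filterS aeS => x Sx m.
  have h0 := cvg_q (@q0 R) x (fun _ _ => erefl) (@norm_q0_le R) Sx.
  have h1 := cvg_q (@q1 R) x (fun _ _ => erefl) (@norm_q1_le R) Sx.
  have h2 := cvg_q (@q2 R) x (fun _ _ => erefl) (@norm_q2_le R) Sx.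
  have h3 := cvg_q (@q3 R) x (fun _ _ => erefl) (@norm_q3_le R) Sx.
  apply: cvg_EFin; first exact: nearW.
  have sq (u : nat -> R) l c : u @ \oo --> l ->
      (fun k => (u k - c) ^+ 2) @ \oo --> (l - c) ^+ 2.
    move=> ul; rewrite expr2; under eq_fun do rewrite expr2.
    by apply: cvgM; apply: cvgB => //; exact: cvg_cst.
  rewrite /qsq /=.
  by apply: cvgD; [apply: cvgD; [apply: cvgD|]|]; exact: sq.
(* Fatou's lemma bounds the distance to the limit by the distances along the
   subsequence *)
have dist (e : R) : 0 < e -> \forall m \near \oo, (energy mu (fun x => g x - G m x)%R <= e%:E)%E.
  move=> e0; have [N NP] := cauchy e0; near=> m.
  have mm k : measurable_fun setT (fun x => (qsq (G (n_ k) x - G m x))%:E).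
    by apply: measurable_EFin_qsq; exact: qmeasurableB.
  have -> : energy mu (fun x => g x - G m x) =
      (\int[mu]_x limn_einf (fun k => (qsq (G (n_ k) x - G m x))%:E))%E.
    apply: ge0_ae_eq_integral => //.
    - by apply: measurable_EFin_qsq; exact: qmeasurableB.
    - rewrite /limn_einf; apply: measurableT_comp => //.
      by apply: measurable_fun_limn_esup => k; exact: measurableT_comp.
    - move=> x _; rewrite limn_einf_lim; apply: lime_ge; first exact: is_cvg_einfs.
      by apply: nearW => k; apply: le_ereal_inf_tmp => _ [j _ <-].
    - by apply: filterS cvg_g => x /(_ m) h _; rewrite (cvg_limn_einf_sup h).1.
  apply: le_trans (fatou mu measurableT mm (fun k x _ => EFin_qsq_ge0 _)) _.
  rewrite limn_einf_lim; apply: lime_le; first exact: is_cvg_einfs.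
  near=> k; apply: ereal_inf_le; exists (energy mu (fun x => G (n_ k) x - G m x)).
    by exists k => /=.
  apply: NP; last by near: m; exact: nbhs_infty_ge.
  by apply: leq_trans (n_ge k); near: k; exact: nbhs_infty_ge.
exists g; split; last by apply: cvge0_le_near dist => n; exact: energy_ge0.
apply/qL2P; split => //; have [m _ /(_ m (leqnn m)) gm] := dist 1 ltr01.
have /qL2P[_ Gy] := G2 m.
have -> : energy mu g = energy mu (fun x => (g x - G m x) + G m x).
  by apply: eq_energy => x; rewrite subrK.
apply: le_lt_trans (energyD_le mu (qmeasurableB mg (mG m)) (mG m)) _.
apply: lte_add_pinfty; apply: lte_mul_pinfty => //.
exact: le_lt_trans gm (ltry _).
Unshelve. all: end_near. Qed.

End Completeness.

Section EnergyConvergence.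
Context d (T : measurableType d) (R : realType).
Variable mu : {measure set T -> \bar R}.
Implicit Types F : nat -> T -> quat R.

Lemma cvg_qnorm_energy F :
  (qnorm mu 2%:E (F n) @[n --> \oo] --> 0)%E <-> (energy mu (F n) @[n --> \oo] --> 0)%E.
Proof.
split=> H.
- apply: cvge0_le_near => [n|e e0]; first exact: energy_ge0.
  have s0 : 0 < Num.sqrt e by rewrite sqrtr_gt0.
  apply: filterS (cvge0_near_le (fun n => qnorm2_ge0 _ _) H s0) => n Hn.
  rewrite -qnorm2_sq -(sqr_sqrtr (ltW e0)) expe2 expr2 EFinM.
  by apply: lee_pmul => //; exact: qnorm2_ge0.
- apply: cvge0_le_near => [n|e e0]; first exact: qnorm2_ge0.
  have s0 : 0 < e ^+ 2 by rewrite exprn_gt0.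
  apply: filterS (cvge0_near_le (fun n => energy_ge0 _ _) H s0) => n Hn.
  by apply: qnorm_le_fin => //; exact: ltW.
Qed.

Lemma cvge0_squeeze (a b : nat -> \bar R) (c : R) : 0 <= c ->
  (forall n, 0 <= b n)%E -> (forall n, b n <= c%:E * a n)%E ->
  (forall n, 0 <= a n)%E -> (a @ \oo --> 0)%E -> (b @ \oo --> 0)%E.
Proof.
move=> c0 b0 ba a0 /(cvge0_near_le a0) H; apply: cvge0_le_near => // e e0.
have c1 : 0 < c + 1 by rewrite ltr_wpDl.
have e1 : 0 < e / (c + 1) by rewrite divr_gt0.
apply: filterS (H _ e1) => n an; apply: le_trans (ba n) _.
apply: (@le_trans _ _ (c%:E * (e / (c + 1))%:E)%E); first exact: lee_wpmul2l.
rewrite -EFinM lee_fin mulrA ler_pdivrMr// mulrC.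
by rewrite ler_wpM2l ?(ltW e0)// lerDl.
Qed.

Lemma cvge0_squeeze2 (a b : nat -> \bar R) (x y : \bar R) :
  (forall n, x <= y + (a n + b n))%E -> (forall n, 0 <= a n)%E -> (forall n, 0 <= b n)%E ->
  (a @ \oo --> 0)%E -> (b @ \oo --> 0)%E -> (x <= y)%E.
Proof.
move=> xy a0 b0 /(cvge0_near_le a0) Ha /(cvge0_near_le b0) Hb.
apply/lee_addgt0Pr => e e0; have e2 : 0 < e / 2 by rewrite divr_gt0.
have : \forall n \near \oo, (x <= y + e%:E)%E.
  apply: filterS2 (Ha _ e2) (Hb _ e2) => n an bn.
  apply: le_trans (xy n) _; apply: leeD2l.
  have -> : e%:E = ((e / 2)%:E + (e / 2)%:E)%E by rewrite -EFinD -splitr.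
  exact: leeD.
by move=> [n _ /(_ n (leqnn n))].
Qed.

End EnergyConvergence.

(** A Lipschitz bound on differences is all that passing to limits needs; it spares
    bundling the linearity of the operation. *)
Definition qL2_bounded d1 d2 (T1 : measurableType d1) (T2 : measurableType d2)
    (R : realType) (mu : {measure set T1 -> \bar R}) (nu : {measure set T2 -> \bar R})
    (A : (T1 -> quat R) -> T2 -> quat R) :=
  (forall f, qL mu 2%:E f -> qL nu 2%:E (A f)) /\
  exists2 c : R, 0 <= c & forall f g, qL mu 2%:E f -> qL mu 2%:E g ->
    (energy nu (fun x => A f x - A g x)%R <= c%:E * energy mu (fun x => f x - g x)%R)%E.

Lemma qL2_bounded_energy d1 d2 (T1 : measurableType d1) (T2 : measurableType d2)
    (R : realType) (mu : {measure set T1 -> \bar R}) (nu : {measure set T2 -> \bar R})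
    (A : (T1 -> quat R) -> T2 -> quat R) (c : R) : 0 <= c ->
  (forall f, qmeasurable f -> qmeasurable (A f)) ->
  (forall f g x, A (fun y => f y - g y) x = A f x - A g x) ->
  (forall f, qmeasurable f -> (energy nu (A f) <= c%:E * energy mu f)%E) ->
  qL2_bounded mu nu A.
Proof.
move=> c0 mA AB Ac; split=> [f /qL2P[mf fy]|].
  apply/qL2P; split; first exact: mA.
  by apply: le_lt_trans (Ac f mf) _; apply: lte_mul_pinfty.
exists c => // f g [mf _] [mg _]; apply: le_trans (Ac _ (qmeasurableB mf mg)).
rewrite le_eqVlt; apply/orP; left; apply/eqP.
by apply: eq_energy => x; rewrite AB.
Qed.

Section Extension.
Context d1 d2 (T1 : measurableType d1) (T2 : measurableType d2) (R : realType).
Variables (mu : {measure set T1 -> \bar R}) (nu : {measure set T2 -> \bar R}).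
Implicit Types f h : T1 -> quat R.
Implicit Types g : T2 -> quat R.

(** g is a value at f of the extension of U by density from the integrable, square
    integrable functions to L^2; is_qfourier is the case of the two-sided transform. *)
Definition is_extension (U : (T1 -> quat R) -> T2 -> quat R) f g :=
  [/\ qL mu 2%:E f, qL nu 2%:E g &
  exists h : nat -> T1 -> quat R,
    [/\ forall l, qL mu 1%:E (h l) /\ qL mu 2%:E (h l),
        (fun l => qnorm mu 2%:E (fun z => f z - h l z)) @ \oo --> 0%E &
        (fun l => qnorm nu 2%:E (fun w => g w - U (h l) w)) @ \oo --> 0%E]].

(** What Plancherel's theorem says of a transform. *)
Definition isometric_transform (U : (T1 -> quat R) -> T2 -> quat R) :=
  [/\ forall h, qL mu 1%:E h -> qmeasurable (U h),
      forall h k, qL mu 1%:E h -> qL mu 1%:E k ->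
        forall w, U (fun x => h x - k x) w = U h w - U k w &
      forall h, qL mu 1%:E h -> qL mu 2%:E h -> energy nu (U h) = energy mu h].

Variable U : (T1 -> quat R) -> T2 -> quat R.
Hypothesis isoU : isometric_transform U.

Let mU h : qL mu 1%:E h -> qmeasurable (U h). Proof. by case: isoU => + _ _; exact. Qed.
Let nU h : qL mu 1%:E h -> qL mu 2%:E h -> qnorm nu 2%:E (U h) = qnorm mu 2%:E h.
Proof. by case: isoU => _ _ H h1 h2; rewrite !qnorm2E H. Qed.

Lemma extension_isometry f g : is_extension U f g -> energy nu g = energy mu f.
Proof.
move=> [f2 g2 [h [hL fh gh]]].
have mf : qmeasurable f by case: f2.
have mg : qmeasurable g by case: g2.
have mh l : qmeasurable (h l) by have [[]] := hL l.
have mUh l : qmeasurable (U (h l)) by apply: mU; have [] := hL l.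
suff H : qnorm nu 2%:E g = qnorm mu 2%:E f by rewrite -!qnorm2_sq H.
apply/eqP; rewrite eq_le; apply/andP; split.
- apply: (cvge0_squeeze2 _ _ _ gh fh) => l; try exact: qnorm2_ge0.
  have e1 : (qnorm nu 2%:E g <= qnorm nu 2%:E (fun w => g w - U (h l) w)%R +
      qnorm nu 2%:E (U (h l)))%E.
    rewrite -[leLHS](@eq_qnorm _ _ _ nu (fun w => (g w - U (h l) w) + U (h l) w)).
      by apply: qnormD => //; exact: qmeasurableB.
    by move=> w; rewrite subrK.
  have e2 : (qnorm mu 2%:E (h l) <= qnorm mu 2%:E (fun z => f z - h l z)%R +
      qnorm mu 2%:E f)%E.
    rewrite -[leLHS](@eq_qnorm _ _ _ mu (fun z => f z - (f z - h l z))).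
      by rewrite addeC; apply: qnormB => //; exact: qmeasurableB.
    by move=> w; rewrite subKr.
  have [h1 h2] := hL l; rewrite nU// in e1.
  apply: le_trans e1 _; rewrite addeCA; apply: leeD2l.
  by rewrite addeC.
- apply: (cvge0_squeeze2 _ _ _ gh fh) => l; try exact: qnorm2_ge0.
  have e1 : (qnorm nu 2%:E (U (h l)) <= qnorm nu 2%:E (fun w => g w - U (h l) w)%R +
      qnorm nu 2%:E g)%E.
    rewrite -[leLHS](@eq_qnorm _ _ _ nu (fun w => g w - (g w - U (h l) w))).
      by rewrite addeC; apply: qnormB => //; exact: qmeasurableB.
    by move=> w; rewrite subKr.
  have e2 : (qnorm mu 2%:E f <= qnorm mu 2%:E (fun z => f z - h l z)%R +
      qnorm mu 2%:E (h l))%E.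
    rewrite -[leLHS](@eq_qnorm _ _ _ mu (fun z => (f z - h l z) + h l z)).
      by apply: qnormD => //; exact: qmeasurableB.
    by move=> w; rewrite subrK.
  have [h1 h2] := hL l; rewrite nU// in e1.
  apply: le_trans e2 _.
  rewrite [leRHS]addeA [leRHS]addeC; apply: leeD2l.
  by rewrite addeC.
Qed.

Lemma extensionB f g f' g' : is_extension U f g -> is_extension U f' g' ->
  is_extension U (fun x => f x - f' x) (fun w => g w - g' w).
Proof.
move=> [f2 g2 [h [hL fh gh]]] [f2' g2' [h' [hL' fh' gh']]].
split; [exact: qL2B|exact: qL2B|exists (fun l x => h l x - h' l x)].
have cB (a b c : nat -> \bar R) : (forall n, 0 <= a n)%E -> (forall n, 0 <= b n)%E ->
    (forall n, 0 <= c n)%E -> (forall n, c n <= a n + b n)%E ->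
    (a @ \oo --> 0)%E -> (b @ \oo --> 0)%E -> (c @ \oo --> 0)%E.
  move=> a0 b0 c0 cab /(cvge0_near_le a0) Ha /(cvge0_near_le b0) Hb.
  apply: cvge0_le_near => // e e0; have e2 : 0 < e / 2 by rewrite divr_gt0.
  apply: filterS2 (Ha _ e2) (Hb _ e2) => n an bn; apply: le_trans (cab n) _.
  have -> : e%:E = ((e / 2)%:E + (e / 2)%:E)%E by rewrite -EFinD -splitr.
  exact: leeD.
have mf : qmeasurable f by case: f2. have mf' : qmeasurable f' by case: f2'.
have mg : qmeasurable g by case: g2. have mg' : qmeasurable g' by case: g2'.
split=> [l||].
- by have [? ?] := hL l; have [? ?] := hL' l; split; [exact: qL1B|exact: qL2B].
- apply: cB fh fh' => n; try exact: qnorm2_ge0.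
  have [[m1 _] _] := hL n; have [[m1' _] _] := hL' n.
  apply: le_trans (qnormB mu (qmeasurableB mf m1) (qmeasurableB mf' m1')).
  rewrite [leLHS](@eq_qnorm _ _ _ mu _ (fun x => (f x - h n x) - (f' x - h' n x)))//.
  by move=> x; rewrite !opprD !opprK addrACA.
- apply: cB gh gh' => n; try exact: qnorm2_ge0.
  have [h1 _] := hL n; have [h1' _] := hL' n.
  apply: le_trans (qnormB nu (qmeasurableB mg (mU h1)) (qmeasurableB mg' (mU h1'))).
  have [_ UB _] := isoU.
  rewrite [leLHS](@eq_qnorm _ _ _ nu _ (fun x => (g x - U (h n) x) - (g' x - U (h' n) x)))//.
  by move=> x; rewrite UB// !opprD !opprK addrACA.
Qed.

(** Differences of values extend 0, and the extension is isometric. *)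
Lemma extension_unique f g g' : is_extension U f g -> is_extension U f g' ->
  {ae nu, forall w, g w = g' w}.
Proof.
move=> fg fg'; have gg := extensionB fg fg'.
have [_ [mgg _] _] := gg.
have e0 : energy nu (fun w => g w - g' w) = 0%E.
  rewrite (extension_isometry gg); have e0 x : qsq (f x - f x) = 0 by rewrite subrr qsq0.
  by rewrite /energy; under eq_integral do rewrite e0; rewrite integral0.
by apply: filterS (energy0_ae mgg e0) => w /eqP; rewrite subr_eq0 => /eqP.
Qed.

Lemma extension_ae f f' g g' : is_extension U f g ->
  qmeasurable f' -> qmeasurable g' ->
  {ae mu, forall x, f' x = f x} -> {ae nu, forall w, g' w = g w} ->
  is_extension U f' g'.
Proof.
move=> [f2 g2 [h [hL fh gh]]] mf' mg' ff gg.
split; [exact: ae_qL2 ff f2|exact: ae_qL2 gg g2|exists h; split => //].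
- rewrite (_ : (fun l => _) = (fun l => qnorm mu 2%:E (fun z => f z - h l z)))//.
  apply/funext => l; have [[mh _] _] := hL l; apply: qnorm_energy.
  apply: ae_energy; [exact: qmeasurableB|apply: qmeasurableB => //; by case: f2|].
  by apply: filterS ff => x ->.
- rewrite (_ : (fun l => _) = (fun l => qnorm nu 2%:E (fun w => g w - U (h l) w)))//.
  apply/funext => l; have [h1 _] := hL l; apply: qnorm_energy.
  apply: ae_energy; [apply: qmeasurableB => //; exact: mU|apply: qmeasurableB; [by case: g2|exact: mU]|].
  by apply: filterS gg => x ->.
Qed.

(** Truncations of f converge to f; their transforms form a Cauchy sequence,
    and L^2 is complete. *)
Lemma extension_exists f (E_ : nat -> set T1) :
  (forall l, measurable (E_ l)) -> (forall l, (mu (E_ l) < +oo)%E) ->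
  (forall x, \forall l \near \oo, E_ l x) -> qL mu 2%:E f -> exists g, is_extension U f g.
Proof.
move=> mE Ey cover f2.
have mf : qmeasurable f by case: f2.
pose h := truncation E_ f.
have h1 l : qL mu 1%:E (h l) by exact: qL1_truncation.
have h2 l : qL mu 2%:E (h l) by exact: qL2_truncation.
have mh l : qmeasurable (h l) by case: (h1 l).
have fh := cvg_truncation mE cover f2.
have [_ UB UE] := isoU.
have Uh2 l : qL nu 2%:E (U (h l)).
  apply/qL2P; split; first exact: mU.
  by rewrite UE//; have /qL2P[] := h2 l.
have cauchy (e : R) : 0 < e -> exists N, forall m n, (N <= m)%N -> (N <= n)%N ->
    (energy nu (fun x => U (h m) x - U (h n) x)%R <= e%:E)%E.
  move=> e0; have e4 : 0 < e / 4 by rewrite divr_gt0.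
  have [N _ NP] := cvge0_near_le (fun n => energy_ge0 mu _) fh e4.
  exists N => m n Nm Nn.
  have -> : energy nu (fun x => U (h m) x - U (h n) x) = energy mu (fun x => h m x - h n x).
    rewrite -UE; [|exact: qL1B|exact: qL2B].
    by apply: eq_energy => w; rewrite UB.
  have -> : energy mu (fun x => h m x - h n x) =
      energy mu (fun x => (f x - h n x) + (- (f x - h m x))).
    by apply: eq_energy => x; rewrite opprB [in RHS]addrC addrA subrK.
  have mfn l := qmeasurableB mf (mh l).
  apply: le_trans (energyD_le mu (mfn n) (qmeasurableN (mfn m))) _.
  rewrite energyN; apply: (@le_trans _ _ (2%:E * (e / 4)%:E + 2%:E * (e / 4)%:E)%E).
    by apply: leeD; apply: lee_wpmul2l => //; exact: NP.
  by rewrite -!EFinM -EFinD lee_fin; lra.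
have [g [g2 gU]] := qL2_complete Uh2 cauchy.
by exists g; split => //; exists h; split => //; exact/cvg_qnorm_energy.
Qed.

End Extension.

(** An operation that intertwines two transforms on integrable, square integrable
    functions intertwines their extensions. *)
Lemma extension_intertwine d1 d2 d1' d2' (T1 : measurableType d1) (T2 : measurableType d2)
    (T1' : measurableType d1') (T2' : measurableType d2') (R : realType)
    (mu : {measure set T1 -> \bar R}) (nu : {measure set T2 -> \bar R})
    (mu' : {measure set T1' -> \bar R}) (nu' : {measure set T2' -> \bar R})
    (U : (T1 -> quat R) -> T2 -> quat R) (U' : (T1' -> quat R) -> T2' -> quat R)
    (A : (T1 -> quat R) -> T1' -> quat R) (B : (T2 -> quat R) -> T2' -> quat R) f g :
  isometric_transform mu nu U -> qL2_bounded mu mu' A -> qL2_bounded nu nu' B ->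
  (forall h, qL mu 1%:E h -> qL mu' 1%:E (A h)) ->
  (forall h, qL mu 1%:E h -> qL mu 2%:E h -> forall w, U' (A h) w = B (U h) w) ->
  is_extension mu nu U f g -> is_extension mu' nu' U' (A f) (B g).
Proof.
move=> [mU _ UE] [A2 [a a0 Aa]] [B2 [b b0 Bb]] A1 UAB [f2 g2 [h [hL fh gh]]].
have Uh2 l : qL nu 2%:E (U (h l)).
  have [h1 h2] := hL l; apply/qL2P; split; first exact: mU.
  by rewrite UE//; have /qL2P[] := h2.
split; [exact: A2|exact: B2|exists (fun l => A (h l)); split].
- by move=> l; have [? ?] := hL l; split; [exact: A1|exact: A2].
- apply/cvg_qnorm_energy; move/cvg_qnorm_energy: fh; apply: (cvge0_squeeze a0);
    try by move=> l; exact: energy_ge0.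
  by move=> l; apply: Aa => //; have [] := hL l.
- apply/cvg_qnorm_energy; move/cvg_qnorm_energy: gh; apply: (cvge0_squeeze b0);
    try by move=> l; exact: energy_ge0.
  move=> l; have [h1 h2] := hL l.
  apply: le_trans (Bb _ _ g2 (Uh2 l)); rewrite (@eq_energy _ _ _ nu' _ (fun x => B g x - B (U (h l)) x))//.
  by move=> w; rewrite UAB.
Qed.

(** * The two-sided quaternion Fourier transform *)

Section HalfSplit.
Variable R : realType.
Implicit Types p q : quat R.

(** The eigenspaces of q |-> i q j, for 1 and -1. *)
Definition qhalfp q : quat R := 2^-1 *: (q + qi * q * qj).
Definition qhalfm q : quat R := 2^-1 *: (q - qi * q * qj).

Lemma qhalf_sum q : qhalfm q + qhalfp q = q.
Proof. by apply: quatP; split => /=; field. Qed.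

Lemma qhalfpD p q : qhalfp (p + q) = qhalfp p + qhalfp q.
Proof. by apply: quatP; split => /=; ring. Qed.
Lemma qhalfmD p q : qhalfm (p + q) = qhalfm p + qhalfm q.
Proof. by apply: quatP; split => /=; ring. Qed.
Lemma qhalfpB p q : qhalfp (p - q) = qhalfp p - qhalfp q.
Proof. by apply: quatP; split => /=; ring. Qed.
Lemma qhalfmB p q : qhalfm (p - q) = qhalfm p - qhalfm q.
Proof. by apply: quatP; split => /=; ring. Qed.
Lemma qhalfpp q : qhalfp (qhalfp q) = qhalfp q.
Proof. by apply: quatP; split => /=; field. Qed.
Lemma qhalfmm q : qhalfm (qhalfm q) = qhalfm q.
Proof. by apply: quatP; split => /=; field. Qed.
Lemma qhalfpm q : qhalfp (qhalfm q) = 0.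
Proof. by apply: quatP; split => /=; field. Qed.
Lemma qhalfmp q : qhalfm (qhalfp q) = 0.
Proof. by apply: quatP; split => /=; field. Qed.

(** j anticommutes with i, so that it exchanges the eigenspaces. *)
Lemma qhalf_jM q : qhalfp (qj * q) = qj * qhalfm q /\ qhalfm (qj * q) = qj * qhalfp q.
Proof. by split; apply: quatP; split => /=; ring. Qed.

Lemma qsq_half_orth p q : qsq (qhalfm p + qhalfp q) = qsq (qhalfm p) + qsq (qhalfp q).
Proof. by rewrite /qsq /=; field. Qed.

Lemma qsq_half_sum q : qsq (qhalfm q) + qsq (qhalfp q) = qsq q.
Proof. by rewrite /qsq /=; field. Qed.

Lemma qhalf_ej q (t : R) :
  qhalfp (q * ej t) = qhalfp q * ej t /\ qhalfm (q * ej t) = qhalfm q * ej t.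
Proof. by rewrite ejE; split; apply: quatP; split => /=; ring. Qed.

Lemma qexp_iE (t : R) : qexp qi t = Quat (cos t) (sin t) 0 0.
Proof. by apply: quatP; split => /=; rewrite ?mulr0 ?mulr1 ?addr0 ?add0r. Qed.

(** On the two eigenspaces the left exponential in i acts as a right exponential
    in j; this reduces the two-sided transform to a one-sided one. *)
Lemma qexp_i_left q (t : R) :
  qexp qi t * q = qhalfm q * ej t + qhalfp q * ej (- t).
Proof.
by rewrite qexp_iE !ejE cosN sinN; apply: quatP; split => /=; field.
Qed.

End HalfSplit.

Section HalfIntegral.
Context d (T : measurableType d) (R : realType).
Variable mu : {measure set T -> \bar R}.
Implicit Types f : T -> quat R.

Lemma qmeasurable_half f : qmeasurable f ->
  qmeasurable (fun x => qhalfp (f x)) /\ qmeasurable (fun x => qhalfm (f x)).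
Proof.
move=> mf; have mij : qmeasurable (fun x => qi * f x * qj).
  by apply: qmeasurableM; [apply: qmeasurableM => //|]; exact: qmeasurable_cst.
by split; apply: qmeasurableZ => //; [exact: qmeasurableD|exact: qmeasurableB].
Qed.

Lemma qintegral_half f : qL mu 1%:E f ->
  qintegral mu (fun x => qhalfp (f x)) = qhalfp (qintegral mu f) /\
  qintegral mu (fun x => qhalfm (f x)) = qhalfm (qintegral mu f).
Proof.
move=> fL; have fi : qL mu 1%:E (fun x => qi * f x) by exact: qL1Ml.
have fij : qL mu 1%:E (fun x => qi * f x * qj) by exact: qL1Mr.
rewrite /qhalfp /qhalfm; split.
  by rewrite qintegralZ ?qintegralD ?qintegralMr ?qintegralMl//; exact: qL1D.
by rewrite qintegralZ ?qintegralB ?qintegralMr ?qintegralMl//; exact: qL1B.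
Qed.

Lemma qL1_half f : qL mu 1%:E f ->
  qL mu 1%:E (fun x => qhalfp (f x)) /\ qL mu 1%:E (fun x => qhalfm (f x)).
Proof.
move=> fL; have fi : qL mu 1%:E (fun x => qi * f x) by exact: qL1Ml.
have fij : qL mu 1%:E (fun x => qi * f x * qj) by exact: qL1Mr.
by split; apply: qL1Z; [exact: qL1D|exact: qL1B].
Qed.

End HalfIntegral.

Lemma rescales_signs (R : realType) m (e : 'I_m -> R) : (forall i, `|e i| = 1) ->
  rescales (lebesgue_cV R m) (lebesgue_cV R m) (fun x => \col_i (e i * x i ord0)) 1.
Proof.
elim: m e => [|m IH] e e1.
  have -> : (fun x : 'cV[R]_0 => \col_i (e i * x i ord0)) = id.
    by apply/funext => x; rewrite (flatmx0 x) [LHS]flatmx0.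
  by split => // f mf f0; rewrite mul1e.
have -> : (fun x : 'cV[R]_m.+1 => \col_i (e i * x i ord0)) = (fun x => cV_cons
    ((fun p : measurableTypeR R * 'cV[R]_m => (e ord0 * ((p.1 : R) + 0) : measurableTypeR R,
       \col_i (e (lift ord0 i) * p.2 i ord0) : 'cV[R]_m)) (cV_uncons x))).
  apply/funext => x; rewrite -[in LHS](cV_unconsK x) [cV_uncons x]surjective_pairing.
  apply: eq_cV_cons => [|i]; first by rewrite mxE cV_cons_ord0 addr0.
  by rewrite mxE cV_cons_lift [RHS]mxE.
have e0 : e ord0 != 0 by rewrite -normr_eq0 e1 oner_eq0.
have rs := rescales_affine 0 e0; have [mk _ _] := rs.
rewrite -[1]mulr1; apply: (@rescales_cV_conj R m (fun p =>
  (e ord0 * ((p.1 : R) + 0) : measurableTypeR R,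
   \col_i (e (lift ord0 i) * p.2 i ord0) : 'cV[R]_m))).
apply: (@rescales_fiber2 _ _ _ _ _ (@lebesgue_measure R) (lebesgue_cV R m)
  (fun p => e ord0 * ((p.1 : R) + 0) : measurableTypeR R)
  (fun x => \col_i (e (lift ord0 i) * x i ord0))) => //.
- exact: (measurableT_comp mk measurable_fst).
- by move=> y; move: rs; rewrite e1 invr1.
- exact: IH.
Qed.

Section TwoSided.
Variables (R : realType) (n : nat).
Notation V := 'cV[R]_(n + n).
Notation leb := (lebesgue_cV R (n + n)).
Implicit Types f g : V -> quat R.

Definition flip (w : V) : V := \col_i ((if (i < n)%N then -1 else 1) * w i ord0).

Lemma rescales_flip : rescales leb leb flip 1.
Proof. by apply: rescales_signs => i; case: ifP => _; rewrite ?normrN normr1. Qed.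

Let usub_flip w : usubmx (flip w) = - usubmx w.
Proof. by apply/matrixP => i j; rewrite !mxE /= ltn_ord mulN1r (ord1 j). Qed.

Let dsub_flip w : dsubmx (flip w) = dsubmx w.
Proof. by apply/matrixP => i j; rewrite !mxE /= ltnNge leq_addr mul1r (ord1 j). Qed.

Let dotcV_split (w z : V) :
  dotcV w z = dotcV (usubmx w) (usubmx z) + dotcV (dsubmx w) (dsubmx z).
Proof.
rewrite /dotcV big_split_ord /=; congr (_ + _); by apply: eq_bigr => i _; rewrite !mxE.
Qed.

Let dotcVN m (x y : 'cV[R]_m) : dotcV (- x) y = - dotcV x y.
Proof. by rewrite /dotcV -sumrN; apply: eq_bigr => i _; rewrite mxE mulNr. Qed.

Definition two_sided g w : quat R := qhalfm (g w) + qhalfp (g (flip w)).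

(** The two exponentials merge into one on the right, with the first block of
    frequencies reflected on one of the eigenspaces. *)
Lemma qfourier1E f w : qL leb 1%:E f ->
  qfourier1 f w = two_sided (@cV_fourier R (n + n) f) w.
Proof.
move=> fL; have f1 := qL1_cV_phase w fL; have f2 := qL1_cV_phase (flip w) fL.
rewrite /two_sided /cV_fourier.
have [_ <-] := qintegral_half f1; have [<- _] := qintegral_half f2.
rewrite -qintegralD; first last.
- by have [] := qL1_half f2.
- by have [] := qL1_half f1.
apply: eq_qintegral => z; rewrite qexp_i_left mulrDl -!mulrA -!ejD.
rewrite (qhalf_ej _ _).2 (qhalf_ej _ _).1 /cV_phase !dotcV_split usub_flip dsub_flip dotcVN.
by congr (_ * ej _ + _ * ej _); ring.
Qed.

Lemma isometric_cV_fourier m :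
  isometric_transform (lebesgue_cV R m) (lebesgue_cV R m) (@cV_fourier R m).
Proof.
split; [by move=> h [mh _]; exact: qmeasurable_cV_fourier|exact: cV_fourierB|].
exact: cV_plancherel.
Qed.

Lemma qmeasurable_two_sided g : qmeasurable g -> qmeasurable (two_sided g).
Proof.
move=> mg; have mgf := rescales_qmeasurable rescales_flip mg.
by apply: qmeasurableD; [have [] := qmeasurable_half mg|have [] := qmeasurable_half mgf].
Qed.

(** The eigenspaces are orthogonal and the reflection preserves Lebesgue measure. *)
Lemma energy_two_sided g : qmeasurable g -> energy leb (two_sided g) = energy leb g.
Proof.
move=> mg; have [mp mm] := qmeasurable_half mg.
have [mfp _] := qmeasurable_half (rescales_qmeasurable rescales_flip mg).
have eD (u v : V -> quat R) : qmeasurable u -> qmeasurable v ->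
    (\int[leb]_x ((qsq (u x))%:E + (qsq (v x))%:E) = energy leb u + energy leb v)%E.
  by move=> mu mv; rewrite ge0_integralD//; exact: measurable_EFin_qsq.
transitivity (energy leb (fun x => qhalfm (g x)) + energy leb (fun x => qhalfp (g (flip x))))%E.
  rewrite -eD//; apply: eq_integral => x _; by rewrite -EFinD qsq_half_orth.
rewrite (rescales_energy rescales_flip mp) mul1e -eD//.
by apply: eq_integral => x _; rewrite -EFinD qsq_half_sum.
Qed.

Lemma two_sidedB g g' w : two_sided (fun x => g x - g' x) w = two_sided g w - two_sided g' w.
Proof. by rewrite /two_sided qhalfmB qhalfpB opprD addrACA. Qed.

Lemma qL2_bounded_two_sided : qL2_bounded leb leb two_sided.
Proof.
apply: (qL2_bounded_energy ler01 _ two_sidedB) => [f|f mf]; first exact: qmeasurable_two_sided.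
by rewrite mul1e energy_two_sided.
Qed.

Lemma isometric_qfourier1 : isometric_transform leb leb (@qfourier1 R n).
Proof.
have E h : qL leb 1%:E h -> qfourier1 h = two_sided (@cV_fourier R (n + n) h).
  by move=> h1; apply/funext => w; exact: qfourier1E.
have [mU UB UE] := isometric_cV_fourier (n + n).
split.
- by move=> h h1; rewrite E//; apply: qmeasurable_two_sided; exact: mU.
- move=> h k h1 k1 w; rewrite !E//; last exact: qL1B.
  by rewrite -two_sidedB; congr (qhalfm _ + qhalfp _); exact: UB.
- by move=> h h1 h2; rewrite E// energy_two_sided ?UE//; exact: mU.
Qed.

Lemma qL2_bounded_id d (T : measurableType d) (mu : {measure set T -> \bar R}) :
  qL2_bounded mu mu id.
Proof. by split => //; exists 1 => // f g _ _; rewrite mul1e. Qed.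

Let is_ext f g := is_extension leb leb (@cV_fourier R (n + n)) f g.

Lemma is_qfourier_two_sided f g : is_ext f g -> is_qfourier f (two_sided g).
Proof.
apply: (@extension_intertwine _ _ _ _ _ _ _ _ _ _ _ _ _ _ (@qfourier1 R n) id).
- exact: isometric_cV_fourier.
- exact: qL2_bounded_id.
- exact: qL2_bounded_two_sided.
- by [].
- by move=> h h1 h2 w; exact: qfourier1E.
Qed.

(** The choice made in the definition of the two-sided transform is immaterial up to
    null sets, as the extension is unique. *)
Lemma qfourierE f g : is_ext f g -> {ae leb, forall w, qfourier f w = two_sided g w}.
Proof.
move=> fg; have H := is_qfourier_two_sided fg.
apply: (extension_unique isometric_qfourier1 _ H).
by rewrite /qfourier; apply: (xgetPex (fun=> 0)); exists (two_sided g).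
Qed.

End TwoSided.

Lemma cV_fourier_extension_exists (R : realType) m (f : 'cV[R]_m -> quat R) : qL (lebesgue_cV R m) 2%:E f ->
  exists g : 'cV[R]_m -> quat R, is_extension (lebesgue_cV R m) (lebesgue_cV R m) (@cV_fourier R m) f g.
Proof.
have /sigma_finiteP[E [ET ndE mE]] := sigma_finiteT (lebesgue_cV R m).
move=> f2; apply: (extension_exists (@isometric_cV_fourier R m) (E_ := E)) f2.
- by move=> l; have [] := mE l.
- by move=> l; have [] := mE l.
move=> x; have : [set: 'cV[R]_m] x by [].
rewrite ET => -[k _ Ex]; near=> l; have kl : (k <= l)%N by near: l; exact: nbhs_infty_ge.
by have /subsetPset := ndE _ _ kl; apply.
Unshelve. all: end_near. Qed.

(** * Commuting symbols *)

Lemma measurable_inverse d (T : measurableType d) (R : realType) (f : T -> R) :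
  measurable_fun setT f -> (forall x, 0 <= f x) -> measurable_fun setT (fun x => (f x)^-1).
Proof.
move=> mf f0; rewrite (_ : (fun _ => _) = (@powR R)^~ (-1) \o f); last first.
  by apply/funext => x /=; rewrite powR_inv1.
by apply: measurableT_comp mf; exact: measurable_powR.
Qed.

Section CoordinateHyperplanes.
Variable R : realType.

Lemma lebesgue_cV_cylinder m (B : set (measurableTypeR R)) (A : set 'cV[R]_m) :
  measurable B -> measurable A ->
  lebesgue_cV R m.+1 (@cV_uncons R m @^-1` (B `*` A)) =
  (@lebesgue_measure R B * lebesgue_cV R m A)%E.
Proof.
move=> mB mA; rewrite -product_measure1E//=.
rewrite /lebesgue_step /pushforward -comp_preimage.
by rewrite (_ : _ \o _ = id)//; apply/funext => p /=; rewrite cV_consK.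
Qed.

Lemma coordinate_neq0_ae m (i : 'I_m) : {ae lebesgue_cV R m, forall w : 'cV[R]_m, w i ord0 != 0}.
Proof.
elim: m i => [[]//|m IH] i.
have [mu_ _ _] := rescales_cV_uncons R m.
have [j ->|->] := unliftP ord0 i.
  have [A [mA A0 HA]] := IH j.
  exists ((@cV_uncons R m) @^-1` ([set: measurableTypeR R] `*` A)); split.
  - by rewrite -[X in measurable X]setTI; apply: mu_ => //; exact: measurableX.
  - by rewrite lebesgue_cV_cylinder// [X in (_ * X)%E]A0 mule0.
  - move=> x /= Hx; split => //; apply: HA => /= Hj; apply: Hx.
    by rewrite -(cV_unconsK x) [cV_uncons x]surjective_pairing cV_cons_lift.
have mS : measurable [set (0 : measurableTypeR R)] by exact: measurable_set1.
have S0 : (@lebesgue_measure R) [set (0 : R)] = 0%E by exact: lebesgue_measure_set1.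
exists ((@cV_uncons R m) @^-1` ([set (0 : measurableTypeR R)] `*` [set: 'cV[R]_m])); split.
- by rewrite -[X in measurable X]setTI; apply: mu_ => //; exact: measurableX.
- by rewrite lebesgue_cV_cylinder// [X in (X * _)%E]S0 mul0e.
- by move=> x /= /negP; rewrite negbK => /eqP.
Qed.

End CoordinateHyperplanes.

Section Symbol.
Variables (R : realType) (n : nat).
Notation V := 'cV[R]_(n.+1 + n.+1).
Notation leb := (lebesgue_cV R (n.+1 + n.+1)).
Notation is_ext := (is_extension leb leb (@cV_fourier R (n.+1 + n.+1))).
Implicit Types (f g : V -> quat R) (q : quat R).

(** The plane of 1 and j, which is the centraliser of j. *)
Definition in_Cj q := q1 q = 0 /\ q3 q = 0.

Lemma in_Cj_ejC q (t : R) : in_Cj q -> q * ej t = ej t * q.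
Proof. by move=> [a b]; rewrite ejE; apply: quatP; split; rewrite /= a b; ring. Qed.

Lemma commute_ej_in_Cj q (t : R) : sin t != 0 -> q * ej t = ej t * q -> in_Cj q.
Proof.
rewrite ejE => s0 E; have := congr1 (@q1 R) E; have := congr1 (@q3 R) E => /= e3 e1.
have h1 : sin t * q1 q = 0 by lra.
have h3 : sin t * q3 q = 0 by lra.
by split; apply/eqP; [move/eqP: h1|move/eqP: h3]; rewrite mulf_eq0 (negbTE s0).
Qed.

Lemma in_Cj_conj q : in_Cj q -> qconj q = qi * q * - qi.
Proof. by move=> [a b]; apply: quatP; split; rewrite /= ?a ?b; ring. Qed.

Lemma in_CjP q : in_Cj q <-> 2^-1 *: (q + qj * q * qj) = 0.
Proof.
split=> [[a b]|E]; first by apply: quatP; split; rewrite /= ?a ?b; ring.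
have := congr1 (@q1 R) E; have := congr1 (@q3 R) E => /= e3 e1.
by split; lra.
Qed.

(** Commuting with e^(j c) confines a quaternion to the plane of 1 and j as soon as
    sin c is not 0. Taking for t the vectors 1/(l+1) times the first basis vector,
    c is a nonzero number in ]-pi, pi[ once l is large; countably many vectors t are
    used, so that the exceptional sets add up to a null set. *)
Lemma ae_in_Cj g :
  (forall t : 'cV[R]_n.+1, {ae leb, forall w,
    g w * ej (- (2 * pi * dotcV (dsubmx w) t)) =
    ej (- (2 * pi * dotcV (dsubmx w) t)) * g w}) ->
  {ae leb, forall w, in_Cj (g w)}.
Proof.
move=> H; pose t (l : nat) : 'cV[R]_n.+1 := \col_i (if i == ord0 then l.+1%:R^-1 else 0).
have := ae_foralln (fun l => H (t l)).
apply: filterS2 (coordinate_neq0_ae R (rshift n.+1 (ord0 : 'I_n.+1))) => w w0 Hw.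
set a := w _ _ in w0.
have dE l : dotcV (dsubmx w) (t l) = a * l.+1%:R^-1.
  rewrite /dotcV (bigD1 ord0)//= big1 => [|i i0]; first by rewrite !mxE eqxx addr0.
  by rewrite [t l i 0]mxE (negbTE i0) mulr0.
pose l := Num.truncn (2 * `|a|).
have la : 2 * `|a| < l.+1%:R by exact: truncnS_gt.
have := Hw l; rewrite dE; apply: commute_ej_in_Cj.
have a0 : 0 < `|a| by rewrite normr_gt0.
have l0 : 0 < (l.+1%:R : R) by [].
have [small pos] : 2 * pi * (`|a| * l.+1%:R^-1) < pi /\ 0 < 2 * pi * (`|a| * l.+1%:R^-1).
  split; last by rewrite mulr_gt0 ?mulr_gt0 ?pi_gt0 ?invr_gt0.
  rewrite mulrAC mulrA -[ltRHS]mul1r ltr_pM2r ?pi_gt0//.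
  by rewrite ltr_pdivrMr// mul1r.
have sn : sin (2 * pi * (`|a| * l.+1%:R^-1)) != 0.
  by rewrite gt_eqF// sin_gt0_pi// pos small.
rewrite sinN oppr_eq0; move: sn.
case: (ger0P a) => // _; by rewrite mulNr mulrN sinN oppr_eq0.
Qed.

Let qL2_bounded_pointwise (A : quat R -> quat R) (c : R) : 0 <= c ->
  (forall f, qmeasurable f -> qmeasurable (A \o f)) ->
  (forall p q, A (p - q) = A p - A q) -> (forall q, qsq (A q) <= c * qsq q) ->
  qL2_bounded leb leb (fun f x => A (f x)).
Proof.
move=> c0 mA AB Aq.
have Ac f : qmeasurable f -> (energy leb (fun x => A (f x)) <= c%:E * energy leb f)%E.
  move=> mf; rewrite -ge0_integralZl//; last exact: measurable_EFin_qsq.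
  apply: ge0_le_integral => //.
  - exact/measurable_EFin_qsq/mA.
  - by apply: measurable_funeM; exact: measurable_EFin_qsq.
  - by move=> x _; rewrite -EFinM lee_fin.
exact: (qL2_bounded_energy (A := fun f x => A (f x)) c0 mA (fun f g x => AB _ _) Ac).
Qed.

(** The exponential of the one-sided transform is on the right, so that quaternions
    come out on the left. *)
Lemma extensionMl (c : quat R) f g : is_ext f g ->
  is_ext (fun x => c * f x) (fun w => c * g w).
Proof.
have bc : qL2_bounded leb leb (fun f x => c * f x).
  apply: (@qL2_bounded_pointwise _ (qsq c)) => //.
  - by move=> h mh; apply: qmeasurableM => //; exact: qmeasurable_cst.
  - by move=> p q; rewrite mulrBr.
  - by move=> q; rewrite qsqM.
apply: (extension_intertwine (isometric_cV_fourier R _) bc bc).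
- by move=> h h1; exact: qL1Ml.
- by move=> h h1 h2 w; exact: cV_fourierMl.
Qed.

(* q |-> (q + j q j) / 2 projects onto the complement of the plane of 1 and j *)
Let off q : quat R := 2^-1 *: (q + qj * q * qj).

Let offB p q : off (p - q) = off p - off q.
Proof. by apply: quatP; split; rewrite /=; ring. Qed.

Let qsq_off q : qsq (off q) <= 1 * qsq q.
Proof.
rewrite mul1r -subr_ge0 (_ : _ - _ = q0 q ^+ 2 + q2 q ^+ 2).
  by rewrite addr_ge0 ?sqr_ge0.
by rewrite /off /qsq /=; field.
Qed.

Let moff f : qmeasurable f -> qmeasurable (off \o f).
Proof.
move=> mf; apply: qmeasurableZ => //; apply: qmeasurableD => //.
by apply: qmeasurableM; [apply: qmeasurableM => //|]; exact: qmeasurable_cst.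
Qed.

(** Projecting onto the orthogonal complement of the plane commutes with the transform,
    whose kernel lies in the plane; and the transform is isometric, so that a
    vanishing projection of the symbol makes the projection of f vanish. *)
Lemma extension_in_Cj f g : is_ext f g -> {ae leb, forall w, in_Cj (g w)} ->
  {ae leb, forall x, in_Cj (f x)}.
Proof.
move=> fg gC; have bo : qL2_bounded leb leb (fun f x => off (f x)).
  exact: (@qL2_bounded_pointwise _ 1).
have [f2 g2 _] := fg.
have off1 h : qL leb 1%:E h -> qL leb 1%:E (fun x => off (h x)).
  by move=> h1; apply: qL1Z; apply: qL1D => //; apply: qL1Mr; exact: qL1Ml.
have H : is_ext (fun x => off (f x)) (fun w => off (g w)).
  apply: (extension_intertwine (isometric_cV_fourier R _) bo bo) fg => //.
  move=> h h1 h2 w; rewrite /cV_fourier.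
  have e1 := qL1_cV_phase w h1.
  have e2 : qL leb 1%:E (fun x => qj * (h x * ej (cV_phase w x))) by exact: qL1Ml.
  have e3 : qL leb 1%:E (fun x => qj * (h x * ej (cV_phase w x)) * qj) by exact: qL1Mr.
  rewrite /off -qintegralMl// -qintegralMr// -qintegralD// -qintegralZ; last exact: qL1D.
  apply: eq_qintegral => x; rewrite ejE; apply: quatP; split; rewrite /=; ring.
have := extension_isometry (isometric_cV_fourier R _) H.
have -> : energy leb (fun w => off (g w)) = 0%E.
  rewrite (@ae_energy _ _ _ leb _ (fun=> 0)).
  - by rewrite /energy; under eq_integral do rewrite qsq0; rewrite integral0.
  - by apply: moff; case: g2.
  - exact: qmeasurable_cst.
  - by apply: filterS gC => w /in_CjP.
move/esym/energy0_ae => /(_ (moff _)); have mf : qmeasurable f by case: f2.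
by move=> /(_ mf); apply: filterS => x /in_CjP.
Qed.

Let reflect_rescales : rescales leb leb (fun x : V => - x) 1.
Proof.
have N10 : (-1 : R) != 0 by rewrite oppr_eq0 oner_eq0.
have := rescales_cV_affine (0 : V) N10; rewrite normrN normr1 expr1n invr1.
by under [X in rescales _ _ X _]eq_fun do rewrite addr0 scaleN1r.
Qed.

(* q |-> i q i^-1 restricts to the conjugation of the plane of 1 and j *)
Let sg q : quat R := qi * q * - qi.

(** Conjugation by i conjugates the exponentials in j, and the reflection of the
    variable conjugates them back. On the plane of 1 and j this is the passage to
    the involution defining admissibility. *)
Lemma extension_star f g : is_ext f g ->
  is_ext (fun x => sg (f (- x))) (fun w => sg (g w)).
Proof.
have msg (h : V -> quat R) : qmeasurable h -> qmeasurable (sg \o h).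
  by move=> mh; apply: qmeasurableM; [apply: qmeasurableM => //|]; exact: qmeasurable_cst.
have sgB p q : sg (p - q) = sg p - sg q by rewrite /sg mulrBr mulrBl.
have sgq q : qsq (sg q) = qsq q by rewrite /sg /qsq /=; ring.
have sg_le q : qsq (sg q) <= 1 * qsq q by rewrite sgq mul1r.
have bB : qL2_bounded leb leb (fun g w => sg (g w)).
  exact: (@qL2_bounded_pointwise sg 1 ler01 msg sgB sg_le).
have bA : qL2_bounded leb leb (fun f x => sg (f (- x))).
  apply: (qL2_bounded_energy ler01) => [h mh|h k x|h mh].
  - exact: (msg _ (rescales_qmeasurable reflect_rescales mh)).
  - exact: sgB.
  - rewrite -(rescales_energy reflect_rescales mh) le_eqVlt; apply/orP; left; apply/eqP.
    by apply: eq_energy => x; rewrite sgq.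
apply: (extension_intertwine (isometric_cV_fourier R _) bA bB).
  move=> h h1; apply: qL1Mr; apply: qL1Ml.
  exact: (rescales_qL1 reflect_rescales h1).
move=> h h1 h2 w; rewrite /cV_fourier.
have e1 := qL1_cV_phase w h1.
have e2 : qL leb 1%:E (fun x => qi * (h x * ej (cV_phase w x))) by exact: qL1Ml.
have := rescales_qintegral reflect_rescales e1; rewrite scale1r => <-.
have e1' := rescales_qL1 reflect_rescales e1.
rewrite /sg -qintegralMl// -qintegralMr; last exact: qL1Ml.
apply: eq_qintegral => x.
have -> : cV_phase w (- x) = - cV_phase w x.
  rewrite /cV_phase (_ : dotcV w (- x) = - dotcV w x) ?mulrN//.
  by rewrite /dotcV -sumrN; apply: eq_bigr => i _; rewrite mxE mulrN.
by rewrite !ejE cosN sinN; apply: quatP; split; rewrite /=; ring.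
Qed.

(** The two hypotheses on the two-sided transform together force the one-sided
    transform P of psi to be symmetric under the change of sign of the first
    block of frequencies and to lie in the plane of 1 and j. Then P is also the
    two-sided transform of psi, and psi lies in that plane. *)
Lemma shearlet_symbol psi : qL leb 2%:E psi ->
  (forall t : 'cV[R]_n.+1, {ae leb, forall w,
    qfourier psi w * qexp qj (- (2 * pi * dotcV (dsubmx w) t)) =
    qexp qj (- (2 * pi * dotcV (dsubmx w) t)) * qfourier psi w}) ->
  (forall t : 'cV[R]_n.+1, {ae leb, forall w,
    qfourier (fun z => qj * psi z) w * qexp qj (- (2 * pi * dotcV (dsubmx w) t)) =
    qj * qexp qj (- (2 * pi * dotcV (dsubmx w) t)) * qfourier psi w}) ->
  exists P, [/\ is_ext psi P, {ae leb, forall w, in_Cj (P w)} &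
    admissibility_cst psi =
    (\int[leb]_w (qsq (P w) / `|w ord0 ord0| ^+ (2 * n.+1))%:E)%E].
Proof.
move=> psi2 Hc Hj; have [P psiP] := cV_fourier_extension_exists psi2.
have [_ [mP _] _] := psiP.
have FP := qfourierE psiP.
have FjP := qfourierE (extensionMl qj psiP).
have sym : {ae leb, forall w, two_sided P w = P w /\ P (flip w) = P w}.
  apply: filterS3 FP FjP (Hj 0) => w -> ->.
  have -> : dotcV (dsubmx w) 0 = 0 by rewrite /dotcV big1// => i _; rewrite [X in _ * X]mxE mulr0.
  rewrite mulr0 oppr0 !ej0 !mulr1 /two_sided (qhalf_jM _).1 (qhalf_jM _).2 -mulrDr.
  move/(congr1 (fun q => - qj * q)); rewrite !mulrA mulNr.
  have -> : (qj * qj : quat R) = -1 by have [] := quat_units R.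
  rewrite opprK !mul1r => E.
  have := congr1 (@qhalfp R) E; have := congr1 (@qhalfm R) E.
  rewrite !qhalfpD !qhalfmD !qhalfpp !qhalfmm !qhalfpm !qhalfmp !addr0 !add0r => em ep.
  by split; [rewrite -ep|rewrite -(qhalf_sum (P (flip w))) em -ep]; rewrite qhalf_sum.
have PC : {ae leb, forall w, in_Cj (P w)}.
  have := ae_in_Cj Hc; apply: filterS3 FP sym => w -> [-> _]; exact.
exists P; split => //.
have psiC := rescales_ae reflect_rescales (extension_in_Cj psiP PC).
have mpsi : qmeasurable psi by case: psi2.
have starP : is_ext (qstar psi) (fun w => sg (P w)).
  have H := extension_star psiP.
  apply: (extension_ae (isometric_cV_fourier R _) H).
  - exact: (qmeasurable_conj (rescales_qmeasurable reflect_rescales mpsi)).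
  - by case: H => _ [].
  - by apply: filterS psiC => x /in_Cj_conj.
  - by apply: nearW.
have FsP := qfourierE starP.
have mw : measurable_fun setT (fun w : V => `|w ord0 ord0| ^- (2 * n.+1) : measurableTypeR R).
  apply: measurable_inverse => [|w]; last by rewrite exprn_ge0.
  apply: measurable_funX; apply: measurableT_comp => //.
  exact: (@measurable_cV_coord R (n.+1 + n.+1) ord0).
have E : {ae leb, forall w, qfourier (qstar psi) w = sg (P w)}.
  apply: filterS2 FsP sym => w -> [_ fl]; rewrite /two_sided fl.
  exact: qhalf_sum.
have mint (g : V -> quat R) : qmeasurable g -> measurable_fun setT
    (fun w => (qsq (g w) / `|w ord0 ord0| ^+ (2 * n.+1))%:E).
  by move=> mg; apply/measurable_EFinP/measurable_funM => //; exact: measurable_qsq.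
have sgq q : qsq (sg q) = qsq q by rewrite /sg /qsq /=; ring.
rewrite /admissibility_cst.
apply: ge0_ae_eq_integral => //.
- have := mint (qfourier (qstar psi)); under eq_fun do rewrite -qmod_sq; apply.
  have [] : is_qfourier (qstar psi) (qfourier (qstar psi)); last by move=> _ [].
  rewrite /qfourier; apply: (xgetPex (fun=> 0)); eexists; exact: is_qfourier_two_sided starP.
- exact: mint.
- by move=> w _; rewrite lee_fin mulr_ge0 ?sqr_ge0// invr_ge0 exprn_ge0.
- by move=> w _; rewrite lee_fin mulr_ge0 ?qsq_ge0// invr_ge0 exprn_ge0.
- by apply: filterS E => w -> _; rewrite qmod_sq sgq.
Qed.

End Symbol.

(** * Parseval's identity *)

Section Polarization.
Context d (T : measurableType d) (R : realType).
Variable mu : {measure set T -> \bar R}.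
Implicit Types f g : T -> quat R.

Lemma energy_EFin f : qL mu 2%:E f -> energy mu f = (\int[mu]_x qsq (f x))%:E.
Proof.
move=> /qL2P[mf fy]; rewrite /Rintegral fineK// ge0_fin_numE//; exact: energy_ge0.
Qed.

Lemma qL2_integrable_qsq f : qL mu 2%:E f -> mu.-integrable setT (EFin \o (fun x => qsq (f x))).
Proof.
move=> /qL2P[mf fy]; apply/integrableP; split; first exact: measurable_EFin_qsq.
by rewrite (_ : (\int[mu]_x _)%E = energy mu f)//; apply: eq_integral => x _; rewrite /= ger0_norm.
Qed.

Lemma qSc_qintegral_polar f g : qL mu 2%:E f -> qL mu 2%:E g ->
  qSc (qintegral mu (fun x => f x * qconj (g x))) =
  2^-1 * (fine (energy mu f) + fine (energy mu g) -
          fine (energy mu (fun x => f x - g x)%R)).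
Proof.
move=> f2 g2; have B2 := qL2B f2 g2; rewrite !energy_EFin// ![fine _]/=.
have fg1 := qL2M_qL1 f2 (qL2_conj g2); have [i0 _ _ _] := qL1_integrable fg1.
have fi := qL2_integrable_qsq f2; have gi := qL2_integrable_qsq g2.
have -> : \int[mu]_x qsq (f x - g x) =
    \int[mu]_x ((qsq (f x) + qsq (g x)) - 2 * q0 (f x * qconj (g x))).
  by apply: eq_Rintegral => x _; rewrite qsqB /qSc; ring.
have i2 : mu.-integrable setT (EFin \o (fun x => 2 * q0 (f x * qconj (g x)))).
  by have := integrableZl measurableT 2 i0; under [X in _.-integrable _ X]eq_fun do rewrite -EFinM.
have ifg : mu.-integrable setT (EFin \o (fun x => qsq (f x) + qsq (g x))).
  by have := integrableD measurableT fi gi; under [X in _.-integrable _ X]eq_fun do rewrite -EFinD.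
rewrite (RintegralB measurableT ifg i2) (RintegralD measurableT fi gi).
rewrite (RintegralZl 2 measurableT i0) [LHS]/qSc [LHS]/=; by field.
Qed.

Lemma qinner_EFin f g : qL mu 2%:E f -> qL mu 2%:E g ->
  qinner mu f g = (qSc (qintegral mu (fun x => f x * qconj (g x))))%:E.
Proof.
move=> f2 g2; have fg1 := qL2M_qL1 f2 (qL2_conj g2); have [i0 _ _ _] := qL1_integrable fg1.
by rewrite /qSc /= /Rintegral fineK//; exact: integrable_fin_num i0.
Qed.

End Polarization.

(** The transform is linear over the left quaternions, so that the four real
    components of its sesquilinear identity follow from the scalar part. *)
Lemma extension_parseval (R : realType) n (f g F G : 'cV[R]_(n.+1 + n.+1) -> quat R) :
  let leb := lebesgue_cV R (n.+1 + n.+1) in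
  is_extension leb leb (@cV_fourier R (n.+1 + n.+1)) f F ->
  is_extension leb leb (@cV_fourier R (n.+1 + n.+1)) g G ->
  qintegral leb (fun x => f x * qconj (g x)) = qintegral leb (fun w => F w * qconj (G w)).
Proof.
move=> leb fF gG.
have sc f' F' : is_extension leb leb (@cV_fourier R (n.+1 + n.+1)) f' F' ->
    qSc (qintegral leb (fun x => f' x * qconj (g x))) =
    qSc (qintegral leb (fun w => F' w * qconj (G w))).
  move=> fF'; have iso := isometric_cV_fourier R (n.+1 + n.+1).
  have [f2 F2 _] := fF'; have [g2 G2 _] := gG.
  rewrite !qSc_qintegral_polar// -(extension_isometry iso fF') -(extension_isometry iso gG).
  by rewrite -(extension_isometry iso (extensionB iso fF' gG)).
have scM c : qSc (c * qintegral leb (fun x => f x * qconj (g x))) =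
    qSc (c * qintegral leb (fun w => F w * qconj (G w))).
  have := sc _ _ (extensionMl c fF); have [f2 F2 _] := fF; have [g2 G2 _] := gG.
  rewrite -!qintegralMl; try by apply: qL2M_qL1 => //; exact: qL2_conj.
  by under eq_qintegral do rewrite -mulrA; under [in RHS]eq_qintegral do rewrite -mulrA.
set I := qintegral _ _ in scM *; set J := qintegral _ _ in scM *.
have [I0 I1 I2 I3] := q_component I; have [J0 J1 J2 J3] := q_component J.
apply: quatP; split.
- by have := scM 1; rewrite !mul1r.
- by rewrite I1 J1 scM.
- by rewrite I2 J2 scM.
- by rewrite I3 J3 scM.
Qed.

(** * The affine maps behind shearlets *)

Section AffineMaps.
Variables (R : realType) (m : nat).
Notation RR := (measurableTypeR R).
Notation V := 'cV[R]_m.+1.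
Notation leb1 := (@lebesgue_measure R).
Notation leb := (lebesgue_cV R m.+1).
Implicit Types (a d : R) (s : 'cV[R]_m) (t w x : V).

Lemma invmx_shear s :
  invmx (block_mx 1%:M s^T 0 1%:M : 'M[R]_(1 + m)) = block_mx 1%:M (- s^T) 0 1%:M.
Proof.
set A := block_mx _ _ _ _; set B := block_mx _ _ _ _.
have AB : A *m B = 1%:M.
  rewrite mulmx_block !mul1mx !mulmx1 !mul0mx !mulmx0 !addr0 !add0r addNr.
  by rewrite -scalar_mx_block.
have [uA _] := mulmx1_unit AB.
by rewrite -[RHS](mulKmx uA) AB mulmx1.
Qed.

Lemma invmx_dilation a d : (a == 0) = (d == 0) ->
  invmx (block_mx a%:M 0 0 d%:M : 'M[R]_(1 + m)) = block_mx a^-1%:M 0 0 d^-1%:M.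
Proof.
move=> ad; have [d0|d0] := eqVneq d 0.
  move: ad; rewrite d0 eqxx => /eqP ->.
  by rewrite -!scalar_mx_block invmx_scalar.
have a0 : a != 0 by rewrite ad.
rewrite invmx_block_diag ?invmx_scalar// unitmxE det_ublock !det_scalar.
by rewrite unitfE mulf_neq0// expf_neq0.
Qed.

(** x |-> A^-1 S^-1 (x - t) in coordinates, A being the diagonal matrix of a and
    of copies of d. The convention 0^-1 = 0 makes the formula valid for a = 0. *)
Definition shear_affine a d s t x : V :=
  let y := cV_uncons (x - t) in cV_cons (a^-1 * ((y.1 : R) - dotcV s y.2) : RR, d^-1 *: y.2).

(** The transpose of S A. *)
Definition shear_dual a d s w : V :=
  let v := cV_uncons w in cV_cons (a * (v.1 : R) : RR, d *: (v.2 + (v.1 : R) *: s)).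

Lemma dotcVE k (u v : 'cV[R]_k) : u^T *m v = (dotcV u v)%:M.
Proof.
apply/matrixP => i j; rewrite !ord1 !mxE mulr1n; apply: eq_bigr => l _.
by rewrite mxE.
Qed.

Lemma shear_affineE a d s t x : (a == 0) = (d == 0) ->
  invmx (block_mx a%:M 0 0 d%:M : 'M[R]_(1 + m)) *m
    (invmx (block_mx 1%:M s^T 0 1%:M : 'M[R]_(1 + m)) *m ((x - t) : 'cV[R]_(1 + m)))
  = shear_affine a d s t x.
Proof.
move=> ad; rewrite invmx_shear invmx_dilation// /shear_affine.
have [b [y ->]] := cV_consP (x - t); rewrite cV_consK /cV_cons /=.
rewrite !mul_block_col !mul0mx !mul1mx !addr0 !add0r mulNmx dotcVE !mul_scalar_mx.
by rewrite -[X in _ *: X]raddfB scale_scalar_mx.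
Qed.

Lemma rescales_shear_affine a d s t : a != 0 -> d != 0 ->
  rescales leb leb (shear_affine a d s t) (`|a| * `|d| ^+ m).
Proof.
move=> a0 d0; have ai : a^-1 != 0 by rewrite invr_eq0.
have di : d^-1 != 0 by rewrite invr_eq0.
pose phi (p : RR * 'cV[R]_m) : RR := a^-1 * ((p.1 : R) - dotcV s p.2).
have mphi : measurable_fun setT phi.
  apply: measurable_funM => //; apply: measurable_funB => //.
  exact: measurable_dotcV.
have r2 : rescales (leb1 \x lebesgue_cV R m)%E (leb1 \x lebesgue_cV R m)%E
    (fun p => (phi p, d^-1 *: p.2)) (`|a| * `|d| ^+ m).
  apply: (@rescales_fiber2 _ _ _ _ _ leb1 (lebesgue_cV R m) phi (fun y => d^-1 *: y)) => //.
  - by rewrite normr_gt0.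
  - by move=> y; have := rescales_affine (- dotcV s y) ai; rewrite normfV invrK.
  - have := rescales_cV_affine (0 : 'cV[R]_m) di; rewrite normfV exprVn invrK.
    by under [X in rescales _ _ X _]eq_fun do rewrite addr0.
have rt : rescales leb leb (fun x : V => x - t) 1.
  have := rescales_cV_affine (- t) (@oner_neq0 R); rewrite normr1 expr1n invr1.
  by under [X in rescales _ _ X _]eq_fun do rewrite scale1r.
rewrite -[X in rescales _ _ _ X]mul1r.
exact: (rescales_comp rt (rescales_cV_conj r2)).
Qed.

Lemma rescales_shear_dual a d s : a != 0 -> d != 0 ->
  rescales leb leb (shear_dual a d s) (`|a|^-1 * `|d| ^- m).
Proof.
move=> a0 d0; apply: (@rescales_cV_conj R m
  (fun p => (a * (p.1 : R) : RR, d *: (p.2 + (p.1 : R) *: s)))).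
apply: (@rescales_fiber1 _ _ _ _ _ leb1 (lebesgue_cV R m) (fun b : RR => a * (b : R) : RR)
  (fun p => d *: (p.2 + (p.1 : R) *: s))).
- apply: measurable_fun_cV => i; rewrite /cV_coord.
  rewrite (_ : _ \o _ = (fun p : RR * 'cV[R]_m =>
    d * ((p.2 : 'cV[R]_m) i ord0 + (p.1 : R) * s i ord0))).
    apply: measurable_funM => //; apply: measurable_funD.
      exact: (measurableT_comp (@measurable_cV_coord R m i) measurable_snd).
    by apply: measurable_funM.
  by apply/funext => p /=; rewrite !mxE.
- by rewrite invr_gt0 exprn_gt0// normr_gt0.
- by have := rescales_affine 0 a0; under [X in rescales _ _ X _]eq_fun do rewrite addr0.
- by move=> b; exact: (rescales_cV_affine ((b : R) *: s) d0).
Qed.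

Lemma dotcVDl k (u u' v : 'cV[R]_k) : dotcV (u + u') v = dotcV u v + dotcV u' v.
Proof. by rewrite /dotcV -big_split; apply: eq_bigr => i _; rewrite mxE mulrDl. Qed.

Lemma dotcVC k (u v : 'cV[R]_k) : dotcV u v = dotcV v u.
Proof. by apply: eq_bigr => i _; rewrite mulrC. Qed.

Lemma dotcVZl k c (u v : 'cV[R]_k) : dotcV (c *: u) v = c * dotcV u v.
Proof. by rewrite /dotcV mulr_sumr; apply: eq_bigr => i _; rewrite mxE mulrA. Qed.

Lemma dotcV_shear a d s t w x : a != 0 -> d != 0 ->
  dotcV w x = dotcV w t + dotcV (shear_dual a d s w) (shear_affine a d s t x).
Proof.
move=> a0 d0; rewrite -{1}(subrK t x) dotcVC dotcVDl addrC dotcVC [X in _ + X]dotcVC.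
congr (_ + _); rewrite /shear_affine /shear_dual.
have [b [y ->]] := cV_consP (x - t); have [c [v ->]] := cV_consP w.
rewrite !cV_consK /= !dotcV_cons dotcVZl dotcVDl dotcVZl.
rewrite !(dotcVC _ (d^-1 *: y)) !dotcVZl (dotcVC y v) (dotcVC y s); field.
exact/andP.
Qed.

Lemma cV_phaseD a d s t w x : a != 0 -> d != 0 ->
  cV_phase w x = cV_phase (shear_dual a d s w) (shear_affine a d s t x) + cV_phase w t.
Proof. by move=> a0 d0; rewrite /cV_phase (dotcV_shear s t w x a0 d0); ring. Qed.

(** A linear change of variables becomes its transposed inverse on frequencies, up
    to the determinant, and a translation becomes a right modulation. *)
Lemma extension_shear (c : R) a d s t (f g : V -> quat R) : a != 0 -> d != 0 ->
  is_extension leb leb (@cV_fourier R m.+1) f g ->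
  is_extension leb leb (@cV_fourier R m.+1) (fun x => c *: f (shear_affine a d s t x))
    (fun w => (c * (`|a| * `|d| ^+ m)) *: (g (shear_dual a d s w) * ej (cV_phase w t))).
Proof.
move=> a0 d0; have ra := rescales_shear_affine s t a0 d0.
have rd := rescales_shear_dual s a0 d0.
set D := `|a| * `|d| ^+ m in ra *; set E := `|a|^-1 * _ in rd.
have [_ Dp _] := ra; have [_ Ep _] := rd.
have mph : qmeasurable (fun w : V => ej (cV_phase w t)).
  by apply: qmeasurable_ej; exact: measurable_cV_phase.
apply: (extension_intertwine (isometric_cV_fourier R _)
  (A := fun f x => c *: f (shear_affine a d s t x))
  (B := fun g w => (c * D) *: (g (shear_dual a d s w) * ej (cV_phase w t)))).
- apply: (@qL2_bounded_energy _ _ _ _ _ _ _ _ (c ^+ 2 * D)) => [|h mh|h k x|h mh].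
  + by rewrite mulr_ge0 ?sqr_ge0 ?ltW.
  + by apply: qmeasurableZ => //; exact: rescales_qmeasurable ra mh.
  + exact: scalerBr.
  rewrite EFinM -muleA -(rescales_energy ra mh) -ge0_integralZl//; last 2 first.
  + exact: (measurable_EFin_qsq (rescales_qmeasurable ra mh)).
  + by rewrite lee_fin sqr_ge0.
  by rewrite /energy; under eq_integral do rewrite qsqZ EFinM.
- apply: (@qL2_bounded_energy _ _ _ _ _ _ _ _ ((c * D) ^+ 2 * E)) => [|h mh|h k w|h mh].
  + by rewrite mulr_ge0 ?sqr_ge0 ?ltW.
  + apply: qmeasurableZ => //; apply: qmeasurableM => //.
    exact: rescales_qmeasurable rd mh.
  + by rewrite mulrBl scalerBr.
  rewrite EFinM -muleA -(rescales_energy rd mh) -ge0_integralZl//; last 2 first.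
  + exact: (measurable_EFin_qsq (rescales_qmeasurable rd mh)).
  + by rewrite lee_fin sqr_ge0.
  by rewrite /energy; under eq_integral do rewrite qsqZ qsqM qsq_ej mulr1 EFinM.
- by move=> h h1; apply: qL1Z; exact: rescales_qL1 ra h1.
move=> h h1 h2 w; rewrite /cV_fourier.
have e1 := qL1_cV_phase (shear_dual a d s w) h1.
rewrite -scalerA [X in c *: X]scalerAl -(rescales_qintegral ra e1).
have e2 := rescales_qL1 ra e1.
rewrite -qintegralMr// -qintegralZ; last exact: qL1Mr.
apply: eq_qintegral => x.
by rewrite (cV_phaseD s t w x a0 d0) ejD mulrA -!scalerAl.
Qed.

End AffineMaps.

(** * The shearlet transform at a fixed scale and shear *)

Section FixedScale.
Variables (R : realType) (n' : nat).
Notation n := n'.+1.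
Notation m := (n' + n'.+1)%N.
Notation RR := (measurableTypeR R).
Notation V := 'cV[R]_(n + n).
Notation S := 'cV[R]_(n' + n).
Notation leb := (lebesgue_cV R (n + n)).
Notation is_ext := (is_extension leb leb (@cV_fourier R (n + n))).
Implicit Types (a : R) (s : S) (t : V).

Definition dil_root a : R := `|a| `^ ((2 * n)%:R^-1).
Definition dil_entry a : R := Num.sg a * dil_root a.
Definition shearlet_amp a : R := `|a| `^ ((4 * n)%:R^-1 - 1).

Lemma dil_root_gt0 a : a != 0 -> 0 < dil_root a.
Proof. by move=> a0; apply: powR_gt0; rewrite normr_gt0. Qed.

Lemma dil_root_ge0 a : 0 <= dil_root a. Proof. exact: powR_ge0. Qed.

Lemma dil_entry_eq0 a : (a == 0) = (dil_entry a == 0).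
Proof.
rewrite mulf_eq0 sgr_eq0; have [->//|a0] := eqVneq a 0.
by rewrite gt_eqF// dil_root_gt0.
Qed.

Lemma dil_entry_neq0 a : a != 0 -> dil_entry a != 0.
Proof. by rewrite dil_entry_eq0. Qed.

Lemma norm_dil_entry a : a != 0 -> `|dil_entry a| = dil_root a.
Proof.
by move=> a0; rewrite normrM normr_sg a0 mul1r ger0_norm// dil_root_ge0.
Qed.

Lemma shearletE (psi : V -> quat R) a s t x :
  shearlet psi a s t x = shearlet_amp a *: psi (shear_affine a (dil_entry a) s t x).
Proof.
rewrite /shearlet -/(shearlet_amp a); congr (_ *: psi _).
exact: (shear_affineE s t x (dil_entry_eq0 a)).
Qed.

(** The amplitude times the absolute value of the determinant of S A. *)
Definition shearlet_gain a : R := shearlet_amp a * (`|a| * `|dil_entry a| ^+ m).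

(** The frequency side of the transform: its inverse Fourier transform in t. *)
Definition shearlet_slice (P F : V -> quat R) a s (w : V) : quat R :=
  shearlet_gain a *: (F w * qconj (P (shear_dual a (dil_entry a) s w))).

Variables (psi P f F : V -> quat R).
Hypotheses (psiP : is_ext psi P) (fF : is_ext f F).
Hypothesis PC : {ae leb, forall w, in_Cj (P w)}.

Let mP : qmeasurable P. Proof. by case: psiP => _ []. Qed.
Let mF : qmeasurable F. Proof. by case: fF => _ []. Qed.

Lemma qL1_shearlet_slice a s : a != 0 -> qL leb 1%:E (shearlet_slice P F a s).
Proof.
move=> a0; apply: qL1Z; apply: qL2M_qL1; first by case: fF.
apply: qL2_conj; apply: (rescales_qL2 (rescales_shear_dual s a0 (dil_entry_neq0 a0))).
by case: psiP.
Qed.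

(** The symbol lies in a commutative plane that contains the modulations, so that
    translations of the shearlet become a modulation of the slice. *)
Lemma shearlet_transformE a s t : a != 0 ->
  shearlet_transform psi f (a, s, t) = cV_fourier (shearlet_slice P F a s) (- t).
Proof.
move=> a0; have d0 := dil_entry_neq0 a0.
have ext := extension_shear (shearlet_amp a) s t a0 d0 psiP.
have -> : shearlet_transform psi f (a, s, t) = qintegral leb (fun x =>
    f x * qconj (shearlet_amp a *: psi (shear_affine a (dil_entry a) s t x))).
  by apply: eq_qintegral => x; rewrite shearletE.
rewrite (extension_parseval fF ext).
have [_ [mext _] _] := ext.
apply: ae_qintegral.
- by apply: qmeasurableM => //; exact: qmeasurable_conj.
- by case: (qL1_cV_phase (- t) (qL1_shearlet_slice s a0)).
apply: filterS (rescales_ae (rescales_shear_dual s a0 d0) PC) => w Pw.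
rewrite /shearlet_slice -/(shearlet_gain a).
set p := P _ in Pw *.
have ph : cV_phase (- t) w = - cV_phase w t.
  by rewrite /cV_phase -[- t]scaleN1r dotcVZl dotcVC; ring.
have pC : in_Cj (qconj p) by case: Pw => p1 p3; rewrite /in_Cj /= p1 p3 oppr0.
rewrite ph -ej_conj -scalerAl -mulrA.
have -> : qconj p * qconj (ej (cV_phase w t)) = qconj (p * ej (cV_phase w t)).
  by rewrite qconjM ej_conj in_Cj_ejC.
by apply: quatP; split => /=; ring.
Qed.

Lemma energy_shearlet_transform a s : a != 0 -> qL leb 2%:E (shearlet_slice P F a s) ->
  (\int[leb]_t (qsq (shearlet_transform psi f (a, s, t)))%:E =
   energy leb (shearlet_slice P F a s))%E.
Proof.
move=> a0 G2; have G1 := qL1_shearlet_slice s a0.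
rewrite -(cV_plancherel G1 G2).
have N10 : (-1 : R) != 0 by rewrite oppr_eq0 oner_eq0.
have := rescales_cV_affine (0 : V) N10; rewrite normrN normr1 expr1n invr1.
under [X in rescales _ _ X _]eq_fun do rewrite addr0 scaleN1r.
move=> r; have mG : qmeasurable (cV_fourier (shearlet_slice P F a s)).
  by apply: qmeasurable_cV_fourier; case: G1.
rewrite -[RHS]mul1e -(rescales_energy r mG).
by apply: eq_integral => t _; rewrite shearlet_transformE.
Qed.

End FixedScale.

(** * Integration over scales and shears *)

Section ScaleWeight.
Variables (R : realType) (n' : nat).
Notation n := n'.+1.
Notation m := (n' + n'.+1)%N.
Notation gain := (@shearlet_gain R n').
Notation entry := (@dil_entry R n').
Notation root := (@dil_root R n').
Implicit Types a : R.

Lemma dil_rootX a : root a ^+ m.+1 = `|a|.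
Proof.
rewrite /dil_root -powR_mulrn ?powR_ge0// -powRrM.
have -> : m.+1 = (2 * n)%N by rewrite mul2n -addnn.
by rewrite mulVf ?pnatr_eq0// powRr1.
Qed.

Lemma shearlet_ampX a : a != 0 -> shearlet_amp n' a ^+ 2 = root a / `|a| ^+ 2.
Proof.
move=> a0; have na0 : `|a| != 0 by rewrite normr_eq0.
rewrite -powR_mulrn ?powR_ge0// -powRrM mulrBl mul1r.
have -> : (4 * n)%:R^-1 * 2 = (2 * n)%:R^-1 :> R.
  rewrite (_ : 4 * n = 2 * n * 2)%N; last by rewrite mulnAC.
  by rewrite natrM invfM -mulrA mulVf ?mulr1// pnatr_eq0.
rewrite powRD ?na0 ?implybT// powRN; congr (_ / _).
by rewrite powR_mulrn.
Qed.

(** The density of the parameter measure times the square of the factor of the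
    slices: the weight of the scale a in the total energy. *)
Definition shearlet_weight a : R := `|a| ^- (2 * n + 1) * gain a ^+ 2.

Lemma shearlet_weight_ge0 a : 0 <= shearlet_weight a.
Proof. by rewrite mulr_ge0 ?sqr_ge0// invr_ge0 exprn_ge0. Qed.

(** The exponent 2n of the admissibility condition comes out of the powers of |a|
    in the invariant density, the normalisation and the determinants. *)
Lemma shearlet_weightE a : a != 0 ->
  shearlet_weight a * `|entry a| ^- m = `|a| ^- (2 * n).
Proof.
move=> a0; have na0 : `|a| != 0 by rewrite normr_eq0.
have r0 : root a != 0 by rewrite gt_eqF// dil_root_gt0.
rewrite /shearlet_weight /shearlet_gain norm_dil_entry// exprMn shearlet_ampX//.
have E := dil_rootX a; rewrite exprS in E.
move: (2 * n)%N => k; rewrite addn1 [`|a| ^+ k.+1]exprS.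
transitivity (`|a|^-1 * (root a * root a ^+ m) * `|a| ^- k); last by rewrite E mulVf// mul1r.
by field; rewrite !expf_neq0 ?na0 ?r0.
Qed.

Lemma shearlet_weight0 : shearlet_weight 0 = 0.
Proof. by rewrite /shearlet_weight normr0 expr0n addn1/= invr0 mul0r. Qed.

End ScaleWeight.

Section MeasurableShear.
Context d (T : measurableType d) (R : realType).
Implicit Types a b : T -> R.

Lemma cV_uncons_lift m (x : 'cV[R]_m.+1) i : (cV_uncons x).2 i ord0 = x (lift ord0 i) ord0.
Proof. by have [c [v ->]] := cV_consP x; rewrite cV_consK cV_cons_lift. Qed.

Lemma measurable_inv a : measurable_fun setT a -> measurable_fun setT (fun p => (a p)^-1).
Proof.
move=> ma; rewrite (_ : (fun _ => _) = (fun p => a p * (a p ^+ 2)^-1)).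
  apply: measurable_funM => //; apply: measurable_inverse => [|p]; last exact: sqr_ge0.
  exact: measurable_funX.
apply/funext => p; have [->|ap] := eqVneq (a p) 0; first by rewrite invr0 mul0r.
by rewrite expr2 invfM mulrA divff// mul1r.
Qed.

Lemma measurable_dil_entry n' a : measurable_fun setT a ->
  measurable_fun setT (fun p => dil_entry n' (a p)).
Proof.
move=> ma; have mn : measurable_fun setT (fun p => `|a p|) by exact: measurableT_comp.
apply: measurable_funM; last exact: (measurableT_comp (measurable_powR _) mn).
rewrite (_ : (fun _ => _) = (fun p => a p * `|a p|^-1)).
  by apply: measurable_funM => //; exact: measurable_inv.
apply/funext => p; have [->|ap] := eqVneq (a p) 0; first by rewrite sgr0 mul0r.
by rewrite [X in X / _]numEsg mulfK// normr_eq0.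
Qed.

Lemma measurable_shearlet_gain n' a : measurable_fun setT a ->
  measurable_fun setT (fun p => shearlet_gain n' (a p)).
Proof.
move=> ma; have mn : measurable_fun setT (fun p => `|a p|) by exact: measurableT_comp.
apply: measurable_funM; first exact: (measurableT_comp (measurable_powR _) mn).
apply: measurable_funM => //; apply: measurable_funX.
by apply: measurableT_comp => //; exact: measurable_dil_entry.
Qed.

Lemma measurable_shear_dual m a b (s : T -> 'cV[R]_m) (w : T -> 'cV[R]_m.+1) :
  measurable_fun setT a -> measurable_fun setT b -> measurable_fun setT s ->
  measurable_fun setT w ->
  measurable_fun setT (fun p => shear_dual (a p) (b p) (s p) (w p)).
Proof.
move=> ma mb ms mw; apply: measurable_fun_cV => i.
have mwi j : measurable_fun setT (fun p => w p j ord0).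
  exact: (measurableT_comp (@measurable_cV_coord R m.+1 j) mw).
have [j ->|->] := unliftP ord0 i; last first.
  rewrite (_ : _ \o _ = (fun p => a p * w p ord0 ord0)); first exact: measurable_funM.
  by apply/funext => p; rewrite /= /cV_coord /shear_dual cV_cons_ord0.
rewrite (_ : _ \o _ = (fun p => b p * (w p (lift ord0 j) ord0 + w p ord0 ord0 * s p j ord0))).
  apply: measurable_funM => //; apply: measurable_funD => //; apply: measurable_funM => //.
  exact: (measurableT_comp (@measurable_cV_coord R m j) ms).
apply/funext => p; rewrite /= /cV_coord /shear_dual cV_cons_lift.
by have [c [v ->]] := cV_consP (w p); rewrite cV_consK cV_cons_lift cV_cons_ord0 !mxE.
Qed.

Lemma measurable_shear_affine m a b (s : T -> 'cV[R]_m) (t x : T -> 'cV[R]_m.+1) :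
  measurable_fun setT a -> measurable_fun setT b -> measurable_fun setT s ->
  measurable_fun setT t -> measurable_fun setT x ->
  measurable_fun setT (fun p => shear_affine (a p) (b p) (s p) (t p) (x p)).
Proof.
move=> ma mb ms mt mx; have mai := measurable_inv ma; have mbi := measurable_inv mb.
have mci k (u : T -> 'cV[R]_k) j : measurable_fun setT u ->
    measurable_fun setT (fun p => u p j ord0).
  by move=> mu; exact: (measurableT_comp (@measurable_cV_coord R k j) mu).
have my j : measurable_fun setT (fun p => (x p - t p) j ord0).
  rewrite (_ : (fun _ => _) = (fun p => x p j ord0 - t p j ord0)).
    by apply: measurable_funB; exact: mci.
  by apply/funext => p; rewrite !mxE.
have m2 : measurable_fun setT (fun p => (cV_uncons (x p - t p)).2).
  apply: measurable_fun_cV => i; rewrite (_ : _ \o _ = (fun p => (x p - t p) (lift ord0 i) ord0)).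
    exact: my.
  by apply/funext => p; exact: cV_uncons_lift.
apply: measurable_fun_cV => i.
have [j ->|->] := unliftP ord0 i; last first.
  rewrite (_ : _ \o _ = (fun p => (a p)^-1 * ((x p - t p) ord0 ord0 -
      dotcV (s p) (cV_uncons (x p - t p)).2))).
    by apply: measurable_funM => //; apply: measurable_funB => //; exact: measurable_dotcV.
  by apply/funext => p; rewrite /= /cV_coord /shear_affine cV_cons_ord0.
rewrite (_ : _ \o _ = (fun p => (b p)^-1 * (cV_uncons (x p - t p)).2 j ord0)).
  by apply: measurable_funM => //; exact: mci.
by apply/funext => p; rewrite /= /cV_coord /shear_affine cV_cons_lift [LHS]mxE.
Qed.

End MeasurableShear.

Section Calderon.
Variables (R : realType) (n' : nat).
Notation n := n'.+1.
Notation m := (n' + n'.+1)%N.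
Notation RR := (measurableTypeR R).
Notation V := 'cV[R]_(n + n).
Notation S := 'cV[R]_(n' + n).
Notation leb1 := (@lebesgue_measure R).
Notation lebS := (lebesgue_cV R (n' + n)).
Notation leb := (lebesgue_cV R (n + n)).
Notation weight := (@shearlet_weight R n').
Notation entry := (@dil_entry R n').

Variable P : V -> quat R.
Hypothesis mP : qmeasurable P.

Let H (b : RR) : \bar R := energy lebS (fun y => P (cV_cons (b, y))).

Let mPc : qmeasurable (fun p : RR * S => P (@cV_cons R m p)).
Proof. exact: (qmeasurable_comp (@measurable_cV_cons R m) mP). Qed.

Let mH : measurable_fun setT H.
Proof. exact: (measurable_energy1 lebS mPc). Qed.

Let H0 b : (0 <= H b)%E. Proof. exact: energy_ge0. Qed.

Let minv k : measurable_fun setT (fun b : RR => (`|b : R| ^- k : R)).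
Proof.
by apply: measurable_inv; apply: measurable_funX; exact: normr_measurable.
Qed.

Let mw : measurable_fun setT (fun a : RR => weight a : R).
Proof.
apply: measurable_funM; first exact: minv.
by apply: measurable_funX; exact: measurable_shearlet_gain.
Qed.

(* the energy of P on a hyperplane, weighted as in the admissibility constant *)
Let K (b : RR) : \bar R := ((`|b : R| ^- (2 * n))%:E * H b)%E.

Let mK : measurable_fun setT K.
Proof. by apply: emeasurable_funM => //; apply/measurable_EFinP; exact: minv. Qed.

Let K0 b : (0 <= K b)%E.
Proof. by apply: mule_ge0 => //; rewrite lee_fin invr_ge0 exprn_ge0. Qed.

Let weighted_energyE :
  (\int[leb]_w (qsq (P w) / `|w ord0 ord0| ^+ (2 * n))%:E = \int[leb1]_b K b)%E.
Proof.
have mf : measurable_fun setT (fun w : V => (qsq (P w) / `|w ord0 ord0| ^+ (2 * n))%:E).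
  apply/measurable_EFinP/measurable_funM; first exact: measurable_qsq.
  apply: measurable_inv; apply: measurable_funX; apply: measurableT_comp => //.
  exact: (@measurable_cV_coord R (n + n) ord0).
have f0 w : (0 <= (qsq (P w) / `|(w : V) ord0 ord0| ^+ (2 * n))%:E)%E.
  by rewrite lee_fin mulr_ge0// invr_ge0 exprn_ge0.
have [mc _ E] := rescales_cV_cons R m.
rewrite -[LHS]mul1e -(E _ mf f0) tonelli1//; last exact: measurableT_comp mf mc.
apply: eq_integral => b _; rewrite /K /H /energy -ge0_integralZl//; last first.
  apply: measurable_EFin_qsq; exact: (qmeasurable_slice1 b mPc).
by apply: eq_integral => y _; rewrite [cV_cons _ _ _]cV_cons_ord0 mulrC EFinM.
Qed.

(* the integral over the shears, for which (w2 + w1 s) is the variable; the scale a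
   enters only through a w1, as in the second change of variables *)
Let fiber (a : RR) (w1 : R) (w2 : S) : w1 != 0 ->
  (\int[lebS]_s ((weight a)%:E *
     (qsq (P (shear_dual (a : R) (entry a) s (@cV_cons R m (w1 : RR, w2)))))%:E) =
   `|w1|%R%:E * K (w1 * ((a : R) + 0) : RR)%R)%E.
Proof.
move=> w0; rewrite addr0 /K; have [->|a0] := eqVneq (a : R) 0.
  rewrite mulr0 shearlet_weight0 normr0 expr0n muln_eq0/= invr0.
  by rewrite mul0e mule0 integral0_eq// => s _; rewrite mul0e.
have e0 := dil_entry_neq0 n' a0; have ew0 : entry a * w1 != 0 by rewrite mulf_neq0.
have r := rescales_cV_affine (w1^-1 *: w2) ew0.
have mb : qmeasurable (fun y : S => P (cV_cons (w1 * (a : R) : RR, y))).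
  exact: (qmeasurable_slice1 (w1 * (a : R) : RR) mPc).
have E s : shear_dual (a : R) (entry a) s (@cV_cons R m (w1 : RR, w2)) =
    cV_cons (w1 * (a : R) : RR, (entry a * w1) *: (s + w1^-1 *: w2)).
  rewrite /shear_dual cV_consK /=; congr (cV_cons (_, _)); first exact: mulrC.
  by rewrite -scalerA; congr (_ *: _); rewrite scalerDr scalerA divff// scale1r addrC.
transitivity (\int[lebS]_s ((weight a)%:E *
    (qsq (P (cV_cons (w1 * (a : R) : RR, (entry a * w1) *: (s + w1^-1 *: w2)))%R))%:E))%E.
  by apply: eq_integral => s _; rewrite E.
rewrite ge0_integralZl//; last 2 first.
- exact: (measurable_EFin_qsq (rescales_qmeasurable r mb)).
- by rewrite lee_fin shearlet_weight_ge0.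
rewrite [X in (_ * X)%E](rescales_energy r mb) !muleA -!EFinM; congr (_%:E * _)%E.
rewrite normrM exprMn invfM mulrA shearlet_weightE//.
have w1n : `|w1| != 0 by rewrite normr_eq0.
have a1n : `|a : R| != 0 by rewrite normr_eq0.
rewrite normrM exprMn (_ : (2 * n = m.+1)%N); last by rewrite mul2n -addnn addSn.
rewrite [`|w1| ^+ m.+1]exprS.
by field; rewrite ?expf_neq0 ?w1n ?a1n.
Qed.

(** Scales and shears act on the frequencies off a hyperplane simply
    transitively; the admissibility integral is the integral over the orbit of
    w for the invariant measure, so that it does not depend on w. *)
Lemma calderon_integral (w : V) : w ord0 ord0 != 0 ->
  (\int[leb1 \x lebS]_p ((weight p.1)%:E *
     (qsq (P (shear_dual (p.1 : R) (entry p.1) p.2 w)))%:E) =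
   \int[leb]_l (qsq (P l) / `|l ord0 ord0| ^+ (2 * n))%:E)%E.
Proof.
have [w1 [w2 ->]] := cV_consP (w : 'cV[R]_m.+1); rewrite [cV_cons _ _ _]cV_cons_ord0 => w0.
rewrite weighted_energyE tonelli1; last 2 first.
- apply: emeasurable_funM; first by apply/measurable_EFinP; exact: measurableT_comp mw _.
  apply: measurable_EFin_qsq; apply: qmeasurable_comp mP.
  by apply: measurable_shear_dual => //; exact: measurable_dil_entry.
- by move=> p; apply: mule_ge0 => //; rewrite lee_fin shearlet_weight_ge0.
transitivity (\int[leb1]_a (`|w1 : R|%R%:E * K ((w1 : R) * ((a : R) + 0) : RR)%R))%E.
  by apply: eq_integral => a _; exact: fiber.
have [mk k0 E] := rescales_affine 0 w0.
rewrite ge0_integralZl//; last by apply: measurableT_comp mK mk.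
by rewrite (E K)// muleA -EFinM divff ?mul1e// normr_eq0.
Qed.

End Calderon.

(** * The measure of the parameters *)

Section Density.
Local Open Scope ereal_scope.
Context d (T : measurableType d) (R : realType).
Variables (mu nu : {measure set T -> \bar R}) (rho : T -> R).
Hypothesis mrho : measurable_fun setT rho.
Hypothesis rho0 : forall x, (0 <= rho x)%R.
Hypothesis nuE : forall A, measurable A -> nu A = \int[mu]_(x in A) (rho x)%:E.

Import HBNNSimple.

Let mErho : measurable_fun setT (EFin \o rho).
Proof. exact/measurable_EFinP. Qed.

Let density_indic (A : set T) : measurable A ->
  \int[nu]_x (\1_A x)%:E = \int[mu]_x ((rho x)%:E * (\1_A x)%:E).
Proof.
move=> mA; rewrite (integral_indic nu measurableT mA) setIT nuE//.
rewrite [LHS]integral_mkcond; apply: eq_integral => x _.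
by rewrite patchE indicE; case: (x \in A); rewrite ?mule1 ?mule0.
Qed.

Let density_nnsfun (h : {nnsfun T >-> R}) :
  \int[nu]_x (h x)%:E = \int[mu]_x ((rho x)%:E * (h x)%:E).
Proof.
have mh (r : R) : measurable (h @^-1` [set r]) by [].
have m1 (r : R) : measurable_fun setT (fun x => (\1_(h @^-1` [set r]) x)%:E : \bar R).
  by apply/measurable_EFinP.
under [LHS]eq_integral do rewrite fimfunE -fsumEFin//.
rewrite [LHS]ge0_integral_fsum//; last 2 first.
  - by move=> r; exact/measurable_EFinP/measurableT_comp.
  - by move=> n x _; rewrite EFinM nnfun_muleindic_ge0.
under [RHS]eq_integral.
  move=> x xD; rewrite fimfunE -fsumEFin// ge0_mule_fsumr; last first.
    by move=> r; rewrite EFinM nnfun_muleindic_ge0.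
  over.
rewrite [RHS]ge0_integral_fsum//; last 2 first.
  - by move=> r; apply: emeasurable_funM => //; exact/measurable_EFinP/measurableT_comp.
  - move=> r x _; rewrite EFinM; apply: mule_ge0; first by rewrite lee_fin.
    exact: nnfun_muleindic_ge0.
apply: eq_fsbigr => r; rewrite inE => -[z _ rz].
have r0 : 0 <= r%:E by rewrite lee_fin -rz.
transitivity (r%:E * \int[mu]_x ((rho x)%:E * (\1_(h @^-1` [set r]) x)%:E)).
  by rewrite integralZl_indic_nnsfun// density_indic.
rewrite -ge0_integralZl//; last 2 first.
- exact: emeasurable_funM.
- by move=> x _; rewrite mule_ge0// lee_fin.
by apply: eq_integral => x _; rewrite EFinM muleCA.
Qed.

(** Both sides are monotone limits over simple functions, for which the identity is
    the definition of the measure. *)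
Lemma integral_density (f : T -> \bar R) : measurable_fun setT f -> (forall x, 0 <= f x) ->
  \int[nu]_x f x = \int[mu]_x ((rho x)%:E * f x).
Proof.
move=> mf f0; pose f_ := nnsfun_approx measurableT mf.
have cf x : (EFin \o f_^~ x) @ \oo --> f x by apply: cvg_nnsfun_approx.
transitivity (limn (fun n => \int[nu]_x (f_ n x)%:E)).
  rewrite -monotone_convergence//=.
  - by apply: eq_integral => x _; apply/esym/cvg_lim => //; exact: cf.
  - by move=> n; exact/measurable_EFinP.
  - by move=> n x _; rewrite lee_fin.
  - by move=> x _ a b ab; rewrite lee_fin//; exact/lefP/nd_nnsfun_approx.
transitivity (limn (fun n => \int[mu]_x ((rho x)%:E * (f_ n x)%:E))).
  by congr (limn _); apply/funext => n; exact: density_nnsfun.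
rewrite -monotone_convergence//=.
- apply: eq_integral => x _; apply/cvg_lim => //.
  by apply: cvgeZl => //; exact: cf.
- by move=> n; apply: emeasurable_funM => //; exact/measurable_EFinP.
- by move=> n x _; rewrite mule_ge0// lee_fin.
- by move=> x _ a b ab; rewrite lee_wpmul2l ?lee_fin//; exact/lefP/nd_nnsfun_approx.
Qed.

End Density.

(** * Plancherel's identity for the shearlet transform *)

Section SigmaFiniteProduct.
Context d1 d2 (T1 : measurableType d1) (T2 : measurableType d2) (R : realType).
Variable m1 : {sigma_finite_measure set T1 -> \bar R}.
Variable m2 : {sigma_finite_measure set T2 -> \bar R}.

(** The product measure under a name of its own, to carry its structure of
    sigma-finite measure. *)
Definition sigma_product : set (T1 * T2) -> \bar R := (m1 \x m2)%E.

HB.instance Definition _ := Measure.on sigma_product.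
HB.instance Definition _ := Measure_isSigmaFinite.Build _ _ _ sigma_product
  (sigma_finite_product m1 m2).

End SigmaFiniteProduct.

Section ShearletPlancherel.
Variables (R : realType) (n' : nat).
Notation n := n'.+1.
Notation m := (n' + n'.+1)%N.
Notation RR := (measurableTypeR R).
Notation V := 'cV[R]_(n + n).
Notation S := 'cV[R]_(n' + n).
Notation leb1 := (@lebesgue_measure R).
Notation lebS := (lebesgue_cV R (n' + n)).
Notation leb := (lebesgue_cV R (n + n)).
Notation lebP := (sigma_product leb1 lebS).
Notation weight := (@shearlet_weight R n').
Notation entry := (@dil_entry R n').
Notation is_ext := (is_extension leb leb (@cV_fourier R (n + n))).

Definition shearlet_density (a : R) : R := `|a| ^- (2 * n + 1).

Lemma shearlet_density_ge0 a : 0 <= shearlet_density a.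
Proof. by rewrite invr_ge0 exprn_ge0. Qed.

Lemma measurable_shearlet_density d (T : measurableType d) (a : T -> R) :
  measurable_fun setT a -> measurable_fun setT (fun p => shearlet_density (a p)).
Proof.
by move=> ma; apply: measurable_inv; apply: measurable_funX; exact: measurableT_comp.
Qed.

(** The density vanishes at a = 0 by the convention on 0^-1. *)
Lemma integral_shearlet_measure (f : RR * S * V -> \bar R) : measurable_fun setT f ->
  (forall p, 0 <= f p)%E ->
  (\int[@shearlet_measure R n']_p f p =
   \int[lebP]_q ((shearlet_density q.1)%:E * \int[leb]_t f (q, t)))%E.
Proof.
move=> mf f0; pose rho (p : RR * S * V) : R := shearlet_density p.1.1.
have mrho : measurable_fun setT rho.
  by apply: measurable_shearlet_density; exact: measurableT_comp.
have rho0 p : 0 <= rho p by exact: shearlet_density_ge0.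
rewrite (integral_density mrho rho0 (mu := @param_lebesgue R n') _ mf f0); last first.
  move=> A mA.
  transitivity (\int[@param_lebesgue R n']_(p in A `&` [set p | p.1.1 != 0%R])
    ((`|p.1.1 : R| ^+ (2 * n + 1))^-1)%:E)%E; first by [].
  rewrite [LHS]integral_mkcond [RHS]integral_mkcond.
  apply: eq_integral => p _; rewrite !patchE in_setI.
  case: (p \in A) => //=; case: ifPn => //; rewrite notin_setE /= => /negP.
  rewrite negbK => /eqP p0.
  by rewrite /rho /shearlet_density p0 normr0 expr0n addn1 invr0.
have mg : measurable_fun setT (fun p : RR * S * V => (rho p)%:E * f p)%E.
  by apply: emeasurable_funM => //; exact/measurable_EFinP.
have g0 p : (0 <= (rho p)%:E * f p)%E by rewrite mule_ge0// lee_fin.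
transitivity (\int[lebP]_q \int[leb]_t ((rho (q, t))%:E * f (q, t)))%E.
  exact: (tonelli1 lebP leb mg g0).
apply: eq_integral => q _; rewrite -ge0_integralZl//.
- by apply: measurableT_comp mf _; exact: measurable_fun_pair.
- by rewrite lee_fin shearlet_density_ge0.
Qed.

(** Joint measurability in the parameters, which the explicit form of the affine maps
    makes visible also at a = 0. *)
Lemma qmeasurable_shearlet_transform (psi f : V -> quat R) : qmeasurable psi -> qmeasurable f ->
  qmeasurable (shearlet_transform psi f).
Proof.
move=> mpsi mf.
pose F (q : (RR * S * V) * V) := f q.2 *
  qconj (shearlet_amp n' q.1.1.1 *: psi (shear_affine (q.1.1.1 : R) (entry q.1.1.1) q.1.1.2 q.1.2 q.2)).
have mF : qmeasurable F.
  have m1 : measurable_fun setT (fun q : (RR * S * V) * V => q.1.1.1 : R).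
    by do 2 apply: measurableT_comp => //.
  apply: qmeasurableM; first exact: (qmeasurable_comp measurable_snd mf).
  apply: qmeasurable_conj; apply: qmeasurableZ.
    apply: (measurableT_comp (measurable_powR _)); exact: measurableT_comp.
  apply: qmeasurable_comp mpsi; apply: measurable_shear_affine => //.
  - exact: measurable_dil_entry.
  - by do 2 apply: measurableT_comp => //.
  - exact: measurableT_comp.
rewrite (_ : shearlet_transform psi f = (fun p => qintegral leb (fun x => F (p, x)))).
  exact: qmeasurable_qintegral2.
apply/funext => -[[a s] t]; apply: eq_qintegral => x.
by rewrite shearletE.
Qed.

Section Symbol.
Variables (psi P f F : V -> quat R).
Hypotheses (psiP : is_ext psi P) (fF : is_ext f F).
Hypothesis PC : {ae leb, forall w, in_Cj (P w)}.
Let C : \bar R := (\int[leb]_w (qsq (P w) / `|w ord0 ord0| ^+ (2 * n))%:E)%E.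
Hypothesis Cfin : (C < +oo)%E.

Let C0 : (0 <= C)%E.
Proof. by apply: integral_ge0 => w _; rewrite lee_fin mulr_ge0// invr_ge0 exprn_ge0. Qed.

Let mP : qmeasurable P. Proof. by case: psiP => _ []. Qed.
Let mF : qmeasurable F. Proof. by case: fF => _ []. Qed.

Let slice (p : RR * S) := shearlet_slice P F (p.1 : R) p.2.

Let Phi (q : (RR * S) * V) : \bar R :=
  ((qsq (F q.2))%:E * ((weight q.1.1)%:E *
   (qsq (P (shear_dual (q.1.1 : R) (entry q.1.1) q.1.2 q.2)))%:E))%E.

Let mPd : qmeasurable (fun q : (RR * S) * V =>
  P (shear_dual (q.1.1 : R) (entry q.1.1) q.1.2 q.2)).
Proof.
have m1 : measurable_fun setT (fun q : (RR * S) * V => q.1.1 : R) by exact: measurableT_comp.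
apply: qmeasurable_comp mP; apply: measurable_shear_dual => //.
- exact: measurable_dil_entry.
- exact: measurableT_comp.
Qed.

Let mslice : qmeasurable (fun q : (RR * S) * V => slice q.1 q.2).
Proof.
have m1 : measurable_fun setT (fun q : (RR * S) * V => q.1.1 : R) by exact: measurableT_comp.
apply: qmeasurableZ; first exact: measurable_shearlet_gain.
apply: qmeasurableM; first exact: (qmeasurable_comp measurable_snd mF).
exact: qmeasurable_conj.
Qed.

Let mPhi : measurable_fun setT Phi.
Proof.
have m1 : measurable_fun setT (fun q : (RR * S) * V => q.1.1 : R) by exact: measurableT_comp.
apply: emeasurable_funM.
  by apply: measurable_EFin_qsq; exact: (qmeasurable_comp measurable_snd mF).
apply: emeasurable_funM; last exact: measurable_EFin_qsq.
apply/measurable_EFinP; apply: measurable_funM; first exact: measurable_shearlet_density.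
by apply: measurable_funX; exact: measurable_shearlet_gain.
Qed.

Let Phi0 q : (0 <= Phi q)%E.
Proof. by rewrite !mule_ge0// lee_fin shearlet_weight_ge0. Qed.

Let density_energy p :
  ((shearlet_density p.1)%:E * energy leb (slice p) = \int[leb]_w Phi (p, w))%E.
Proof.
rewrite /energy -ge0_integralZl//; last 2 first.
- exact: (measurable_EFin_qsq (qmeasurable_slice1 p mslice)).
- by rewrite lee_fin shearlet_density_ge0.
apply: eq_integral => w _; rewrite /Phi /slice qsqZ qsqM qsq_conj -!EFinM; congr EFin.
by rewrite /shearlet_weight /shearlet_density; ring.
Qed.

(* Tonelli exchanges parameters and frequencies; almost every frequency is off the
   hyperplane that the Calderon integral excludes *)
Let total : (\int[lebP]_p ((shearlet_density p.1)%:E * energy leb (slice p)) =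
  C * energy leb F)%E.
Proof.
transitivity (\int[lebP]_p \int[leb]_w Phi (p, w))%E.
  by apply: eq_integral => p _; exact: density_energy.
rewrite -(tonelli1 lebP leb mPhi Phi0) (tonelli2 lebP leb mPhi Phi0) muleC /energy -ge0_integralZr//; last exact: measurable_EFin_qsq.
apply: ge0_ae_eq_integral => //.
- exact: (measurable_fun_fubini_tonelli_G (m1 := lebP) _ mPhi Phi0).
- by apply: emeasurable_funM => //; exact: measurable_EFin_qsq.
- by move=> w _; exact: integral_ge0.
- by move=> w _; apply: mule_ge0 => //; exact: C0.
apply: filterS (coordinate_neq0_ae R (ord0 : 'I_(n + n))) => w w0 _.
transitivity ((qsq (F w))%:E * \int[lebP]_p ((weight p.1)%:E *
    (qsq (P (shear_dual (p.1 : R) (entry p.1) p.2 w)))%:E))%E; last first.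
  by congr (_ * _)%E; exact: calderon_integral.
rewrite -ge0_integralZl//.
- have mp : measurable_fun setT (fun p : RR * S => (p, w)) by exact: measurable_fun_pair.
  apply: emeasurable_funM; last exact: (measurable_EFin_qsq (qmeasurable_slice2 w mPd)).
  apply/measurable_EFinP; apply: measurable_funM; first exact: measurable_shearlet_density.
  by apply: measurable_funX; exact: measurable_shearlet_gain.
- by move=> p _; apply: mule_ge0 => //; rewrite lee_fin shearlet_weight_ge0.
Qed.

(** The slices are square integrable for almost all scales and shears only, and this
    is known from the finiteness of the total energy. *)
Lemma shearlet_plancherel :
  (energy (@shearlet_measure R n') (shearlet_transform psi f) = C * energy leb f)%E.
Proof.
have iso := isometric_cV_fourier R (n + n).
have mpsi : qmeasurable psi by case: psiP => -[].
have f2 : qL leb 2%:E f by case: fF.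
have mf : qmeasurable f by case: f2.
have mSH := qmeasurable_shearlet_transform mpsi mf.
rewrite -(extension_isometry iso fF) -total /energy.
rewrite (integral_shearlet_measure (measurable_EFin_qsq mSH) (fun p => EFin_qsq_ge0 _)).
have mdens : measurable_fun setT (fun p : RR * S => (shearlet_density p.1)%:E).
  by apply/measurable_EFinP; exact: measurable_shearlet_density.
have mtot : measurable_fun setT (fun p : RR * S =>
    ((shearlet_density p.1)%:E * energy leb (slice p))%E).
  by apply: emeasurable_funM => //; exact: (measurable_energy1 leb mslice).
apply: ge0_ae_eq_integral => //.
- by apply: emeasurable_funM => //; exact: (measurable_energy1 leb mSH).
- by move=> p _; rewrite mule_ge0 ?lee_fin ?shearlet_density_ge0// integral_ge0.
- by move=> p _; rewrite mule_ge0 ?lee_fin ?shearlet_density_ge0// integral_ge0.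
have fin : (\int[lebP]_p ((shearlet_density p.1)%:E * energy leb (slice p)) < +oo)%E.
  rewrite total (extension_isometry iso fF); have /qL2P[_ fy] := f2.
  by apply: lte_mul_pinfty fy; [exact: C0|rewrite ge0_fin_numE//; exact: C0].
have := ae_fin_integral mtot _ fin.
have pos p : (0 <= (shearlet_density (p : RR * S).1)%:E * energy leb (slice p))%E.
  by rewrite mule_ge0 ?lee_fin ?shearlet_density_ge0// energy_ge0.
move=> /(_ pos); apply: filterS => -[a s] /= fine_as _.
have [a0|a0] := eqVneq (a : R) 0.
  by rewrite /shearlet_density a0 normr0 expr0n addn1 invr0 !mul0e.
congr (_ * _)%E; apply: (energy_shearlet_transform psiP fF PC a0).
apply/qL2P; split; first by case: (qL1_shearlet_slice psiP fF s a0).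
have dpos : 0 < shearlet_density a by rewrite invr_gt0 exprn_gt0// normr_gt0.
rewrite ltey; apply/eqP => E; move: fine_as; rewrite /slice /= E.
by rewrite gt0_muley ?lte_fin// ltxx.
Qed.

End Symbol.
End ShearletPlancherel.

(** At a = 0 the amplitude 0^(1/(4n) - 1) vanishes, and with it the shearlet, so that
    no parameter is exceptional. *)
Lemma shearlet_transformB (R : realType) (n : nat) (psi f g : 'cV[R]_(n.+1 + n.+1) -> quat R) p :
  let leb := lebesgue_cV R (n.+1 + n.+1) in
  qL leb 2%:E psi -> qL leb 2%:E f -> qL leb 2%:E g ->
  shearlet_transform psi (fun x => f x - g x) p =
  shearlet_transform psi f p - shearlet_transform psi g p.
Proof.
move=> leb psi2 f2 g2; case: p => -[a s] t.
have s2 : qL leb 2%:E (shearlet psi a s t).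
  have -> : shearlet psi a s t = (fun x => Quat (shearlet_amp n a) 0 0 0 *
      psi (shear_affine (a : R) (dil_entry n a) s t x)).
    apply/funext => x; rewrite shearletE.
    by apply: quatP; split => /=; ring.
  have [->|a0] := eqVneq (a : R) 0.
    rewrite (_ : (fun _ => _) = (fun _ => 0)).
      apply/qL2P; split; first exact: qmeasurable_cst.
      by rewrite /energy; under eq_integral do rewrite qsq0; rewrite integral0 ltry.
    apply/funext => x; rewrite /shearlet_amp normr0 powR0.
      by apply: quatP; split => /=; ring.
    by rewrite subr_eq0 invr_eq1 (eqr_nat R _ 1) mulnS.
  apply: qL2Ml.
  exact: (rescales_qL2 (rescales_shear_affine s t a0 (dil_entry_neq0 n a0)) psi2).
rewrite /shearlet_transform -qintegralB; try by apply: qL2M_qL1 => //; exact: qL2_conj.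
by apply: eq_qintegral => x; rewrite mulrBl.
Qed.

Theorem theorem3 (R : realType) (n : nat)
    (psi : 'cV[R]_(n.+1 + n.+1) -> quat R)
    (psi_adm : admissible_shearlet psi)
    (psi_comm : forall t : 'cV[R]_n.+1,
      {ae lebesgue_cV R (n.+1 + n.+1), forall w,
        qfourier psi w * qexp qj (- (2 * pi * dotcV (dsubmx w) t)) =
        qexp qj (- (2 * pi * dotcV (dsubmx w) t)) * qfourier psi w})
    (psi_j_comm : forall t : 'cV[R]_n.+1,
      {ae lebesgue_cV R (n.+1 + n.+1), forall w,
        qfourier (fun z => qj * psi z) w *
          qexp qj (- (2 * pi * dotcV (dsubmx w) t)) =
        qj * qexp qj (- (2 * pi * dotcV (dsubmx w) t)) * qfourier psi w}) :
  (forall f g : 'cV[R]_(n.+1 + n.+1) -> quat R,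
    qL (lebesgue_cV R (n.+1 + n.+1)) 2%:E f ->
    qL (lebesgue_cV R (n.+1 + n.+1)) 2%:E g ->
    [/\ qL (@shearlet_measure R n) 2%:E (shearlet_transform psi f),
        qL (@shearlet_measure R n) 2%:E (shearlet_transform psi g) &
        qinner (@shearlet_measure R n)
          (shearlet_transform psi f) (shearlet_transform psi g) =
        (admissibility_cst psi *
         qinner (lebesgue_cV R (n.+1 + n.+1)) f g)%E]) /\
  (forall f : 'cV[R]_(n.+1 + n.+1) -> quat R,
    qL (lebesgue_cV R (n.+1 + n.+1)) 2%:E f ->
    (\int[@shearlet_measure R n]_p
        (qmod (shearlet_transform psi f p) ^+ 2)%:E =
     admissibility_cst psi *
       qnorm (lebesgue_cV R (n.+1 + n.+1)) 2%:E f ^+ 2)%E).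
Proof.
case: psi_adm => psi2 Cfin.
have [P [psiP PC CE]] := shearlet_symbol psi2 psi_comm psi_j_comm.
set C := admissibility_cst psi in Cfin CE *.
set leb := lebesgue_cV R (n.+1 + n.+1).
have C0 : (0 <= C)%E.
  by rewrite CE; apply: integral_ge0 => w _; rewrite lee_fin mulr_ge0// invr_ge0 exprn_ge0.
have Cf : C \is a fin_num by rewrite ge0_fin_numE.
have planch f : qL leb 2%:E f ->
    energy (@shearlet_measure R n) (shearlet_transform psi f) = (C * energy leb f)%E.
  move=> f2; have [F fF] := cV_fourier_extension_exists f2.
  by rewrite CE; apply: (shearlet_plancherel psiP fF PC); rewrite -CE.
have SH2 f : qL leb 2%:E f -> qL (@shearlet_measure R n) 2%:E (shearlet_transform psi f).
  move=> f2; have /qL2P[mf fy] := f2; apply/qL2P; rewrite planch//; split.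
    by apply: qmeasurable_shearlet_transform => //; case: psi2.
  exact: lte_mul_pinfty.
split=> [f g f2 g2|f f2]; last first.
  rewrite qnorm2_sq -planch//.
  by apply: eq_integral => p _; rewrite qmod_sq.
split; [exact: SH2|exact: SH2|].
have fin h : qL leb 2%:E h ->
    fine (energy (@shearlet_measure R n) (shearlet_transform psi h)) =
    fine C * fine (energy leb h).
  by move=> h2; rewrite planch// fineM// (energy_EFin h2).
rewrite (qinner_EFin (SH2 f f2) (SH2 g g2)) (qinner_EFin f2 g2).
rewrite (qSc_qintegral_polar (SH2 f f2) (SH2 g g2)) (qSc_qintegral_polar f2 g2).
transitivity ((2^-1 * (fine C * fine (energy leb f) + fine C * fine (energy leb g) -
    fine C * fine (energy leb (fun x => f x - g x)%R)))%:E).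
  congr ((2^-1 * (_ + _ - _))%:E); [exact: fin|exact: fin|].
  rewrite -(fin _ (qL2B f2 g2)); congr (fine (energy _ _)).
  by apply/funext => p; rewrite shearlet_transformB.
by rewrite -[X in _ = (X * _)%E](fineK Cf) -EFinM; congr (_%:E); ring.
Qed.
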